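(* Let $x>0$, and let $W^x$ and $\hat W^x$ be the workload processes of the baseline system and of the admission-controlled system described in the context, with common type distribution $H$, common service kernel $\Psi$ and common joining function $\Phi$. Suppose that the service requirement of each customer is independent of his type, in the sense that $\Psi(\cdot;y)$ is constant in $y\in\mathcal Y$. Let $\tau_x=\inf\{t\ge0:W^x_t=0\}$, $\hat\tau_x=\inf\{t\ge0:\hat W^x_t=0\}$, and $$V^x_t=W^x_{t\wedge\tau_x},\qquad \hat V^x_t=\hat W^x_{t\wedge\hat\tau_x},\qquad t\ge0.$$ Then the admission control policy is initially busy-period effective, that is, $$\hat V^x\preceq_{\mathrm{st}}V^x.$$
   Context: **Common data.** $\mathcal Y$ is an arbitrary topological space (with its Borel $\sigma$-algebra); $H$ is a probability distribution on $\mathcal Y$; $\Psi(\cdot;\cdot)$ is a probability kernel ($\Psi(\cdot;y)$ is a distribution on $(0,\infty)$ for each $y\in\mathcal Y$, and $y\mapsto\Psi(s;y)$ is Borel for each $s>0$); $\Phi:\mathcal Y\times[0,\infty)\to\{0,1\}$ is measurable; $x>0$. Write $a^-=\min(a,0)$. **Baseline system**, on a probability space $(\Omega,\mathcal F,\mathbb P)$. The random arrival epochs $\mathcal T=(T_n)_{n\ge1}$ satisfy $0<T_1<T_2<\cdots$ a.s.; customer $n$ has type $Y_n\in\mathcal Y$ and service requirement $S_n\in(0,\infty)$; $I_n\in\{0,1\}$ indicates whether customer $n$ joins ($1$) or balks ($0$). The workload satisfies $W^x_0=x$ and, for $t>0$, $$W^x_t=L^x_t-\inf_{0\le s<t}(L^x_s)^-,\qquad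 L^x_t=x+\sum_{n:T_n\le t}I_nS_n-t .$$ The following hold conditionally on $\sigma(\mathcal T)$, for every $n\ge1$: - (A1) $Y_n\sim H$ and $Y_n$ is independent of $\sigma(\{S_j:1\le j<n\}\cup\{Y_j:1\le j<n\})$. - (A2) $I_n=\Phi(Y_n,W^x_{T_n-})$. - (A3) The $S_n$ are identically distributed, and the conditional distribution of $S_n$ given $\sigma(\{W^x_t:0\le t<T_n\}\cup\{Y_j:1\le j\le n\})$ is $\Psi(\cdot;Y_n)$. **Admission-controlled system**, on a probability space $(\hat\Omega,\hat{\mathcal F},\hat{\mathbb P})$, possibly different from the first. The random arrival epochs $\hat{\mathcal T}=(\hat T_n)_{n\ge1}$ satisfy $0<\hat T_1<\hat T_2<\cdots$ a.s.; customer $n$ has type $\hat Y_n\in\mathcal Y$ and service requirement $\hat S_n\in(0,\infty)$; $\hat Z_n\in(0,1)$ is the dispatcher's randomization variable; $\hat I_n\in\{0,1\}$ is the customer's joining decision and $\hat J_n\in\{0,1\}$ is the dispatcher's admission decision. The workload satisfies $\hat W^x_0=x$ and, for $t>0$, $$\hat W^x_t=\hat L^x_t-\inf_{0\le s<t}(\hat L^x_s)^-,\qquad \hat L^x_t=x+\sum_{n:\hat T_n\le t}\hat I_n\hat J_n\hat S_n-t .$$ Assume: - (Â0) $\hat{\mathcal T}$ under $\hat{\mathbb P}$ has the same distribution as $\mathcal T$ under $\mathbb P$. The following hold conditionally on $\sigma(\hat{\mathcal T})$, for every $n\ge1$: - (Â1) $\hat Y_n\sim H$ and $\hat Y_n$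 is independent of $\sigma(\{\hat S_j:1\le j<n\}\cup\{\hat Y_j:1\le j<n\}\cup\{\hat Z_j:1\le j\le n\})$. - (Â2) $\hat I_n=\Phi(\hat Y_n,\hat W^x_{\hat T_n-})$. - (Â3) The conditional distribution of $\hat S_n$ given $\sigma(\{\hat W^x_t:0\le t<\hat T_n\}\cup\{\hat Y_j:1\le j\le n\}\cup\{\hat Z_j:1\le j\le n\})$ is $\Psi(\cdot;\hat Y_n)$. - (Â4) $\hat Z_n$ is uniform on $(0,1)$ and independent of $\sigma(\{\hat W^x_t:0\le t<\hat T_n\}\cup\{\hat Y_j:1\le j\le n\}\cup\{\hat Z_j:1\le j<n\})$. - (Â5) $\hat J_n$ is measurable with respect to the $\sigma$-algebra generated by $\{\hat W^x_t:0\le t<\hat T_n\}$ and $\hat Z_n$. (Because these are imposed conditionally on the arrival epochs, the epochs may be treated as a fixed increasing sequence.) Both workload processes have real-valued right-continuous sample paths with left limits. No stability is assumed: $\tau_x,\hat\tau_x$ may be infinite, with $\inf\emptyset=\infty$. **Stochastic order.** Let $\mathcal D([0,\infty))$ be the Skorokhod space of real-valued right-continuous functions with left limits on $[0,\infty)$, and write $u\preceq v$ if $u(t)\le v(t)$ for all $t\ge0$. A measurable $f:\mathcal D([0,\infty))\to[0,\infty)$ is nondecreasing if $u\preceq v$ implies $f(u)\le f(v)$. Then $\hat V^x\preceq_{\mathrm{st}}V^x$ means $\hat{\mathbb E}f(\hat V^x)\le\mathbb E f(V^x)$ for every nonnegative nondecreasing measurable functional $f:\mathcal D([0,\infty))\to[0,\infty)$.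 The policy is called initially busy-period effective if this holds. *)

(* Defs.v *)
From HB Require Import structures.
From mathcomp Require Import all_boot all_order all_algebra.
From mathcomp Require Import all_classical all_reals all_analysis.
From mathcomp Require Import measurable_realfun.

Set Implicit Arguments.
Unset Strict Implicit.
Unset Printing Implicit Defensive.

Import Order.TTheory GRing.Theory Num.Theory.
Import numFieldNormedType.Exports.

Local Open Scope classical_set_scope.
Local Open Scope ring_scope.

Definition cadlag (R : realType) (u : R -> R) : Prop :=
  (forall t, 0 <= t -> u s @[s --> t^'+] --> u t) /\
  (forall t, 0 < t -> cvg (u s @[s --> t^'-])).

(* Paths are indexed by [0, oo); values at negative times are frozen to 0 so
   that Leibniz equality is equality of functions on [0, oo). *)
Record skorokhod (R : realType) := Skorokhod {
  path_of :> R -> R;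
  path_of_neg : forall t, t < 0 -> path_of t = 0;
  path_of_cadlag : cadlag path_of }.

Lemma cadlag0 (R : realType) : cadlag (fun _ : R => 0 : R).
Proof. by split=> t _; [exact: cvg_cst|exact: is_cvg_cst]. Qed.

Section skorokhod_instances.
Variable R : realType.

HB.instance Definition _ := gen_eqMixin (skorokhod R).
HB.instance Definition _ := gen_choiceMixin (skorokhod R).
HB.instance Definition _ := isPointed.Build (skorokhod R)
  (@Skorokhod R (fun _ => 0) (fun _ _ => erefl) (@cadlag0 R)).

End skorokhod_instances.

(* Increasing bijections of [0, oo); continuity is automatic. *)
Definition time_change (R : realType) (l : R -> R) : Prop :=
  set_bij `[0, +oo[ `[0, +oo[ l /\
  (forall s t, 0 <= s -> s < t -> l s < l t).

(* A base of neighbourhoods of [u] for the J1 topology: [v_k] tends to [u] iff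
   there are time changes [l_k] such that [sup_s |l_k s - s|] tends to 0 and
   [sup_(s <= n) |v_k (l_k s) - u s|] tends to 0 for every [n]
   (Jacod and Shiryaev, Theorem VI.1.14). *)
Definition skorokhod_nbhs (R : realType) (u : skorokhod R) (n : nat) (e : R) :
    set (skorokhod R) :=
  [set v | exists l, [/\ time_change l,
     forall s, 0 <= s -> `|l s - s| < e &
     forall s, 0 <= s <= n%:R -> `|v (l s) - u s| < e]].

Definition skorokhod_open (R : realType) (A : set (skorokhod R)) : Prop :=
  forall u, A u -> exists n e, 0 < e /\ skorokhod_nbhs u n e `<=` A.

Section skorokhod_topology.
Variable R : realType.

Lemma skorokhod_openT : @skorokhod_open R setT.
Proof. by move=> u _; exists 0%N, 1. Qed.

Lemma skorokhod_nbhs_sub (u : skorokhod R) (m n : nat) (e f : R) :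
  (m <= n)%N -> f <= e -> skorokhod_nbhs u n f `<=` skorokhod_nbhs u m e.
Proof.
move=> mn fe v [l [tl l1 l2]]; exists l; split=> // s.
  by move=> /l1 /lt_le_trans; apply.
move=> /andP[s0 sm]; apply: lt_le_trans fe; apply: l2.
by rewrite s0 (le_trans sm)// ler_nat.
Qed.

Lemma skorokhod_openI : setI_closed (@skorokhod_open R).
Proof.
move=> A B oA oB u [/oA[m [e [e0 Ae]]] /oB[n [f [f0 Bf]]]].
exists (maxn m n), (Num.min e f); split; first by rewrite lt_min e0.
move=> v uv; split; [apply: Ae|apply: Bf]; apply: skorokhod_nbhs_sub uv.
- exact: leq_maxl.
- by rewrite ge_min lexx.
- exact: leq_maxr.
- by rewrite ge_min lexx orbT.
Qed.

Lemma skorokhod_open_bigU (I : Type) (f : I -> set (skorokhod R)) :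
  (forall i, skorokhod_open (f i)) -> skorokhod_open (\bigcup_i f i).
Proof.
move=> of_ u [i _ /of_[n [e [e0 sub]]]]; exists n, e; split=> // v /sub fv.
by exists i.
Qed.

HB.instance Definition _ := isOpenTopological.Build (skorokhod R)
  skorokhod_openT skorokhod_openI skorokhod_open_bigU.

End skorokhod_topology.

Definition borel (T : ptopologicalType) := g_sigma_algebraType (@open T).

Definition pathwise_le (R : realType) (u v : skorokhod R) : Prop :=
  forall t, 0 <= t -> u t <= v t.

Definition stoch_le (R : realType) (d1 d2 : measure_display)
    (O1 : measurableType d1) (O2 : measurableType d2)
    (P1 : probability O1 R) (P2 : probability O2 R)
    (V1 : O1 -> skorokhod R) (V2 : O2 -> skorokhod R) : Prop :=
  forall f : skorokhod R -> R,
    @measurable_fun _ _ (borel (skorokhod R)) (R) setT f ->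
    (forall u, 0 <= f u) ->
    (forall u v, pathwise_le u v -> f u <= f v) ->
    ('E_P1[f \o V1] <= 'E_P2[f \o V2])%E.

Definition hitting0 (R : realType) (u : skorokhod R) : \bar R :=
  ereal_inf [set t%:E | t in [set t : R | 0 <= t /\ u t = 0]].

Definition stop_fun (R : realType) (u : skorokhod R) (tau : \bar R) (t : R) : R :=
  if t < 0 then 0 else u (fine (Order.min t%:E tau)).

Lemma stop_fun_neg (R : realType) (u : skorokhod R) (tau : \bar R) (t : R) :
  t < 0 -> stop_fun u tau t = 0.
Proof. by rewrite /stop_fun => ->. Qed.

Lemma stop_fun_cadlag (R : realType) (u : skorokhod R) (tau : \bar R) :
  cadlag (stop_fun u tau).
Proof.
have [ur ul] := path_of_cadlag u.
split=> t t0.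
- have [tlt|tget] := ltP t%:E tau.
  + have -> : stop_fun u tau t = u t.
      by rewrite /stop_fun ltNge t0 /= (min_idPl (ltW tlt)).
    have ev : \forall s \near t^'+, (s%:E <= tau)%E.
      case: tau tlt => [r| |] //=.
      * rewrite lte_fin => tr; near=> s; rewrite lee_fin; near: s.
        exact: nbhs_right_le.
      * by move=> _; near=> s; rewrite leey.
    apply: cvg_trans (ur t t0); apply: near_eq_cvg; near=> s.
    have ts : t < s by near: s; exact: nbhs_right_gt.
    have st : (s%:E <= tau)%E by near: s.
    by rewrite /stop_fun ltNge (le_trans t0 (ltW ts)) /= (min_idPl st).
  + have st s : t <= s -> stop_fun u tau s = u (fine tau).
      move=> ts; rewrite /stop_fun ltNge (le_trans t0 ts) /= (min_idPr _)//.
      by rewrite (le_trans tget)// lee_fin.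
    rewrite st//.
    have cc : u (fine tau) @[_ --> t^'+] --> u (fine tau) by exact: cvg_cst.
    apply: cvg_trans cc; apply: near_eq_cvg; near=> s.
    have ts : t <= s by apply: ltW; near: s; exact: nbhs_right_gt.
    by rewrite st.
- have [tle|tlt] := leP t%:E tau.
  + have /cvg_ex[l ltl] := ul t t0.
    apply/cvg_ex; exists l; apply: cvg_trans ltl; apply: near_eq_cvg.
    near=> s.
    have s0 : 0 <= s by near: s; exact: nbhs_left_ge.
    rewrite /stop_fun ltNge s0 /= (min_idPl _)// (le_trans _ tle)// lee_fin.
    by near: s; exact: nbhs_left_le.
  + have ev : \forall s \near t^'-, (tau <= s%:E)%E.
      case: tau tlt => [r| |] //=.
      * rewrite lte_fin => rt; near=> s; rewrite lee_fin; near: s.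
        exact: nbhs_left_ge.
      * by move=> _; near=> s; rewrite leNye.
    apply/cvg_ex; exists (u (fine tau)).
    have cc : u (fine tau) @[_ --> t^'-] --> u (fine tau) by exact: cvg_cst.
    apply: cvg_trans cc; apply: near_eq_cvg; near=> s.
    have s0 : 0 <= s by near: s; exact: nbhs_left_ge.
    by rewrite /stop_fun ltNge s0 /= (min_idPr _)//; near: s.
Unshelve. all: by end_near. Qed.

Definition stop (R : realType) (u : skorokhod R) (tau : \bar R) : skorokhod R :=
  Skorokhod (@stop_fun_neg R u tau) (@stop_fun_cadlag R u tau).

(* Generators of the sigma-algebra of the family [X i], [i] in [D]. *)
Definition gen (Omega I : Type) (d : measure_display) (F : measurableType d)
    (D : set I) (X : I -> Omega -> F) : set (set Omega) :=
  \bigcup_(i in D) preimage_set_system setT (X i) measurable.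

Section conditioning.
Context (R : realType) (d : measure_display) (Omega : measurableType d).
Variable P : probability Omega R.
Implicit Types G : set (set Omega).

(* [p] is a version of the conditional probability P(A | <<s G >>). *)
Definition cond_prob G (A : set Omega) (p : Omega -> \bar R) : Prop :=
  [/\ @measurable_fun _ _ (g_sigma_algebraType G) (\bar R) setT p,
      P.-integrable setT p &
      forall C, <<s G >> C -> (\int[P]_(w in C) p w = P (A `&` C))%E].

Definition cond_dist (d' : measure_display) (F : measurableType d')
    G (X : Omega -> F) (K : Omega -> set F -> \bar R) : Prop :=
  forall B, measurable B -> cond_prob G (X @^-1` B) (fun w => K w B).

(* Versions exist and are P-a.e. unique, so "some versions" is "all versions". *)
Definition cond_indep G (G1 G2 : set (set Omega)) : Prop :=
  forall A B, <<s G1 >> A -> <<s G2 >> B -> exists p q,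
    [/\ cond_prob G A p, cond_prob G B q &
        cond_prob G (A `&` B) (fun w => p w * q w)%E].

Definition cond_id_dist (d' : measure_display) (F : measurableType d')
    G (X1 X2 : Omega -> F) : Prop :=
  forall B, measurable B -> exists p,
    cond_prob G (X1 @^-1` B) p /\ cond_prob G (X2 @^-1` B) p.

End conditioning.

(* Equality in law of random sequences, for the product sigma-algebra. *)
Definition same_law (R : realType) (d1 d2 : measure_display)
    (O1 : measurableType d1) (O2 : measurableType d2)
    (P1 : probability O1 R) (P2 : probability O2 R)
    (T1 : nat -> O1 -> R) (T2 : nat -> O2 -> R) : Prop :=
  forall A : set (nat -> R),
    <<s gen setT (fun n (t : nat -> R) => t n : R) >> A ->
    P1 [set w | A (T1 ^~ w)] = P2 [set w | A (T2 ^~ w)].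

Section workload.
Variable R : realType.
Local Open Scope ereal_scope.

(* The net input at time [t] when the [n]-th arrival, at time [T n], brings
   work [S n] if [B n] holds and nothing otherwise; a priori it may be [+oo]. *)
Definition net_input (x : R) (T S : nat -> R) (B : nat -> bool) (t : R) : \bar R :=
  x%:E + \sum_(0 <= n <oo | (T n <= t)%R) ((B n)%:R * S n)%:E - t%:E.

Definition is_workload (x : R) (T S : nat -> R) (B : nat -> bool)
    (W : skorokhod R) : Prop :=
  W 0%R = x /\
  forall t : R, (0 < t)%R ->
    (W t)%:E = net_input x T S B t -
      ereal_inf [set Order.min (net_input x T S B s) 0 | s in `[0%R, t[].

End workload.

Definition left_lim (R : realType) (u : skorokhod R) (t : R) : R :=
  lim (u s @[s --> t^'-]).

(* Generators of the information in {W_t : 0 <= t < tau}: the traces on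
   {t < tau} of the events {W_t in B}. To be joined with, or used given, sigma(tau). *)
Definition past (R : realType) (Omega : Type) (W : Omega -> skorokhod R)
    (tau : Omega -> R) : set (set Omega) :=
  [set A | exists (t : R) (B : set R),
     [/\ 0 <= t, measurable B & A = [set w | t < tau w /\ B (W w t)]]].

(* Customers are numbered from 0, so [T 0] is the first epoch. Conditioning on
   the arrival epochs and then on a further sigma-algebra is conditioning on
   their join. *)
Record baseline (R : realType) (E : ptopologicalType)
    (H : probability (borel E) R) (Psi : R.-pker borel E ~> R)
    (Phi : borel E * R -> bool) (x : R)
    (d : measure_display) (Omega : measurableType d) (P : probability Omega R)
    (T : nat -> {RV P >-> R}) (Y : nat -> {RV P >-> borel E})
    (S : nat -> {RV P >-> R}) (I : nat -> {RV P >-> bool})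
    (W : Omega -> skorokhod R) : Prop := Baseline {
  bl_epochs : {ae P, forall w, 0 < T 0 w /\ forall n, T n w < T n.+1 w};
  bl_service_gt0 : forall n w, 0 < S n w;
  bl_process : forall t, 0 <= t -> measurable_fun setT (fun w => W w t);
  bl_workload : {ae P, forall w,
    is_workload x (T ^~ w) (S ^~ w) (I ^~ w) (W w)};
  bl_type_dist : forall n, cond_dist P (gen setT T) (Y n) (fun _ => H);
  bl_type_indep : forall n, cond_indep P (gen setT T) (gen [set n] Y)
    (gen [set j | (j < n)%N] S `|` gen [set j | (j < n)%N] Y);
  bl_join : forall n, {ae P, forall w,
    I n w = Phi (Y n w, left_lim (W w) (T n w))};
  bl_service_id : forall m n, cond_id_dist P (gen setT T) (S m) (S n);
  bl_service_dist : forall n,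
    cond_dist P
      (gen setT T `|` (past W (T n) `|` gen [set j | (j <= n)%N] Y))
      (S n) (fun w => Psi (Y n w)) }.

Record admission_controlled (R : realType) (E : ptopologicalType)
    (H : probability (borel E) R) (Psi : R.-pker borel E ~> R)
    (Phi : borel E * R -> bool) (x : R)
    (d : measure_display) (Omega : measurableType d) (P : probability Omega R)
    (T : nat -> {RV P >-> R}) (Y : nat -> {RV P >-> borel E})
    (S Z : nat -> {RV P >-> R}) (I J : nat -> {RV P >-> bool})
    (W : Omega -> skorokhod R) : Prop := AdmissionControlled {
  ac_epochs : {ae P, forall w, 0 < T 0 w /\ forall n, T n w < T n.+1 w};
  ac_service_gt0 : forall n w, 0 < S n w;
  ac_random_range : forall n w, 0 < Z n w < 1;
  ac_process : forall t, 0 <= t -> measurable_fun setT (fun w => W w t);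
  ac_workload : {ae P, forall w,
    is_workload x (T ^~ w) (S ^~ w) (fun n => I n w && J n w) (W w)};
  ac_type_dist : forall n, cond_dist P (gen setT T) (Y n) (fun _ => H);
  ac_type_indep : forall n, cond_indep P (gen setT T) (gen [set n] Y)
    (gen [set j | (j < n)%N] S `|`
      (gen [set j | (j < n)%N] Y `|` gen [set j | (j <= n)%N] Z));
  ac_join : forall n, {ae P, forall w,
    I n w = Phi (Y n w, left_lim (W w) (T n w))};
  ac_service_dist : forall n,
    cond_dist P
      (gen setT T `|` (past W (T n) `|`
        (gen [set j | (j <= n)%N] Y `|` gen [set j | (j <= n)%N] Z)))
      (S n) (fun w => Psi (Y n w));
  ac_random_dist : forall n,
    cond_dist P (gen setT T) (Z n) (fun _ => uniform_prob (@ltr01 R));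
  ac_random_indep : forall n, cond_indep P (gen setT T) (gen [set n] Z)
    (past W (T n) `|`
      (gen [set j | (j <= n)%N] Y `|` gen [set j | (j < n)%N] Z));
  ac_admit : forall n,
    let G := gen setT T `|` (past W (T n) `|` gen [set n] Z) in
    @measurable_fun _ _ (g_sigma_algebraType G) bool setT (J n) }.

(* Main.v *)
(* Since services do not depend on types, the law of the stopped path is determined
   by the epochs and by the following kernel: as long as the work offered so far has
   not run out, the n-th arrival brings work with some probability q_n depending on
   the past, and this work is then a fresh draw from the service law G. In the
   baseline system q_n is the probability phi(w) that a customer finding workload w
   joins; in the controlled system q_n <= phi(w), by Radon-Nikodym.
   Both laws are realized on one space with common epochs, common uniforms u_n and
   common sizes, the k-th customer to be served receiving the k-th size in both
   systems. Coupling by counts rather than by customers makes the comparison work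
   without any monotonicity of phi: as long as the numbers of served customers agree
   so do the workloads, hence u_n < q_n implies u_n < phi(w); so the baseline count
   always dominates, and with it the total work brought up to any time. *)

Require Import Defs.
From HB Require Import structures.
From mathcomp Require Import all_boot all_order all_algebra.
From mathcomp Require Import all_classical all_reals all_analysis.
From mathcomp Require Import measurable_realfun.
From mathcomp Require Import ring lra.
Set Implicit Arguments.
Unset Strict Implicit.
Unset Printing Implicit Defensive.
Import Order.TTheory GRing.Theory Num.Theory.
Import numFieldNormedType.Exports.
Local Open Scope classical_set_scope.
Local Open Scope ring_scope.

(** * Laws, integrals and traces of sigma-algebras *)

(** The epochs are not assumed to tend to infinity, so infinitely many customers may arrive in
    bounded time. What the workload equation does force is that the work they bring by then is
    finite. Regularity and measurability of paths are therefore obtained by splitting off finitely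
    many jumps and leaving a small remainder. The assumptions on types and on sizes use different
    information: a type is independent of earlier types and sizes, whereas the law of a size is
    given relative to the workload path before the arrival. The kernel conditions on epochs and
    earlier jumps, so this history has to be measurable for both. From earlier types and sizes it is
    rebuilt arrival by arrival; from the path it is read off at rational times, which works only
    while the work has not run out. Such identities hold on events only, whence the traces of
    sigma-algebras. Since equality in law is known for epochs and jumps, the stopped path must
    moreover be a Borel function of them. *)

Section law.
Local Open Scope ereal_scope.
Context d1 d2 (T1 : measurableType d1) (T2 : measurableType d2) (R : realType).
Variables (P : probability T1 R) (f : T1 -> T2).
Hypothesis mf : measurable_fun setT f.

(** Carrying the proof of measurability as an argument lets the pushforward be declared a
    probability. *)
Definition law & measurable_fun setT f := pushforward P f.

Let law0 : law mf set0 = 0.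
Proof. by rewrite /law /pushforward preimage_set0 measure0. Qed.

Let law_ge0 A : 0 <= law mf A.
Proof. exact: measure_ge0. Qed.

Let law_sigma_additive : semi_sigma_additive (law mf).
Proof. exact: (@measure_semi_sigma_additive _ _ _ (pushforward P (mfun_Sub (mem_set mf)))). Qed.

HB.instance Definition _ := isMeasure.Build _ _ _ (law mf)
  law0 law_ge0 law_sigma_additive.

Let lawT : law mf setT = 1.
Proof. by rewrite /law /pushforward preimage_setT probability_setT. Qed.

HB.instance Definition _ := Measure_isProbability.Build _ _ _ (law mf) lawT.

End law.

Lemma ge0_integral_law d1 d2 (T1 : measurableType d1) (T2 : measurableType d2)
    (R : realType) (P : probability T1 R) (f : T1 -> T2)
    (mf : measurable_fun setT f) (D : set T2) (g : T2 -> \bar R) :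
  measurable D -> measurable_fun D g -> (forall y, D y -> 0 <= g y)%E ->
  (\int[law P mf]_(y in D) g y = \int[P]_(w in f @^-1` D) g (f w))%E.
Proof.
move=> mD mg g0.
rewrite -(@ge0_integral_pushforward _ _ _ _ R _ mf P D g)//.
by move=> y /[!inE]; exact: g0.
Qed.

Section seqM.
Context d (F : measurableType d).

(** The generators are those of [same_law], so that equality in law of the epochs applies verbatim
    to measurable sets of [seqM R]. *)
Definition coords : set (set (nat -> F)) := gen setT (fun n (t : nat -> F) => t n).
Definition seqM := g_sigma_algebraType coords.

Lemma measurable_coord n : measurable_fun setT (fun t : seqM => t n).
Proof.
move=> _ A mA; rewrite setTI; apply: sub_sigma_algebra.
by exists n => //; exists A => //; rewrite setTI.
Qed.

Lemma measurable_seqM d' (O : measurableType d') (f : O -> seqM) :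
  (forall n, measurable_fun setT (fun w => f w n)) -> measurable_fun setT f.
Proof.
move=> mf; apply: (@measurability _ _ O seqM setT f coords (erefl _)).
move=> _ [_ [n _ [B mB <-]] <-]; rewrite !setTI.
by rewrite -[X in measurable X]setTI; exact: mf.
Qed.

End seqM.

Section nomeas.
Import HBNNSimple.

(* Measurability of [f] and [g] is not assumed: the stopped workload of the theorem need
   not be measurable on the null set where the workload equation fails. The integral
   is a supremum over simple functions below the integrand, which suffices. *)
Lemma ge0_ae_le_integral_nomeas d (T : measurableType d) (R : realType)
    (mu : {measure set T -> \bar R}) (f g : T -> \bar R) (N : set T) :
  measurable N -> (mu N = 0)%E ->
  (forall w, 0 <= f w)%E -> (forall w, 0 <= g w)%E ->
  (forall w, ~ N w -> (f w <= g w)%E) ->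
  (\int[mu]_w f w <= \int[mu]_w g w)%E.
Proof.
move=> mN N0 f0 g0 fg; rewrite !ge0_integralTE//.
apply: ge_ereal_sup => _ [h /= hf <-].
have mNC : measurable (~` N) by exact: measurableC.
(* Cut off on the null set [N], the simple function lies below [g] everywhere and keeps its
   integral. *)
pose h' := proj_nnsfun h mNC.
apply: ereal_sup_ge; exists (sintegral mu h').
  exists h' => //= w; rewrite /h' mindicE; have [Nw|Nw] := pselect (N w).
    by rewrite memNset ?mulr0//; exact.
  by rewrite mem_set// mulr1 (le_trans (hf w))// fg.
rewrite -!integralT_nnsfun; apply: ae_ge0_le_integral => //.
- by move=> w _; rewrite lee_fin.
- exact/measurable_EFinP.
- by move=> w _; rewrite lee_fin.
- exact/measurable_EFinP.
exists N; split => // w /= /not_implyP[_].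
by apply: contra_notP => wN; rewrite lee_fin mindicE mem_set// mulr1.
Qed.

End nomeas.

Lemma prob_unique d (T : measurableType d) (R : realType)
    (m1 m2 : probability T R) (G : set (set T)) :
  setI_closed G -> G `<=` measurable -> @measurable _ T `<=` <<s G >> ->
  (forall A, G A -> m1 A = m2 A) -> forall A, measurable A -> m1 A = m2 A.
Proof.
move=> GI Gm mG m12 A mA.
(* Adjoining the whole space to [G] provides the required cover by sets of finite measure. *)
apply: (g_sigma_algebra_measure_unique (G `|` [set setT]) _ (fun _ => setT)).
- by move=> B [/Gm//|->].
- by move=> _; right.
- by rewrite bigcup_const.
- move=> B C [GB|->] [GC|->]; rewrite ?setTI ?setIT; [left;exact: GI|by left|by left|by right].
- move=> B [/m12//|->].
  transitivity (1 : \bar R)%E; [exact: probability_setT|exact/esym/probability_setT].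
- by move=> _; rewrite -ge0_fin_numE// fin_num_measure.
- apply: smallest_sub (mG _ mA); first exact: smallest_sigma_algebra.
  by move=> B GB; apply: sub_sigma_algebra; left.
Qed.

Lemma prob_unique_prod d1 d2 (T1 : measurableType d1) (T2 : measurableType d2)
    (R : realType) (m1 m2 : probability (T1 * T2)%type R) :
  (forall A B, measurable A -> measurable B -> m1 (A `*` B) = m2 (A `*` B)) ->
  forall A, measurable A -> m1 A = m2 A.
Proof.
move=> m12.
apply: (@prob_unique _ _ _ _ _ [set A `*` B | A in measurable & B in measurable]).
- move=> _ _ [A mA [B mB <-]] [C mC [D mD <-]]; rewrite -setXI.
  by exists (A `&` C); [exact: measurableI|exists (B `&` D) => //; exact: measurableI].
- by move=> _ [A mA [B mB <-]]; exact: measurableX.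
- by rewrite measurable_prod_measurableType.
- by move=> _ [A mA [B mB <-]]; exact: m12.
Qed.

(** Independence on rectangles makes the joint law a product measure, whose value at [M] is the
    integral of the measures of the sections. *)
Lemma indep_freeze d d1 d2 (O : measurableType d) (T1 : measurableType d1)
    (T2 : measurableType d2) (R : realType) (P : probability O R)
    (Z : O -> T1) (Y : O -> T2) (mZ : measurable_fun setT Z)
    (mY : measurable_fun setT Y) (H : probability T2 R) :
  (forall A C, measurable A -> measurable C ->
    P (Z @^-1` A `&` Y @^-1` C) = P (Z @^-1` A) * H C)%E ->
  forall M : set (T1 * T2), measurable M ->
    P [set w | M (Z w, Y w)] = (\int[law P mZ]_z H (xsection M z))%E.
Proof.
move=> ind M mM.
have mZY : measurable_fun setT (fun w => (Z w, Y w)) by exact: measurable_fun_pair.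
by rewrite -[LHS]/(law P mZY M) -(@product_measure_unique _ _ _ _ _ (law P mZ) H).
Qed.

Section trace.
Context d (T : measurableType d).
Implicit Types (G : set (set T)) (M A : set T).

(* Events agreeing on [M] with an event of <<s G>>: almost sure identities, and the
   description of the past of the workload before it runs out, hold only on such [M]. *)
Definition trace_sigma G M : set (set T) :=
  [set A | measurable A /\ exists2 B, <<s G >> B & A `&` M = B `&` M].

Lemma trace_sigma_algebra G M : sigma_algebra setT (trace_sigma G M).
Proof.
split.
- by split => //; exists set0 => //; exact: sigma_algebra0.
- move=> A [mA [B GB AB]]; rewrite setTD; split; first exact: measurableC.
  exists (~` B); first exact: sigma_algebraC.
  apply/seteqP; split => w [nA Mw]; split => // Bw; apply: nA.
    by have [] : (A `&` M) w by rewrite AB.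
  by have [] : (B `&` M) w by rewrite -AB.
- move=> F mF; split; first by apply: bigcupT_measurable => n; case: (mF n).
  have /choice[B BP] : forall n, exists B, <<s G >> B /\ F n `&` M = B `&` M.
    by move=> n; have [_ [B]] := mF n; exists B.
  exists (\bigcup_n B n); first by apply: sigma_algebra_bigcup => n; case: (BP n).
  by rewrite !setI_bigcupl; apply: eq_bigcupr => n _; case: (BP n).
Qed.

Lemma sub_trace_sigma G M : <<s G >> `<=` measurable -> <<s G >> `<=` trace_sigma G M.
Proof. by move=> Gm A GA; split; [exact: Gm|exists A]. Qed.

Lemma trace_sigmaS G M N : N `<=` M -> trace_sigma G M `<=` trace_sigma G N.
Proof.
move=> NM A [mA [B GB AB]]; split => //; exists B => //.
by rewrite -(setIidr NM) !setIA AB.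
Qed.

Lemma trace_sigma_gen G G' M : G' `<=` trace_sigma G M -> <<s G' >> `<=` trace_sigma G M.
Proof. by move=> h; apply: smallest_sub => //; exact: trace_sigma_algebra. Qed.

(** Lets an event contained in [A] be studied with identities valid only on [A]: if [A] is known on
    [M], knowledge on the intersection suffices. It is used with [A] the event of not having run
    out. *)
Lemma trace_sigma_restr G M A : trace_sigma G M A ->
  trace_sigma G (M `&` A) `<=` [set B | trace_sigma G M (B `&` A)].
Proof.
move=> [mA [B GB AB]] C [mC [D GD CD]]; split; first exact: measurableI.
exists (D `&` B).
  exact: (@measurableI _ (g_sigma_algebraType G)).
by rewrite -(setIA C A M) [A `&` M]setIC CD [M `&` A]setIC AB setIA.
Qed.

End trace.

Section trunc.
Context (R : realType).
Implicit Types (t b : nat -> R).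

(** Histories of every length are padded with zeros, so that all kernels are functions on the single
    space [hist]. *)
Definition trunc (n : nat) b : nat -> R := fun j => if (j < n)%N then b j else 0.
Definition upd (n : nat) b (v : R) : nat -> R := fun j => if j == n then v else b j.

Lemma trunc_trunc m n b : trunc m (trunc n b) = trunc (minn m n) b.
Proof.
by apply/funext => j; rewrite /trunc leq_min; case: (j < m)%N; case: (j < n)%N.
Qed.

Lemma truncS n b : trunc n.+1 b = upd n (trunc n b) (b n).
Proof.
by apply/funext => j; rewrite /trunc /upd ltnS leq_eqVlt; case: (eqVneq j n) => [->|].
Qed.

(* The arrival epochs and the work brought at each of them. *)
Definition hist := (seqM R * seqM R)%type.

Lemma measurable_trunc n : measurable_fun setT (trunc n : seqM R -> seqM R).
Proof.
apply: measurable_seqM => j; rewrite /trunc; case: (j < n)%N => //.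
exact: measurable_coord.
Qed.

Lemma measurable_upd n :
  measurable_fun setT (fun z : hist * R => (z.1.1, upd n z.1.2 z.2) : hist).
Proof.
apply: measurable_fun_pair; first exact: measurableT_comp.
apply: measurable_seqM => j; rewrite /upd; case: (j == n); first exact: measurable_snd.
exact: (measurableT_comp (measurable_coord j)
  (measurableT_comp measurable_snd measurable_fst)).
Qed.

Lemma measurable_hist d (O : measurableType d) (t b : nat -> O -> R) :
  (forall n, measurable_fun setT (t n)) -> (forall n, measurable_fun setT (b n)) ->
  measurable_fun setT (fun w => (t ^~ w, b ^~ w) : hist).
Proof. by move=> mt mb; apply: measurable_fun_pair; exact: measurable_seqM. Qed.

Definition trunch n (z : hist) : hist := (z.1, trunc n z.2).

Lemma measurable_trunch n : measurable_fun setT (trunch n).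
Proof.
by apply: measurable_fun_pair => //; exact: (measurableT_comp (measurable_trunc n) measurable_snd).
Qed.

(** The events seen by some truncation are stable under intersection, because a longer truncation
    determines a shorter one, and they generate the sigma-algebra. *)
Lemma hist_prob_unique (m1 m2 : probability hist R) :
  (forall n (A : set hist), measurable A -> m1 (trunch n @^-1` A) =
                               m2 (trunch n @^-1` A)) ->
  forall A, measurable A -> m1 A = m2 A.
Proof.
move=> m12.
pose G := [set C : set hist | exists n (A : set hist), measurable A /\
  C = (trunch n @^-1` A)].
apply: (@prob_unique _ _ _ _ _ G).
- move=> _ _ [m [A [mA ->]]] [n [B [mB ->]]]; exists (maxn m n).
  exists ((trunch m @^-1` A) `&` (trunch n @^-1` B)); split.
    by apply: measurableI; rewrite -[X in measurable X]setTI; exact: measurable_trunch.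
  apply/seteqP; split => z /=; rewrite /trunch/= !trunc_trunc.
    by rewrite (minn_idPl (leq_maxl m n)) (minn_idPl (leq_maxr m n)).
  by rewrite (minn_idPl (leq_maxl m n)) (minn_idPl (leq_maxr m n)).
- move=> _ [n [A [mA ->]]].
  by rewrite -[X in measurable X]setTI; exact: measurable_trunch.
- have mid : measurable_fun setT (id : g_sigma_algebraType G -> hist).
    apply/measurable_fun_pairP; split; apply: measurable_seqM => n /= _ A mA;
        rewrite setTI; apply: sub_sigma_algebra.
      (* Epochs are never truncated, so the truncation at 0 shows them all; the [n]-th jump first
         appears in the one at [n.+1]. *)
      exists 0%N, [set z : hist | A (z.1 n)]; split => //.
      rewrite -[X in measurable X]setTI.
      exact: (measurableT_comp (measurable_coord n) measurable_fst).
    exists n.+1, [set z : hist | A (z.2 n)]; split => //.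
      rewrite -[X in measurable X]setTI.
      exact: (measurableT_comp (measurable_coord n) measurable_snd).
    by apply/seteqP; split => z /=; rewrite /trunc ltnSn.
  by move=> A mA; rewrite -[A]setTI; exact: mid.
- by move=> _ [n [A [mA ->]]]; exact: m12.
Qed.

End trunc.

(** * The stopped path as a measurable function of epochs and jumps *)

Lemma dist_max0 (R : realDomainType) (a b : R) :
  `|Num.max a 0 - Num.max b 0| <= `|a - b|.
Proof.
have h (u v : R) : u <= v -> `|Num.max u 0 - Num.max v 0| <= `|u - v|.
  move=> uv; rewrite !(distrC u) !(distrC (Num.max u 0)) !ger0_norm ?subr_ge0//.
    case: (leP u 0); case: (leP v 0); lra.
  by rewrite ge_max !le_max uv lexx orbT.
have [/h//|/ltW/h] := leP a b.
by rewrite distrC (distrC b).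
Qed.

Lemma cvg_max0 (R : realType) (T : Type) (F : set_system T) (FF : Filter F)
    (f : T -> R) (l : R) :
  f @ F --> l -> (fun t => Num.max (f t) 0) @ F --> Num.max l 0.
Proof.
move=> /cvgrPdist_lt fl; apply/cvgrPdist_lt => e /fl; apply: filterS => t.
exact/le_lt_trans/dist_max0.
Qed.

Section work.
Context (R : realType).
Implicit Types (z : hist R) (s : R) (n : nat).

(** The absolute value makes the series of jumps meaningful, and its sum measurable, on all of
    [hist]. *)
Definition jump z s (i : nat) : R := if z.1 i <= s then `|z.2 i| else 0.

Lemma jump_ge0 z s i : 0 <= jump z s i.
Proof. by rewrite /jump; case: ifP. Qed.

Lemma le_jump z s s' i : s <= s' -> jump z s i <= jump z s' i.
Proof.
move=> ss'; rewrite /jump; case: ifPn => [ts|_]; last by case: ifP.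
by rewrite (le_trans ts ss').
Qed.

Definition tail_work z n s : \bar R := (\sum_(n <= i <oo) (jump z s i)%:E)%E.

Lemma tail_work_ge0 z n s : (0 <= tail_work z n s)%E.
Proof. by apply: nneseries_ge0 => i _ _; rewrite lee_fin jump_ge0. Qed.

Lemma le_tail_work z n s s' : s <= s' -> (tail_work z n s <= tail_work z n s')%E.
Proof.
move=> ss'; apply: lee_nneseries => [i _ _|i _]; rewrite lee_fin ?jump_ge0//.
exact: le_jump.
Qed.

Lemma tail_work_split z n s :
  tail_work z 0 s = ((\sum_(i < n) jump z s i)%:E + tail_work z n s)%E.
Proof.
rewrite /tail_work (@nneseries_split _ _ 0%N n) ?add0n; last by move=> i _; rewrite lee_fin jump_ge0.
by rewrite big_mkord sumEFin.
Qed.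

(** The epochs may accumulate, provided that the work brought in bounded time is finite; integer
    times make this a countable condition. *)
Definition admissible z : Prop :=
  [/\ 0 < z.1 0%N, forall n, z.1 n < z.1 n.+1, forall n, 0 <= z.2 n
    & forall M : nat, (tail_work z 0 M%:R < +oo)%E].

Definition work z s : R := fine (tail_work z 0 s).

Section admissible.
Variables (z : hist R) (az : admissible z).

Lemma adm_mono i j : (i < j)%N -> z.1 i < z.1 j.
Proof.
have [_ inc _ _] := az; elim: j => // j ih; rewrite ltnS leq_eqVlt => /predU1P[->|/ih ij] //.
exact: lt_trans (inc j).
Qed.

Lemma adm_gt0 i : 0 < z.1 i.
Proof. by have [z0 _ _ _] := az; case: i => // i; exact: lt_trans (adm_mono (ltn0Sn i)). Qed.

Lemma tail_work_fin n s : tail_work z n s \is a fin_num.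
Proof.
rewrite ge0_fin_numE ?tail_work_ge0//.
have [_ _ _ zM] := az.
have [M sM] : exists M : nat, s <= M%:R.
  by exists (Num.bound `|s|); rewrite (le_trans (ler_norm s))// ltW// archi_boundP.
apply: le_lt_trans (zM M); apply: le_trans (le_tail_work z 0 sM).
by rewrite (tail_work_split z n) leeDr// lee_fin sumr_ge0// => i _; exact: jump_ge0.
Qed.

Lemma work_split n s :
  work z s = \sum_(i < n) jump z s i + fine (tail_work z n s).
Proof. by rewrite /work (tail_work_split z n) fineD// tail_work_fin. Qed.

Lemma le_work s s' : s <= s' -> work z s <= work z s'.
Proof. by move=> ss'; apply: fine_le; rewrite ?tail_work_fin// le_tail_work. Qed.

Lemma work_ge0 s : 0 <= work z s.
Proof. exact/fine_ge0/tail_work_ge0. Qed.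

(** Infinitely many arrivals may precede [s], but all except finitely many of them together bring
    little work. *)
Lemma tail_work_small s (e : R) : 0 < e -> exists n, fine (tail_work z n s) < e.
Proof.
move=> e0.
have : tail_work z n s @[n --> \oo] --> 0%E.
  apply: nneseries_tail_cvg => [|i _]; last by rewrite lee_fin jump_ge0.
  by have := tail_work_fin 0 s; rewrite ge0_fin_numE// tail_work_ge0.
move=> /fine_cvgP[_] /cvgrPdist_lt/(_ _ e0)[N _ /(_ N (leqnn _))] h.
by exists N; move: h; rewrite sub0r normrN ger0_norm// fine_ge0// tail_work_ge0.
Qed.

(* If no work arrives after [x + work z s - s] reaches 0, this is the workload stopped at
   its hitting time of 0. *)
Definition free_path x s : R := if s < 0 then 0 else Num.max (x + work z s - s) 0.

Lemma free_path_neg x s : s < 0 -> free_path x s = 0.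
Proof. by rewrite /free_path => ->. Qed.

Lemma jump_right n t : \forall s \near t^'+, forall i, (i < n)%N -> jump z s i = jump z t i.
Proof.
elim: n => [|n ih]; first by near=> s.
have h : \forall s \near t^'+, jump z s n = jump z t n.
  have [ztn|tz] := leP (z.1 n) t.
    near=> s; have ts : t <= s by apply: ltW; near: s; exact: nbhs_right_gt.
    by rewrite /jump ztn (le_trans ztn ts).
  near=> s; have ts : s < z.1 n by near: s; exact: nbhs_right_lt.
  by rewrite /jump !leNgt ts tz.
near=> s => i; rewrite ltnS leq_eqVlt => /predU1P[->|].
  by near: s.
by move: i; near: s.
Unshelve. all: by end_near. Qed.

(** Just to the right of [t] the first [n] jumps do not change, and the increment of the others is
    bounded by their total at time [t + 1], which is small. *)
Lemma work_right t : work z s @[s --> t^'+] --> work z t.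
Proof.
apply/cvgrPdist_lt => e e0.
have [n ne] := tail_work_small (t + 1) e0.
near=> s.
have ts : t <= s by apply: ltW; near: s; exact: nbhs_right_gt.
have st : s <= t + 1 by near: s; apply: nbhs_right_le; rewrite ltrDl.
have js : forall i, (i < n)%N -> jump z s i = jump z t i by near: s; exact: jump_right.
rewrite distrC ger0_norm ?subr_ge0 ?le_work//.
rewrite !(work_split n) [X in X + _ - _](eq_bigr (fun i : 'I_n => jump z t i)) => [|i _]; last exact: js.
rewrite opprD addrACA subrr add0r; apply: le_lt_trans ne.
rewrite (@le_trans _ _ (fine (tail_work z n s)))//.
  by rewrite gerBl fine_ge0// tail_work_ge0.
by apply: fine_le; rewrite ?tail_work_fin// le_tail_work.
Unshelve. all: by end_near. Qed.

Lemma work_left t : cvg (work z s @[s --> t^'-]).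
Proof.
apply: nondecreasing_at_left_is_cvgr.
  by near=> s => a b _ _; exact: le_work.
near=> s; exists (work z t) => _ [y /= + <-]; rewrite in_itv/= => /andP[_ yt].
by apply: le_work; exact: ltW.
Unshelve. all: by end_near. Qed.

Lemma free_path_cadlag x : cadlag (free_path x).
Proof.
split => t t0.
  rewrite {2}/free_path ltNge t0/=.
  have h : Num.max (x + work z s - s) 0 @[s --> t^'+] --> Num.max (x + work z t - t) 0.
    apply: cvg_max0.
    apply: cvgB; last exact: cvg_at_right_filter.
    by apply: cvgD; [exact: cvg_cst|exact: work_right].
  apply: cvg_trans h; apply: near_eq_cvg; near=> s.
  have ts : t <= s by apply: ltW; near: s; exact: nbhs_right_gt.
  by rewrite /free_path ltNge (le_trans t0 ts).
have /cvg_ex[l wl] := @work_left t.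
apply/cvg_ex; exists (Num.max (x + l - t) 0).
have h : Num.max (x + work z s - s) 0 @[s --> t^'-] --> Num.max (x + l - t) 0.
  apply: cvg_max0.
  apply: cvgB; last exact: cvg_at_left_filter.
  by apply: cvgD; [exact: cvg_cst|exact: wl].
apply: cvg_trans h; apply: near_eq_cvg; near=> s.
have s0 : 0 <= s by near: s; exact: nbhs_left_ge.
by rewrite /free_path ltNge s0.
Unshelve. all: by end_near. Qed.

Definition adm_path x : skorokhod R := Skorokhod (@free_path_neg x) (@free_path_cadlag x).

End admissible.

(** A path carries the proof of its regularity, so inadmissible histories are sent to the default
    path. *)
Definition path_map x z : skorokhod R :=
  if pselect (admissible z) is left az then adm_path az x else point.

Lemma path_mapE x z : admissible z -> forall s, 0 <= s ->
  path_map x z s = Num.max (x + work z s - s) 0.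
Proof.
move=> az s s0; rewrite /path_map; case: pselect => // az' /=.
by rewrite /free_path ltNge s0.
Qed.

End work.

Lemma ler_norm_sum_const (R : realDomainType) (N : nat) (F : nat -> R) (c : R) :
  (forall i, (i < N)%N -> `|F i| <= c) -> `|\sum_(i < N) F i| <= N%:R * c.
Proof.
move=> Fc; apply: le_trans (ler_norm_sum _ _ _) _.
rewrite mulr_natl -[N in leRHS]card_ord -sumr_const.
by apply: ler_sum => i _; exact: Fc.
Qed.

(* A time change moving the jump times [t i] to [t' i], built from hat functions
   each of which vanishes at the other [t j]. *)
Section hat_time_change.
Context (R : realType) (t t' : nat -> R) (N : nat) (g h : R).
Hypotheses (g0 : 0 < g) (Nh : N%:R * h <= g / 2).
Hypothesis t_ge : forall i, (i < N)%N -> g <= t i.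
Hypothesis t_sep : forall i j, (i < N)%N -> (j < N)%N -> i != j -> g <= `|t i - t j|.
Hypothesis tt' : forall i, (i < N)%N -> `|t' i - t i| <= h.

Definition hat (i : nat) (s : R) : R := Num.max (1 - `|s - t i| / g) 0.

Definition hat_change (s : R) : R := s + \sum_(i < N) (t' i - t i) * hat i s.

Lemma hat_ge0 i s : 0 <= hat i s.
Proof. by rewrite /hat le_max lexx orbT. Qed.

Lemma hat_le1 i s : hat i s <= 1.
Proof. by rewrite /hat ge_max ler01 andbT gerBl divr_ge0// ltW. Qed.

Lemma hat_eq0 i s : g <= `|s - t i| -> hat i s = 0.
Proof. by move=> gs; apply/max_idPr; rewrite subr_le0 ler_pdivlMr// mul1r. Qed.

Lemma hat_lipschitz i s s' : `|hat i s - hat i s'| <= `|s - s'| / g.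
Proof.
apply: le_trans (dist_max0 _ _) _.
have -> : 1 - `|s - t i| / g - (1 - `|s' - t i| / g) = (`|s' - t i| - `|s - t i|) / g.
  by field; rewrite gt_eqF.
rewrite normrM normfV (gtr0_norm g0) ler_pM2r ?invr_gt0//.
apply: le_trans (ler_dist_dist _ _) _.
by rewrite [leRHS]distrC (_ : s' - t i - (s - t i) = s' - s)//; ring.
Qed.

Lemma hat_change_knot i : (i < N)%N -> hat_change (t i) = t' i.
Proof.
move=> iN; rewrite /hat_change (bigD1 (Ordinal iN))//= big1 => [|j ji].
  by rewrite /hat subrr normr0 mul0r subr0 (max_idPl ler01) mulr1 addr0 addrC subrK.
by rewrite hat_eq0 ?mulr0//; apply: t_sep => //; rewrite eq_sym.
Qed.

Lemma hat_change0 : hat_change 0 = 0.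
Proof.
rewrite /hat_change big1 ?addr0// => i _; rewrite hat_eq0 ?mulr0// sub0r normrN.
by rewrite (le_trans (t_ge (ltn_ord i)))// ler_norm.
Qed.

Lemma hat_change_dist s : `|hat_change s - s| <= N%:R * h.
Proof.
rewrite /hat_change addrAC subrr add0r.
apply: (ler_norm_sum_const (F := fun i => (t' i - t i) * hat i s)) => i iN.
rewrite normrM -[leRHS]mulr1 ler_pM ?tt'// (ger0_norm (hat_ge0 _ _)).
exact: hat_le1.
Qed.

(** Each of the [N] hats has slope at most [1 / g] and weight at most [h], so the displacement has
    Lipschitz constant at most [N h / g], hence at most one half. This makes [hat_change] increasing
    and at least [s / 2]. *)
Lemma hat_change_lipschitz s s' :
  `|(hat_change s - s) - (hat_change s' - s')| <= `|s - s'| / 2.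
Proof.
have E u : hat_change u - u = \sum_(i < N) (t' i - t i) * hat i u.
  by rewrite /hat_change addrAC subrr add0r.
rewrite !E -sumrB.
apply: (@le_trans _ _ (N%:R * (h * (`|s - s'| / g)))).
  apply: (ler_norm_sum_const (F := fun i => (t' i - t i) * hat i s - (t' i - t i) * hat i s')) => i iN.
  rewrite -mulrBr normrM ler_pM ?tt'//; exact: hat_lipschitz.
have s0 : 0 <= `|s - s'| / g by rewrite divr_ge0// ltW.
rewrite mulrA; apply: le_trans (ler_wpM2r s0 Nh) _.
by rewrite le_eqVlt; apply/orP; left; apply/eqP; field; rewrite gt_eqF.
Qed.

Lemma hat_change_lt s s' : s < s' -> hat_change s < hat_change s'.
Proof.
move=> ss'; have := hat_change_lipschitz s' s.
by rewrite ler_norml [X in X / 2]gtr0_norm ?subr_gt0// => /andP[]; lra.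
Qed.

Lemma hat_change_continuous : continuous hat_change.
Proof.
move=> s; apply/cvgrPdist_lt => e e0; near=> u.
have := hat_change_lipschitz s u.
have : `|s - u| < e / 2.
  by near: u; apply: (@cvgr_dist_lt _ _ _ (nbhs s) _ id s) => //; lra.
move=> su lip.
have -> : hat_change s - hat_change u =
    ((hat_change s - s) - (hat_change u - u)) + (s - u) by ring.
by apply: le_lt_trans (ler_normD _ _) _; lra.
Unshelve. all: by end_near. Qed.

Lemma hat_change_ge s : 0 <= s -> s / 2 <= hat_change s.
Proof.
move=> s0; have := hat_change_lipschitz s 0.
by rewrite hat_change0 !subr0 (ger0_norm s0) ler_norml => /andP[]; lra.
Qed.

Lemma hat_change_time_change : time_change hat_change.
Proof.
split; last by move=> s s' _; exact: hat_change_lt.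
split.
- move=> s /=; rewrite !in_itv/= !andbT => s0.
  by apply: le_trans (hat_change_ge s0); lra.
- move=> s s' _ _ ss'; apply/eqP; case: ltgtP => // /hat_change_lt.
    by rewrite ss' ltxx.
  by rewrite ss' ltxx.
- move=> y /=; rewrite in_itv/= andbT => y0.
  (* Since [hat_change s] is at least [s / 2], the value [y] is reached before time [2 * y]. *)
  have y2 : 0 <= 2 * y by lra.
  have [|||c] := @IVT R hat_change 0 (2 * y) y.
  + exact: y2.
  + by apply: continuous_subspaceT => u; exact: hat_change_continuous.
  + have := hat_change_ge y2; rewrite hat_change0 => y2h.
    rewrite ge_min le_max y0/=; apply/orP; right; lra.
  + by rewrite in_itv/= => /andP[c0 _] <-; exists c => //=; rewrite in_itv/= c0.
Qed.

End hat_time_change.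

Section path_map_near.
Context (R : realType).
Implicit Types (z : hist R).

Lemma adm_gap z N : admissible z -> exists2 g : R, 0 < g &
  g <= z.1 0%N /\ forall i, (i < N)%N -> g <= z.1 i.+1 - z.1 i.
Proof.
move=> az; elim: N => [|N [g g0 [gz gi]]].
  by exists (z.1 0%N); [exact: adm_gt0|split].
exists (Num.min g (z.1 N.+1 - z.1 N)).
  by rewrite lt_min g0 subr_gt0 adm_mono.
split=> [|i]; first by rewrite ge_min gz.
rewrite ltnS leq_eqVlt => /predU1P[->|/gi gi']; rewrite ge_min ?lexx ?orbT//.
by rewrite gi'.
Qed.

(** Closeness of finitely many coordinates says nothing about the remaining work of [z'], so its
    smallness is a separate condition. It is imposed at time [n0.+1] because the time change may
    move [n0] to the right. *)
Lemma path_map_near x z (n0 : nat) (e : R) : admissible z -> 0 < e ->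
  exists N h tau, [/\ 0 < h, 0 < tau, fine (tail_work z N n0.+1%:R) < tau &
    forall z', admissible z' ->
      (forall i, (i < N)%N -> `|z'.1 i - z.1 i| <= h) ->
      (forall i, (i < N)%N -> `|z'.2 i - z.2 i| <= h) ->
      fine (tail_work z' N n0.+1%:R) < tau ->
      skorokhod_nbhs (path_map x z) n0 e (path_map x z')].
Proof.
move=> az e0; pose tau := e / 4; have tau0 : 0 < tau by rewrite /tau; lra.
have [N Ntau] := tail_work_small az n0.+1%:R tau0.
have [g g0 [gz gi]] := adm_gap N az.
(* The bound [g / 2] is needed for the hats to give a time change, [e / 4] limits the errors in time
   and in the first [N] jumps, and 1 keeps [l s] below [n0.+1]. The two tails differ by less than a
   further [e / 4]. *)
pose c := Num.min (g / 2) (Num.min (e / 4) 1).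
have c0 : 0 < c by rewrite /c !lt_min; apply/and3P; split; lra.
have [cg ce c1] : [/\ c <= g / 2, c <= e / 4 & c <= 1].
  by rewrite /c; split; rewrite !ge_min lexx ?orbT.
pose h : R := c / N.+1%:R.
have h0 : 0 < h by rewrite divr_gt0// ltr0n.
have Nh : N%:R * h <= c.
  rewrite /h mulrCA ger_pMr// ler_pdivrMr ?ltr0n// mul1r ler_nat//.
exists N, h, tau; split => // z' az' tt' bb' tau'.
have t_ge i : (i < N)%N -> g <= z.1 i.
  move=> _; case: i => // i; apply: (le_trans gz); apply: ltW.
  exact: adm_mono.
have t_sep i j : (i < N)%N -> (j < N)%N -> i != j -> g <= `|z.1 i - z.1 j|.
  have sep k l : (k < N)%N -> (k < l)%N -> g <= `|z.1 k - z.1 l|.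
    move=> kN kl; rewrite distrC ger0_norm ?subr_ge0; last exact/ltW/adm_mono.
    apply: le_trans (gi k kN) _; rewrite lerD2r.
    move: kl; rewrite leq_eqVlt => /predU1P[->//|kl].
    exact/ltW/adm_mono.
  move=> iN jN; rewrite neq_ltn => /orP[|] ij; first exact: sep.
  by rewrite distrC; exact: sep.
have Nhg : N%:R * h <= g / 2 by exact: le_trans cg.
pose l := hat_change z.1 z'.1 N g.
have lt_l s s' : s < s' -> l s < l s'.
  exact: (hat_change_lt g0 Nhg tt').
have le_l s s' : (l s <= l s') = (s <= s').
  by rewrite leNgt; have [/lt_l->//|] := ltP s' s; rewrite le_eqVlt => /predU1P[->|/lt_l/ltW]; rewrite ?ltxx// leNgt => ->.
have dist_l s : `|l s - s| <= c.
  exact: le_trans (hat_change_dist g0 tt' s) Nh.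
exists l; split.
- exact: (hat_change_time_change g0 Nhg t_ge tt').
- move=> s _; apply: le_lt_trans (dist_l s) _; lra.
move=> s /andP[s0 sn].
have l0 : 0 <= l s.
  apply: le_trans (hat_change_ge g0 Nhg t_ge tt' s0); lra.
have ln : l s <= n0.+1%:R.
  have := dist_l s; rewrite ler_norml => /andP[_].
  rewrite -natr1; lra.
rewrite !path_mapE//.
apply: le_lt_trans (dist_max0 _ _) _.
rewrite (work_split az' N) (work_split az N).
set T' := fine (tail_work z' N _); set T := fine (tail_work z N _).
have T0 : 0 <= T by rewrite fine_ge0// tail_work_ge0.
have T'0 : 0 <= T' by rewrite fine_ge0// tail_work_ge0.
have Tt : T < tau.
  apply: le_lt_trans Ntau; apply: fine_le; rewrite ?tail_work_fin//.
  by apply: le_tail_work; apply: (le_trans sn); rewrite ler_nat.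
have T't : T' < tau.
  by apply: le_lt_trans tau'; apply: fine_le; rewrite ?tail_work_fin// le_tail_work.
have J : `|\sum_(i < N) (jump z' (l s) i - jump z s i)| <= N%:R * h.
  apply: (ler_norm_sum_const (F := fun i => jump z' (l s) i - jump z s i)) => i iN.
  (* As [l] carries the [i]-th epoch of [z] to that of [z'], this jump has occurred by [l s] in [z']
     exactly if it has occurred by [s] in [z]; only the sizes differ. *)
  rewrite /jump -(@hat_change_knot R z.1 z'.1 N g g0 t_sep i iN) -/l le_l.
  case: ifP => _; last by rewrite subrr normr0 ltW.
  exact: le_trans (ler_dist_dist _ _) (bb' i iN).
rewrite sumrB in J; have := dist_l s; move: J.
set A := \sum_(i < N) _; set B := \sum_(i < N) _.
rewrite /tau in Tt T't.
rewrite ltr_norml !ler_norml => /andP[? ?] /andP[? ?]; apply/andP; split; lra.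
Qed.

End path_map_near.

Lemma measurable_pred d (T : measurableType d) (f : T -> bool) :
  measurable_fun setT f -> measurable [set w | f w].
Proof. by move=> mf; rewrite -[X in measurable X]setTI; exact: mf. Qed.

Section path_map_measurable.
Context (R : realType).
Notation hist := (hist R).

Lemma measurable_fst_coord i : measurable_fun setT (fun z : hist => z.1 i).
Proof. exact: (measurableT_comp (measurable_coord i) measurable_fst). Qed.

Lemma measurable_snd_coord i : measurable_fun setT (fun z : hist => z.2 i).
Proof. exact: (measurableT_comp (measurable_coord i) measurable_snd). Qed.

Lemma measurable_jump s i : measurable_fun setT (fun z : hist => jump z s i).
Proof.
apply: measurable_fun_ifT.
- by apply: measurable_fun_ler; [exact: measurable_fst_coord|exact: measurable_cst].
- exact: (measurableT_comp (@normr_measurable R setT) (measurable_snd_coord i)).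
- exact: measurable_cst.
Qed.

Lemma measurable_tail_work n s : measurable_fun setT (fun z : hist => tail_work z n s).
Proof.
rewrite (_ : (fun z => _) = (fun z : hist => (\sum_(i <oo | i \in [pred i | (n <= i)%N]) (jump z s i)%:E)%E)).
  apply: ge0_emeasurable_sum => [i z _ _|i _]; first by rewrite lee_fin jump_ge0.
  by apply/measurable_EFinP; exact: measurable_jump.
by apply/funext => z; rewrite /tail_work eseries_cond; apply: eq_eseriesl.
Qed.

Lemma measurable_admissible : measurable [set z : hist | admissible z].
Proof.
rewrite (_ : [set _ | _] = [set z : hist | 0 < z.1 0%N] `&`
    \bigcap_n [set z : hist | z.1 n < z.1 n.+1] `&`
    \bigcap_n [set z : hist | 0 <= z.2 n] `&`
    \bigcap_M [set z : hist | (tail_work z 0 M%:R < +oo)%E]).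
  apply: measurableI; last first.
    apply: bigcapT_measurable => M; rewrite -[X in measurable X]setTI.
    by apply: emeasurable_fun_infty_o => //; exact: measurable_tail_work.
  apply: measurableI.
    apply: measurableI.
      apply: measurable_pred; apply: measurable_fun_ltr => //.
      exact: measurable_fst_coord.
    apply: bigcapT_measurable => n; apply: measurable_pred.
    by apply: measurable_fun_ltr; exact: measurable_fst_coord.
  apply: bigcapT_measurable => n; apply: measurable_pred.
  by apply: measurable_fun_ler => //; exact: measurable_snd_coord.
apply/seteqP; split => z /=.
  by case=> z0 zi b0 zM; split; [split; [split|]|] => // n _ /=.
by case=> [[[z0 zi] b0] zM]; split => // n; [exact: zi|exact: b0|exact: zM].
Qed.

(* By [path_map_near], the preimage of an open set is a union of such cells, and there
   are countably many of them. This avoids a description of the Borel sets of the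
   Skorokhod space. *)
Let idx := (nat * nat * rat * nat * seq rat * seq rat)%type.

Let cell (p : idx) : set hist :=
  let: (N, k, rho, M, q, r) := p in
  [set z | admissible z] `&`
  \bigcap_i [set z : hist | (i < N)%N ==> (`|z.1 i - ratr q`_i| < k.+1%:R^-1)] `&`
  \bigcap_i [set z : hist | (i < N)%N ==> (`|z.2 i - ratr r`_i| < k.+1%:R^-1)] `&`
  [set z : hist | (tail_work z N M.+1%:R < (ratr rho)%:E)%E].

Let measurable_cell p : measurable (cell p).
Proof.
case: p => [[[[[N k] rho] M] q] r] /=.
have h (f : nat -> hist -> R) (c : R) (q' : seq rat) : (forall i, measurable_fun setT (f i)) ->
    measurable (\bigcap_i [set z : hist | (i < N)%N ==> (`|f i z - ratr q'`_i| < c)]).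
  move=> mf; apply: bigcapT_measurable => i; case: (i < N)%N => /=; last first.
    by rewrite (_ : [set _ | _] = setT)//; apply/seteqP; split.
  apply: measurable_pred; apply: measurable_fun_ltr => //.
  apply: (measurableT_comp (@normr_measurable R setT)).
  by apply: measurable_funB => //; exact: mf.
apply: measurableI; last first.
  rewrite -[X in measurable X]setTI.
  by apply: emeasurable_fun_infty_o => //; exact: measurable_tail_work.
apply: measurableI; last by apply: (h (fun i z => z.2 i)); exact: measurable_snd_coord.
apply: measurableI; last by apply: (h (fun i z => z.1 i)); exact: measurable_fst_coord.
exact: measurable_admissible.
Qed.

Let rat_approx (u : nat -> R) N (e : R) : 0 < e ->
  exists q : seq rat, forall i, (i < N)%N -> `|u i - ratr q`_i| < e.
Proof.
move=> e0.
have /choice[f fP] : forall i, exists q : rat, `|u i - ratr q| < e.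
  move=> i; have : u i - e < u i + e by lra.
  move=> /rat_in_itvoo[q]; rewrite in_itv/= => /andP[? ?]; exists q.
  by rewrite ltr_norml; apply/andP; split; lra.
by exists (mkseq f N) => i iN; rewrite nth_mkseq.
Qed.

Let dist_common (a b c u v : R) : `|a - c| < u -> `|b - c| < u -> u < v / 2 -> `|a - b| <= v.
Proof.
rewrite !ltr_norml ler_norml => /andP[? ?] /andP[? ?] ?; apply/andP; split; lra.
Qed.

Let inv_small (e : R) : 0 < e -> exists k : nat, k.+1%:R^-1 < e.
Proof.
move=> e0; exists (Num.bound e^-1).
rewrite -[ltRHS]invrK ltf_pV2 ?posrE ?invr_gt0//.
apply: lt_le_trans (archi_boundP _) _; first by rewrite invr_ge0 ltW.
by rewrite ler_nat.
Qed.

Lemma measurable_path_map x :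
  measurable_fun setT (path_map x : hist -> borel (skorokhod R)).
Proof.
apply: (@measurability _ _ hist (borel (skorokhod R)) setT (path_map x)
  (@open (skorokhod R)) (erefl _)).
move=> _ [U oU <-]; rewrite setTI.
(* Cells not mapped into [U] are replaced by the empty set, which keeps the union indexed by a
   countable type; the inadmissible histories are treated apart. *)
pose good p := if pselect (cell p `<=` path_map x @^-1` U) then cell p else set0.
rewrite (_ : _ @^-1` _ = \bigcup_p good p `|`
    (~` [set z | admissible z] `&` [set z | U point])).
  apply: measurableU.
    apply: countable_bigcupT_measurable => [|p]; first exact: countableP.
    rewrite /good.
    case: pselect => [?|?]; first exact: measurable_cell.
    exact: measurable0.
  apply: measurableI; first by apply: measurableC; exact: measurable_admissible.
  have [Up|nUp] := pselect (U point).
    by rewrite (_ : [set _ | _] = setT)//; apply/seteqP; split.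
  by rewrite (_ : [set _ | _] = set0)//; apply/seteqP; split.
apply/seteqP; split => [z /= Uz|z]; last first.
  move=> [[p _]|/= [naz Up]]; first by rewrite /good; case: pselect => // h; exact: h.
  by rewrite /path_map; case: pselect.
have [az|naz] := pselect (admissible z); last first.
  by right; split => //; move: Uz; rewrite /path_map; case: pselect.
left; have [n0 [e [e0 sub]]] := oU _ Uz.
have [N [h [tau [h0 tau0 ztau near_z]]]] := path_map_near x n0 az e0.
(* Two points closer than [h / 2] to the same rational are within [h] of each other. *)
have [k kh] : exists k : nat, k.+1%:R^-1 < h / 2 by apply: inv_small; lra.
have [rho] := rat_in_itvoo ztau; rewrite in_itv/= => /andP[zrho rhotau].
have k0 : (0 : R) < k.+1%:R^-1 by rewrite invr_gt0 ltr0n.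
have [q zq] := rat_approx z.1 N k0.
have [r zr] := rat_approx z.2 N k0.
exists (N, k, rho, n0, q, r) => //; rewrite /good; case: pselect => [?|].
  split; last by rewrite /= -lte_fin fineK ?tail_work_fin in zrho *.
  by split; [split => // i _ /=; apply/implyP; exact: zq|move=> i _ /=; apply/implyP; exact: zr].
case=> z' [[[/= az' z'q] z'r] z'rho]; apply: sub; apply: near_z => //.
- move=> i iN; move: (z'q i Logic.I); rewrite /= iN/= => h'.
  exact: dist_common h' (zq i iN) kh.
- move=> i iN; move: (z'r i Logic.I); rewrite /= iN/= => h'.
  exact: dist_common h' (zr i iN) kh.
- by apply: lt_trans rhotau; rewrite -lte_fin fineK ?tail_work_fin.
Qed.

End path_map_measurable.

(** * Independent uniform variables and quantiles *)

(** The events [D] that satisfy the product formula form a Dynkin system. *)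
Lemma indep_sigma d (O : measurableType d) (R : realType) (P : probability O R)
    (G : set (set O)) (E : set O) (p : \bar R) :
  setI_closed G -> G `<=` measurable -> measurable E -> P E = p ->
  (forall D, G D -> P (D `&` E) = P D * p)%E ->
  forall D, <<s G >> D -> (P (D `&` E) = P D * p)%E.
Proof.
move=> GI Gm mE PE GP.
have Gmeas D : <<s G >> D -> measurable D.
  by move: D; apply: smallest_sub => //; exact: sigma_algebra_measurable.
have pfin : p \is a fin_num by rewrite -PE fin_num_measure.
have PC (D : set O) : measurable D -> (P (D `&` E) = P D * p)%E ->
    (P (~` D `&` E) = P (~` D) * p)%E.
  move=> mD PD.
  have -> : ~` D `&` E = E `\` (D `&` E).
    by apply/seteqP; split => w /=; [move=> [? ?]; split => // -[]|move=> [? h]; split => // ?; apply: h].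
  have -> : (P (E `\` (D `&` E)) = P E - P (D `&` E))%E.
    rewrite measureD//; last 2 first.
    + exact: measurableI.
    + by rewrite -ge0_fin_numE// fin_num_measure.
    by rewrite setICA setIid.
  rewrite PD PE probability_setC// muleBl ?mul1e ?fin_num_measure//.
have PU (F : (set O)^nat) : (forall n, measurable (F n)) -> trivIset [set: nat] F ->
    (forall n, P (F n `&` E) = P (F n) * p)%E ->
    (P (\bigcup_k F k `&` E) = P (\bigcup_k F k) * p)%E.
  move=> mF tF PF.
  have e1 : (P (\bigcup_k F k `&` E) = \sum_(n <oo) P (F n `&` E))%E.
    rewrite setI_bigcupl; apply: measure_semi_bigcup.
    + by move=> n; exact: measurableI.
    + exact: trivIset_setIr.
    + by apply: bigcupT_measurable => n; exact: measurableI.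
  have e2 : (P (\bigcup_k F k) = \sum_(n <oo) P (F n))%E.
    by apply: measure_semi_bigcup => //; exact: bigcupT_measurable.
  rewrite e1 e2 muleC -(fineK pfin) -nneseriesZl; last by [].
  by apply: eq_eseriesr => n _; rewrite PF fineK// muleC.
apply: (@dynkin_induction _ (g_sigma_algebraType G) G
  (fun D => P (D `&` E) = P D * p)%E) => //.
- by rewrite setTI probability_setT mul1e.
- by move=> D /Gmeas mD; exact: PC.
- by move=> F mF tF PF; apply: PU => // n; exact: Gmeas (mF n).
Qed.

Lemma probability_setI1 d (O : measurableType d) (R : realType) (P : probability O R)
    (A B : set O) : measurable A -> measurable B -> P B = 1%E -> P (A `&` B) = P A.
Proof.
move=> mA mB PB.
have n0 : P (~` B) = 0%E.
  transitivity (1 - P B)%E; first exact: probability_setC.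
  by rewrite PB subee.
have -> : P A = (P (A `&` B) + P (A `&` ~` B))%E.
  rewrite -[in LHS](setIT A) -(setUv B) setIUr; apply: measureU.
  - exact: measurableI.
  - by apply: measurableI => //; exact: measurableC.
  - by rewrite setIACA setICr setI0.
suff -> : P (A `&` ~` B) = 0%E by rewrite adde0.
apply/eqP; rewrite eq_le measure_ge0 andbT -n0; apply: le_measure; rewrite ?inE//.
- by apply: measurableI => //; exact: measurableC.
- exact: measurableC.
Qed.

Section coin.
Context (R : realType).
Local Notation unif := (uniform_prob (@ltr01 R)).

Lemma unif_itv (a b : R) : 0 <= a -> a <= b -> b <= 1 -> unif `[a, b[%classic = (b - a)%:E.
Proof.
move=> a0 ab b1; rewrite /uniform_prob.
rewrite (eq_integral (cst 1%:E)) => [|r]; last first.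
  rewrite inE/= in_itv/= => /andP[ar rb]; rewrite /uniform_pdf subr0 invr1.
  by rewrite (le_trans a0 ar) (le_trans (ltW rb) b1).
rewrite integral_cst//= mul1e.
rewrite [LHS]lebesgue_measure_itv/= lte_fin.
by move: ab; rewrite le_eqVlt => /predU1P[->|->//]; rewrite ltxx subrr.
Qed.

Lemma unif_itvoo (a b : R) : 0 <= a -> a <= b -> b <= 1 -> unif `]a, b[%classic = (b - a)%:E.
Proof.
move=> a0 ab b1; rewrite /uniform_prob.
rewrite (eq_integral (cst 1%:E)) => [|r]; last first.
  rewrite inE/= in_itv/= => /andP[ar rb]; rewrite /uniform_pdf subr0 invr1.
  by rewrite (le_trans a0 (ltW ar)) (le_trans (ltW rb) b1).
rewrite integral_cst//= mul1e.
rewrite [LHS]lebesgue_measure_itv/= lte_fin.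
by move: ab; rewrite le_eqVlt => /predU1P[->|->//]; rewrite ltxx subrr.
Qed.

Lemma unif_setI01 (A : set R) : measurable A -> unif (A `&` `[0, 1[%classic) = unif A.
Proof.
have h : unif (`[0%R, 1%R[%classic : set R) = 1%E by rewrite unif_itv// subr0.
by move=> mA; apply: probability_setI1.
Qed.

(* Binary digits of a uniform variable are fair coins, and conversely. *)
Definition dbl (r : R) : R := if r < 1 / 2 then 2 * r else 2 * r - 1.
Definition bits (r : R) : seqM bool := fun m => ~~ (iter m dbl r < 1 / 2).

Fixpoint dyad (s : seq bool) : R :=
  if s is c :: s' then (c%:R + dyad s') / 2 else 0.

Lemma mkseq_cons (T : Type) (f : nat -> T) n : mkseq f n.+1 = f 0%N :: mkseq (f \o S) n.
Proof. by rewrite /mkseq /= -[1%N]addn0 iotaDl -map_comp. Qed.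

Lemma bitsS r : bits r \o S = bits (dbl r).
Proof. by apply/funext => m; rewrite /bits /= -iterS iterSr. Qed.

Lemma dbl01 r : 0 <= r < 1 -> 0 <= dbl r < 1.
Proof. by rewrite /dbl => /andP[? ?]; case: ltP => ?; apply/andP; split; lra. Qed.

Lemma dyad_itv s : 0 <= dyad s /\ dyad s + 2^-1 ^+ size s <= 1.
Proof.
elim: s => [|c s [ih0 ih1]] /=; first by rewrite expr0 add0r.
by split; [case: c => /=; lra|rewrite exprS; case: c => /=; lra].
Qed.

(** A word of digits cuts out the dyadic interval that starts at [dyad s]; the induction removes the
    first digit by means of the doubling map. *)
Lemma bits_dyad s r : 0 <= r < 1 ->
  (mkseq (bits r) (size s) = s) <-> (dyad s <= r < dyad s + 2^-1 ^+ size s).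
Proof.
elim: s r => [|c s ih] r r01 /=.
  by rewrite expr0 add0r; split.
have b0 : bits r 0%N = ~~ (r < 1 / 2) by [].
rewrite mkseq_cons bitsS b0 exprS {b0}.
have [d0 d1] := dyad_itv s; have := ih _ (dbl01 r01); case/andP: r01 => r0 r1.
rewrite /dbl.
case: ltP => r2 /= [ih1 ih2]; split.
- move=> [<- /ih1 /andP[h1 h2]].
  by apply/andP; split => /=; lra.
- move=> /andP[]; case: c => /= h1 h2; first by exfalso; lra.
  by congr (_ :: _); apply: ih2; apply/andP; split; lra.
- move=> [<- /ih1 /andP[h1 h2]].
  by apply/andP; split => /=; lra.
- move=> /andP[]; case: c => /= h1 h2; last by exfalso; lra.
  by congr (_ :: _); apply: ih2; apply/andP; split; lra.
Qed.

Lemma dyad_rcons s c : dyad (rcons s c) = dyad s + c%:R * 2^-1 ^+ (size s).+1.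
Proof.
elim: s => [|c' s ih] /=; first by rewrite expr1; lra.
rewrite ih (exprS _ (size s).+1); set a := _ ^+ _; set b := dyad s; lra.
Qed.

Definition coin_val (w : seqM bool) : R := limn (fun n => dyad (mkseq w n)).

Lemma mkseq_dyadS (w : nat -> bool) n :
  dyad (mkseq w n.+1) = dyad (mkseq w n) + (w n)%:R * 2^-1 ^+ n.+1.
Proof. by rewrite mkseqS dyad_rcons size_mkseq. Qed.

Lemma is_cvg_dyad (w : nat -> bool) : cvgn (fun n => dyad (mkseq w n)).
Proof.
apply: nondecreasing_is_cvgn.
  apply/nondecreasing_seqP => n; rewrite mkseq_dyadS lerDl mulr_ge0// exprn_ge0// invr_ge0//.
exists 1 => _ [n _ <-]; have [_] := dyad_itv (mkseq w n).
by apply: le_trans; rewrite lerDl exprn_ge0// invr_ge0.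
Qed.

Lemma coin_val_ge0 w : 0 <= coin_val w.
Proof.
apply: limr_ge; first exact: is_cvg_dyad.
by near=> n; case: (dyad_itv (mkseq w n)).
Unshelve. all: by end_near. Qed.

Lemma coin_val_bits r : 0 <= r < 1 -> coin_val (bits r) = r.
Proof.
move=> r01; apply/cvg_lim => //.
have h : 2^-1 ^+ n @[n --> \oo] --> (0 : R) by apply: cvg_expr; rewrite ger0_norm; lra.
apply/cvgrPdist_lt => e e0; move/cvgrPdist_lt : h => /(_ _ e0).
apply: filterS => n; rewrite sub0r normrN ger0_norm ?exprn_ge0 ?invr_ge0//.
apply: le_lt_trans.
have [+ _] := bits_dyad (mkseq (bits r) n) r01; rewrite size_mkseq.
move=> /(_ erefl) /andP[]; set a := _ ^+ _; set b := dyad _ => ? ?.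
by rewrite ler_norml; apply/andP; split; lra.
Qed.

Lemma measurable_dyad n : measurable_fun setT (fun w : seqM bool => dyad (mkseq w n)).
Proof.
elim: n => [|n ih].
  by rewrite (_ : (fun _ => _) = cst 0)//; exact: measurable_cst.
rewrite (_ : (fun _ => _) = fun w : seqM bool => dyad (mkseq w n) + (if w n then 2^-1 ^+ n.+1 else 0)).
  apply: measurable_funD => //; apply: measurable_fun_ifT => //.
  exact: measurable_coord.
by apply/funext => w; rewrite mkseq_dyadS; case: (w n); rewrite ?mul1r ?mul0r.
Qed.

Lemma measurable_coin_val : measurable_fun setT coin_val.
Proof.
apply: (measurable_fun_cvg measurable_dyad) => w _.
exact: is_cvg_dyad.
Qed.

Lemma measurable_dbl : measurable_fun setT dbl.
Proof.
apply: measurable_fun_ifT.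
- exact: measurable_fun_ltr.
- exact: measurable_funM.
- by apply: measurable_funB => //; exact: measurable_funM.
Qed.

Lemma measurable_bits : measurable_fun setT bits.
Proof.
apply: measurable_seqM => m; apply: measurable_neg; apply: measurable_fun_ltr => //.
elim: m => [|m ih]; first exact: measurable_id.
exact: (measurableT_comp measurable_dbl ih).
Qed.

Definition coin : probability (seqM bool) R := law unif measurable_bits.

Definition cyl (s : seq bool) : set (seqM bool) := [set w | mkseq w (size s) = s].

Lemma measurable_cyl s : measurable (cyl s).
Proof.
rewrite (_ : cyl s = \bigcap_i [set w : seqM bool | (i < size s)%N ==> (w i == nth false s i)]).
  apply: bigcapT_measurable => i; case: (i < size s)%N => /=; last first.
    by rewrite (_ : [set _ | _] = setT)//; apply/seteqP; split.
  rewrite -[X in measurable X]setTI.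
  exact: (@measurable_coord _ bool i measurableT [set b | b == nth false s i]).
apply/seteqP; split => w /=.
  by move=> ws i _ /=; apply/implyP => si; rewrite -[in X in _ == X]ws nth_mkseq.
move=> h; apply: (@eq_from_nth _ false); rewrite size_mkseq// => i si.
by rewrite nth_mkseq//; have /implyP/(_ si)/eqP := h i Logic.I.
Qed.

Lemma coin_cyl s : coin (cyl s) = (2^-1 ^+ size s)%:E.
Proof.
rewrite [LHS](_ : _ = unif (bits @^-1` cyl s))//.
rewrite -unif_setI01; last first.
  by rewrite -[X in measurable X]setTI; apply: measurable_bits => //; exact: measurable_cyl.
have [d0 d1] := dyad_itv s; have e0 : (0 : R) <= 2^-1 ^+ size s by rewrite exprn_ge0// invr_ge0.
rewrite (_ : _ `&` _ = `[dyad s, dyad s + 2^-1 ^+ size s[%classic).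
  by rewrite unif_itv ?lerDl// addrC addKr.
apply/seteqP; split => r /=; rewrite !in_itv/=.
  by move=> [h r01]; apply/(bits_dyad s r01).
move=> h; have r01 : 0 <= r < 1.
  by case/andP: h => h1 h2; rewrite (le_trans d0 h1) (lt_le_trans h2 d1).
by split => //; apply/(bits_dyad s r01).
Qed.

(** On [[0, 1[] the map [coin_val] inverts [bits], so a number read off fair coins is uniform
    again. *)
Lemma coin_coin_val A : measurable A -> coin (coin_val @^-1` A) = unif A.
Proof.
move=> mA; rewrite [LHS](_ : _ = unif (bits @^-1` (coin_val @^-1` A)))//.
rewrite -unif_setI01; last first.
  rewrite -[X in measurable X]setTI; apply: measurable_bits => //.
  by rewrite -[X in measurable X]setTI; exact: measurable_coin_val.
rewrite -[in RHS]unif_setI01//; congr (unif _).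
by apply/seteqP; split => r /= [+ r01]; move: (r01); rewrite in_itv/= => /coin_val_bits ->.
Qed.

End coin.

Section coin_blocks.
Context (R : realType).
Local Notation coin := (coin R).
Local Notation Bits := (seqM bool).

Definition cyls : set (set Bits) := set0 |` range cyl.

(** Two cylinders are nested if the shorter word is a prefix of the longer one and disjoint
    otherwise; this is why [cyls] contains the empty set. *)
Lemma cyls_setI : setI_closed cyls.
Proof.
have h s s' : (size s <= size s')%N -> cyls (cyl s `&` cyl s').
  move=> ss'; have [tk|tk] := eqVneq (take (size s) s') s.
    right; exists s' => //; apply/seteqP; split => [w ws'|w [_]//]; split => //=.
    by rewrite /cyl/= -[RHS]tk -[in RHS]ws' /mkseq -map_take take_iota (minn_idPl ss').
  left; apply/seteqP; split => // w [/= ws ws']; move/eqP: tk; apply.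
  by rewrite -ws' -[in RHS]ws /mkseq -map_take take_iota (minn_idPl ss').
move=> A B [->|[s _ <-]] [->|[s' _ <-]]; rewrite ?set0I ?setI0; try by left.
have [ss'|/ltnW ss'] := leqP (size s) (size s'); first exact: h.
by rewrite setIC; exact: h.
Qed.

Lemma cyls_gen : @measurable _ Bits `<=` <<s cyls >>.
Proof.
apply: smallest_sub; first exact: smallest_sigma_algebra.
move=> _ [m _ [A _ <-]]; rewrite setTI.
rewrite (_ : _ @^-1` _ = \bigcup_(s in [set s | size s = m.+1 /\ A (nth false s m)]) cyl s).
  have -> : \bigcup_(s in [set s | size s = m.+1 /\ A (nth false s m)]) cyl s =
      \bigcup_s (if pselect (size s = m.+1 /\ A (nth false s m)) then cyl s else set0).
    apply/seteqP; split => [w [s sA ws]|w [s _]].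
      by exists s => //; case: pselect.
    by case: pselect => //= sA ws; exists s.
  apply: (@countable_bigcupT_measurable _ (g_sigma_algebraType cyls)).
    exact: countableP.
  move=> s; case: pselect => [?|?]; apply: sub_sigma_algebra; last by left.
  by right; exists s.
apply/seteqP; split => [w /= Aw|w [s [sm As] /= ws]].
  exists (mkseq w m.+1); last first.
    by apply: (congr1 (mkseq w)); rewrite size_mkseq.
  by split; rewrite ?size_mkseq// nth_mkseq.
by move: As; rewrite -ws nth_mkseq// sm.
Qed.

Lemma cyls_measurable : cyls `<=` measurable.
Proof. by move=> _ [->|[s _ <-]]; [exact: measurable0|exact: measurable_cyl]. Qed.

Lemma cyls_prob_unique (m1 m2 : probability Bits R) :
  (forall s, m1 (cyl s) = m2 (cyl s)) -> forall A, measurable A -> m1 A = m2 A.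
Proof.
move=> m12; apply: (prob_unique cyls_setI cyls_measurable cyls_gen).
move=> _ [->|[s _ <-]]; last exact: m12.
transitivity (0 : \bar R)%E; [exact: measure0|exact/esym/measure0].
Qed.

Definition flip (m : nat) (w : Bits) : Bits := fun j => if j == m then ~~ w j else w j.

Lemma measurable_flip m : measurable_fun setT (flip m).
Proof.
apply: measurable_seqM => j; rewrite /flip; case: (j == m); last exact: measurable_coord.
by apply: measurable_neg; exact: measurable_coord.
Qed.

Lemma flipK m w : flip m (flip m w) = w.
Proof. by apply/funext => j; rewrite /flip; case: (j == m); rewrite ?negbK. Qed.

(** The preimage of a cylinder under a flip is a cylinder of the same length. *)
Lemma coin_flip m A : measurable A -> coin (flip m @^-1` A) = coin A.
Proof.
move: A; apply: (@cyls_prob_unique (law coin (measurable_flip m)) coin) => s.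
rewrite [LHS](_ : _ = coin (flip m @^-1` cyl s))//.
rewrite (_ : _ @^-1` _ = cyl (mkseq (flip m (nth false s)) (size s))).
  by rewrite !coin_cyl size_mkseq.
apply/seteqP; split => w; rewrite /cyl /= size_mkseq => ws.
  apply: (@eq_from_nth _ false); rewrite !size_mkseq// => i si.
  rewrite !nth_mkseq// -[w in LHS](flipK m) /flip; case: ifP => _.
    by rewrite -[in RHS]ws nth_mkseq// /flip; case: ifP.
  by rewrite -[in RHS]ws nth_mkseq// /flip; case: ifP.
apply: (@eq_from_nth _ false); rewrite !size_mkseq// => i si.
have := congr1 (nth false ^~ i) ws; rewrite !nth_mkseq// /flip.
by case: ifP => // _ ->; rewrite negbK.
Qed.

(** The coordinates in [J] are the visible ones; [J] will be the complement of the coins to be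
    forgotten. *)
Definition off_coords (J : set nat) : set (set Bits) :=
  gen J (fun n (w : Bits) => w n).

Lemma off_coords_measurable J : <<s off_coords J >> `<=` @measurable _ Bits.
Proof.
apply: smallest_sub; first exact: sigma_algebra_measurable.
move=> _ [n _ [A mA <-]]; exact: measurable_coord.
Qed.

(** An event that ignores coin [m] is invariant under its flip, which exchanges the two outcomes of
    that coin; the two halves of [D] therefore have equal probability. *)
Lemma coin_half m D c : <<s off_coords (~` [set m]) >> D ->
  (coin (D `&` [set w | w m = c]) = coin D * (2^-1)%:E)%E.
Proof.
move=> DJ; have mD := off_coords_measurable DJ.
have Dflip : flip m @^-1` D = D.
  suff h : <<s off_coords (~` [set m]) >> `<=` [set A | flip m @^-1` A = A] by exact: h.
  apply: smallest_sub.
    split.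
    - by rewrite /= preimage_set0.
    - by move=> A /= fA; rewrite setTD; exact: (congr1 (@setC _) fA).
    - by move=> F fF /=; rewrite preimage_bigcup; apply: eq_bigcupr => i _; exact: fF.
  move=> _ [n /= nm [A mA <-]]; rewrite !setTI; apply/seteqP; split => w /=;
    by rewrite /flip; move/eqP/negbTE : nm => ->.
have mc b : measurable [set w : Bits | w m = b].
  rewrite -[X in measurable X]setTI.
  exact: (@measurable_coord _ bool m measurableT [set b' | b' = b]).
have E : coin (D `&` [set w | w m = c]) = coin (D `&` [set w | w m = ~~ c]).
  rewrite -(@coin_flip m); last by apply: measurableI; [exact: mD|exact: mc].
  rewrite preimage_setI Dflip; congr (coin (_ `&` _)).
  by apply/seteqP; split => w /=; rewrite /flip eqxx; [move=> <-|move=> ->]; rewrite negbK.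
have S : coin D = (coin (D `&` [set w | w m = c]) + coin (D `&` [set w | w m = ~~ c]))%E.
  transitivity (coin ((D `&` [set w | w m = c]) `|` (D `&` [set w | w m = ~~ c]))).
    rewrite -setIUr; congr (coin _); rewrite (_ : _ `|` _ = setT) ?setIT//.
    by apply/seteqP; split => w //= _; case: (w m); case: (c); tauto.
  apply: measureU; try by apply: measurableI; [exact: mD|exact: mc].
  apply/seteqP; split => w //= -[[_ ->] [_ /esym]].
  by case: (c).
rewrite S -E.
have fi : coin (D `&` [set w | w m = c]) \is a fin_num.
  by apply: fin_num_measure; apply: measurableI; [exact: mD|exact: mc].
rewrite -(fineK fi) -EFinD -EFinM; congr EFin; lra.
Qed.

(* Splitting the coins into countably many independent blocks. *)
Definition block (k : nat) : set nat := [set pickle (k, i) | i in [set: nat]].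
Definition sub (k : nat) (w : Bits) : Bits := fun i => w (pickle (k, i)).

Lemma measurable_sub k : measurable_fun setT (sub k).
Proof. by apply: measurable_seqM => i; exact: measurable_coord. Qed.

Lemma coin_sub k D C : <<s off_coords (~` block k) >> D -> measurable C ->
  (coin (D `&` sub k @^-1` C) = coin D * coin C)%E.
Proof.
move=> DJ mC.
have offS J J' : J `<=` J' -> <<s off_coords J >> `<=` <<s off_coords J' >>.
  move=> JJ'; apply: smallest_sub; first exact: smallest_sigma_algebra.
  by move=> A [n Jn h]; apply: sub_sigma_algebra; exists n; [exact: JJ'|exact: h].
have cylE D' s : <<s off_coords (~` block k) >> D' -> (coin (D' `&` sub k @^-1` cyl s) = coin D' * (2^-1 ^+ size s)%:E)%E.
  move=> D'J; elim/last_ind: s => [|s c ih].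
    rewrite expr0 mule1 (_ : sub k @^-1` cyl [::] = setT) ?setIT//.
    by apply/seteqP; split => // w _.
  set m := pickle (k, size s).
  (* The event [D'] and the earlier coins of the block both ignore coin [m], so prescribing this
     last coin halves the probability. *)
  rewrite (_ : D' `&` _ = (D' `&` sub k @^-1` cyl s) `&` [set w | w m = c]).
    rewrite coin_half ?ih ?size_rcons ?exprSr ?EFinM ?muleA//.
    apply: (@measurableI _ (g_sigma_algebraType (off_coords (~` [set m])))).
      by apply: (offS _ _ _ _ D'J) => n /= nb nm; apply: nb; exists (size s).
    rewrite (_ : _ @^-1` _ = \bigcap_i [set w : Bits | (i < size s)%N ==> (w (pickle (k, i)) == nth false s i)]).
      apply: (@bigcapT_measurable _ (g_sigma_algebraType (off_coords (~` [set m])))) => i.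
      case: ltnP => si /=; last first.
        rewrite (_ : [set _ | _] = setT); last by apply/seteqP; split.
        exact: (@measurableT _ (g_sigma_algebraType (off_coords (~` [set m])))).
      apply: sub_sigma_algebra; exists (pickle (k, i)).
        by move=> /= /(pcan_inj pickleK)[] si'; move: si; rewrite si' ltnn.
      by exists [set b | b == nth false s i] => //; rewrite setTI.
    apply/seteqP; split => w /=.
      move=> ws i _ /=; apply/implyP => si.
      by have := congr1 (nth false ^~ i) ws; rewrite nth_mkseq// /sub => <-.
    move=> h; apply: (@eq_from_nth _ false); rewrite size_mkseq// => i si.
    by rewrite nth_mkseq// /sub; have /implyP/(_ si)/eqP := h i Logic.I.
  have cylS w : cyl (rcons s c) w <-> cyl s w /\ w (size s) = c.
    rewrite -[X in X <-> _]/(mkseq w (size (rcons s c)) = rcons s c) size_rcons mkseqS.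
    by split => [/rcons_inj[]|[<- ->]]; [split|rewrite size_mkseq].
  apply/seteqP; split => w /=.
    by move=> [Dw /cylS[]].
  by move=> [[Dw ws] wc]; split => //; apply/cylS.
have mD := off_coords_measurable DJ.
have subE s : coin (sub k @^-1` cyl s) = (2^-1 ^+ size s)%:E.
  rewrite -[X in coin X]setTI cylE; last exact: (@measurableT _ (g_sigma_algebraType _)).
  by rewrite [X in (X * _)%E](_ : _ = 1%E) ?mul1e//; exact: probability_setT.
have coinE A : measurable A -> coin A = coin (sub k @^-1` A).
  move: A; apply: (@cyls_prob_unique coin (law coin (measurable_sub k))) => s.
  by rewrite coin_cyl -subE.
rewrite setIC muleC (coinE C mC).
apply: (@indep_sigma _ _ _ coin [set sub k @^-1` A | A in cyls]) => //.
- move=> _ _ [A cA <-] [B cB <-]; exists (A `&` B); first exact: cyls_setI.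
  by rewrite preimage_setI.
- move=> _ [A cA <-]; rewrite -[X in measurable X]setTI; apply: measurable_sub => //.
  exact: cyls_measurable.
- move=> _ [A [->|[s _ <-]] <-]; last by rewrite setIC cylE// muleC subE.
  by rewrite preimage_set0 set0I measure0 mul0e.
- move: C mC; rewrite -/(measurable `<=` [set C | <<s [set sub k @^-1` A | A in cyls] >> (sub k @^-1` C)]).
  apply: subset_trans cyls_gen _; apply: smallest_sub; last first.
    by move=> A cA; apply: sub_sigma_algebra; exists A.
  split.
  + by rewrite /= preimage_set0; exact: sigma_algebra0.
  + by move=> A /= h; rewrite setTD preimage_setC; exact: sigma_algebraC.
  + by move=> F h /=; rewrite preimage_bigcup; exact: sigma_algebra_bigcup.
Qed.

End coin_blocks.

Section quantile.
Context (R : realType) (G : probability R R).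
Hypothesis G_pos : G `]0, +oo[%classic = 1%E.
Local Notation unif := (uniform_prob (@ltr01 R)).

(** [G] is viewed as the law of the identity, which gives access to the properties of distribution
    functions. *)
Let idG : measurableTypeR R -> R := idfun.
#[local] HB.instance Definition _ :=
  @isMeasurableFun.Build _ _ _ _ idG (@measurable_id _ _ setT).

Let midG : measurable_fun setT (id : R -> measurableTypeR R).
Proof. by move=> _ A mA; rewrite setTI. Qed.

Let cdfE r : cdf (idG : {RV law G midG >-> R}) r = G `]-oo, r]%classic.
Proof. by []. Qed.

Let F r : R := fine (G `]-oo, r]%classic).

Let FE r : (F r)%:E = G `]-oo, r]%classic.
Proof. by rewrite fineK// fin_num_measure. Qed.

Let F_nd : {homo F : r s / r <= s}.
Proof. by move=> r s rs; rewrite -lee_fin !FE -!cdfE; exact: cdf_nondecreasing. Qed.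

Let F_le0 r : r <= 0 -> F r = 0.
Proof.
move=> r0; apply/eqP; rewrite eq_le fine_ge0// andbT -lee_fin FE.
have G0 : G `]-oo, 0]%classic = 0%:E.
  rewrite -setCitvr; transitivity (1 - G `]0%R, +oo[%classic)%E; first exact: probability_setC.
  by rewrite G_pos subee.
by rewrite -G0; apply: le_measure; rewrite ?inE//; apply: subset_itvl; rewrite bnd_simp.
Qed.

Let F_ge0 r : 0 <= F r.
Proof. exact: fine_ge0. Qed.

Let F_le1 r : F r <= 1.
Proof. by rewrite -lee_fin FE; exact: probability_le1. Qed.

Let F_right r : F s @[s --> r^'+] --> F r.
Proof.
apply: (fine_cvg (f := fun s => G `]-oo, s]%classic)); rewrite FE.
exact: (@cdf_right_continuous _ _ _ _ (idG : {RV law G midG >-> R}) r).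
Qed.

Let F_y : F s @[s --> +oo%R] --> (1 : R).
Proof. exact: (fine_cvg (cvg_cdfy1 (idG : {RV law G midG >-> R}))). Qed.

(* The value 1 outside ]0, 1[ only serves to keep [quantile] positive everywhere. *)
Definition quantile (u : R) : R :=
  if (0 < u) && (u < 1) then inf [set y | u <= F y] else 1.

(** The infimum is over a nonempty set because [F] tends to 1, over a set bounded below because [F]
    vanishes on the negative axis, and it is attained because [F] is right-continuous. *)
Lemma quantile_le u c : 0 < u < 1 -> (quantile u <= c) = (u <= F c).
Proof.
move=> u01; have /andP[u0 u1] := u01.
rewrite /quantile u01.
set A := [set y | u <= F y].
have A0 : A !=set0.
  have /cvgrPdist_lt/(_ (1 - u)) := F_y.
  rewrite subr_gt0 => /(_ u1)[M [_ h]].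
  have := h (M + 1); rewrite ltrDl ltr01 => /(_ isT).
  rewrite ltr_norml => /andP[_ h']; exists (M + 1); rewrite /A /=; lra.
have Alb : has_lbound A.
  exists 0 => y /= uy; rewrite leNgt; apply/negP => /ltW /F_le0 Fy.
  by move: uy; rewrite /A/= Fy leNgt u0.
have hA : has_inf A by split.
apply/idP/idP => [Ac|uc]; last exact: ge_inf.
suff uF : u <= F (inf A) by apply: le_trans uF _; exact: F_nd.
rewrite leNgt; apply/negP => Fu.
have /cvgrPdist_lt/(_ (u - F (inf A))) := @F_right (inf A).
rewrite subr_gt0 => /(_ Fu) near_inf.
have : \forall s \near (inf A)^'+, False.
  near=> s.
  have sA : inf A < s by near: s; exact: nbhs_right_gt.
  have Fs : F s < u.
    have : `|F (inf A) - F s| < u - F (inf A) by near: s.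
    by rewrite ltr_norml => /andP[]; lra.
  have sA0 : 0 < s - inf A by rewrite subr_gt0.
  have [y Ay ys] := inf_adherent sA0 hA.
  rewrite addrC subrK in ys.
  have : u <= F s by apply: le_trans Ay _; apply: F_nd; exact: ltW.
  by rewrite leNgt Fs.
by move=> /filter_ex[].
Unshelve. all: by end_near. Qed.

Lemma quantile_gt0 u : 0 < quantile u.
Proof.
have [u01|] := boolP ((0 < u) && (u < 1)); last first.
  by rewrite /quantile => /negbTE ->; exact: ltr01.
by rewrite ltNge quantile_le// F_le0// -ltNge; case/andP: u01.
Qed.

Lemma quantile_preimage c : quantile @^-1` `]c, +oo[%classic `&` `]0, 1[%classic =
  `]F c, 1[%classic.
Proof.
apply/seteqP; split => u /=; rewrite !in_itv/= !andbT.
  by move=> [+ u01]; rewrite ltNge quantile_le// -ltNge => ->; case/andP: u01.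
move=> /andP[Fu u1]; have u01 : 0 < u < 1 by rewrite u1 (le_lt_trans (F_ge0 c) Fu).
by split => //; rewrite ltNge quantile_le// -ltNge.
Qed.

Lemma measurable_quantile : measurable_fun setT quantile.
Proof.
apply: (measurability _ (RGenOInfty.measurableE R)).
move=> _ [_ [c ->] <-]; rewrite setTI.
have m01 : measurable `](0:R), 1[%classic by [].
rewrite -[X in measurable X]setIT -(setUv `](0:R), 1[%classic) setIUr.
apply: measurableU; first by rewrite quantile_preimage.
rewrite (_ : _ `&` _ = if pselect (c < 1) then ~` `](0:R), 1[%classic else set0).
  by case: pselect => ?; [exact: measurableC|exact: measurable0].
case: pselect => c1; apply/seteqP; split => u //=; rewrite !in_itv/= ?andbT.
- by case.
- move=> h; split => //; rewrite /quantile ifF//; exact/negP.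
- by move=> [+ h]; rewrite /quantile ifF//; exact/negP.
Qed.

Lemma unif_quantile C : measurable C -> unif (quantile @^-1` C) = G C.
Proof.
move: C; apply: (@prob_unique _ _ _ (law unif measurable_quantile) G (@RGenOInfty.G R)).
- move=> _ _ [x ->] [y ->]; exists (Num.max x y).
  by apply/seteqP; split => u /=; rewrite !in_itv/= !andbT gt_max; [move=> [-> ->]|move=> /andP[]].
- by move=> _ [x ->].
- move=> A mA; suff: (@RGenOInfty.G R).-sigma.-measurable A by [].
  by rewrite -RGenOInfty.measurableE.
- move=> _ [c ->]; rewrite [LHS](_ : _ = unif (quantile @^-1` `]c, +oo[%classic))//.
  have m01 : unif (`]0%R, 1%R[%classic : set R) = 1%E by rewrite unif_itvoo// subr0.
  transitivity (unif (quantile @^-1` `]c, +oo[%classic `&` `]0%R, 1%R[%classic)).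
    apply/esym; apply: probability_setI1 => //.
    by rewrite -[X in measurable X]setTI; exact: measurable_quantile.
  rewrite quantile_preimage unif_itvoo// EFinB FE -setCitvl.
  by apply/esym; exact: probability_setC.
Qed.

End quantile.

(** * Comparison of two systems driven by the same sizes *)

Lemma measurable_index d (O : measurableType d) d' (T : measurableType d')
    (K : O -> nat) (f : nat -> O -> T) :
  measurable_fun setT K -> (forall k, measurable_fun setT (f k)) ->
  measurable_fun setT (fun w => f (K w) w).
Proof.
move=> mK mf _ A mA; rewrite setTI.
rewrite (_ : _ @^-1` _ = \bigcup_k ((K @^-1` [set k]) `&` (f k @^-1` A))).
  apply: bigcupT_measurable => k; apply: measurableI; rewrite -[X in measurable X]setTI.
    exact: mK.
  exact: mf.
by apply/seteqP; split => [w Aw|w [k _ [/= -> ]]//]; exists (K w).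
Qed.

Section run.
Context (R : realType).
Implicit Types (t u s b : nat -> R) (q : nat -> hist R -> R).

(* The jumps before the [n]-th arrival and the number of customers served among them:
   arrival [m] is served if [u m < q m] at the current history, and the [k]-th customer
   served brings [s k]. *)
Fixpoint run q t u s n : (nat -> R) * nat :=
  if n is m.+1 then
    let bk := run q t u s m in
    if u m < q m (t, bk.1) then (upd m bk.1 (s bk.2), bk.2.+1) else bk
  else (fun=> 0, 0%N).

Definition jumps q t u s n : R := (run q t u s n.+1).1 n.

Lemma run_out q t u s n i : (n <= i)%N -> (run q t u s n).1 i = 0.
Proof.
elim: n => // n ih ni; rewrite /=; case: ifP => _ /=; last exact/ih/ltnW.
by rewrite /upd gtn_eqF// ih// ltnW.
Qed.

Lemma run_jumps q t u s n : (run q t u s n).1 = trunc n (jumps q t u s).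
Proof.
elim: n => [|n ih]; first by apply/funext => i; rewrite /trunc ltn0.
rewrite truncS -ih; apply/funext => i; rewrite /upd; case: eqVneq => [->//|ni].
by rewrite /=; case: ifP => //= _; rewrite /upd (negbTE ni).
Qed.

Lemma jumpsE q t u s n :
  jumps q t u s n = if u n < q n (t, trunc n (jumps q t u s)) then s (run q t u s n).2 else 0.
Proof.
rewrite -run_jumps /jumps /=; case: ifP => _ /=; last exact: run_out.
by rewrite /upd eqxx.
Qed.

(** Sizes are consumed in order, so the work brought depends on the decisions only through the
    number served. Comparing work thus reduces to comparing counts. *)
Lemma run_sum q t u s n :
  \sum_(i < n) jumps q t u s i = \sum_(k < (run q t u s n).2) s k.
Proof.
elim: n => [|n ih]; first by rewrite !big_ord0.
rewrite big_ord_recr/= ih jumpsE -run_jumps.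
by case: ifP => _ /=; rewrite ?addr0// big_ord_recr.
Qed.

(** As long as at most [k] customers have been served, sizes from the [k]-th on have not been looked
    at; hence the next size to be handed out is independent of the run so far. *)
Lemma run_ext q t u s s' k : (forall j, (j < k)%N -> s j = s' j) -> forall n,
  ((run q t u s n).2 <= k)%N -> run q t u s n = run q t u s' n.
Proof.
move=> ss'; elim=> //= n ih.
have [|/=] := boolP (u n < q n (t, (run q t u s n).1)) => c /=.
  by move=> kk; rewrite -(ih (ltnW kk)) c ss'.
by move=> /ih <-; rewrite (negbTE c).
Qed.

(** Only the decisions before [n] are required to be measurable, so that the result also applies to
    sigma-algebras that ignore the [n]-th uniform. *)
Lemma measurable_run d (O : measurableType d) (q : nat -> hist R -> R)
    (t u s : nat -> O -> R) n :
  (forall n, measurable_fun setT (q n)) ->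
  (forall n, measurable_fun setT (t n)) ->
  (forall i, (i < n)%N -> measurable_fun setT (u i)) ->
  (forall k, measurable_fun setT (s k)) ->
  measurable_fun setT (fun w => (t ^~ w, (run q (t ^~ w) (u ^~ w) (s ^~ w) n).1) : hist R) /\
  measurable_fun setT (fun w => (run q (t ^~ w) (u ^~ w) (s ^~ w) n).2).
Proof.
move=> mq mt + ms; elim: n => [_|n ih mu].
  split => //=; apply: (measurable_hist mt) => i; exact: measurable_cst.
have [mb mk] := ih (fun i ni => mu i (ltnW ni)).
have mc : measurable_fun setT (fun w => u n w < q n (t ^~ w, (run q (t ^~ w) (u ^~ w) (s ^~ w) n).1)).
  apply: measurable_fun_ltr; first exact: mu.
  exact: (measurableT_comp (mq n) mb).
split.
- rewrite (_ : (fun w => _) = fun w =>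
    if u n w < q n (t ^~ w, (run q (t ^~ w) (u ^~ w) (s ^~ w) n).1)
    then (t ^~ w, upd n (run q (t ^~ w) (u ^~ w) (s ^~ w) n).1 (s (run q (t ^~ w) (u ^~ w) (s ^~ w) n).2 w)) : hist R
    else (t ^~ w, (run q (t ^~ w) (u ^~ w) (s ^~ w) n).1)).
    apply: measurable_fun_ifT => //.
    have mp : measurable_fun setT (fun w => ((t ^~ w, (run q (t ^~ w) (u ^~ w) (s ^~ w) n).1) : hist R,
        s (run q (t ^~ w) (u ^~ w) (s ^~ w) n).2 w)).
      by apply: measurable_fun_pair => //; exact: measurable_index.
    exact: (measurableT_comp (measurable_upd n) mp).
  by apply/funext => w /=; case: ifP.
- rewrite (_ : (fun w => _) = fun w =>
    if u n w < q n (t ^~ w, (run q (t ^~ w) (u ^~ w) (s ^~ w) n).1)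
    then (run q (t ^~ w) (u ^~ w) (s ^~ w) n).2.+1
    else (run q (t ^~ w) (u ^~ w) (s ^~ w) n).2).
    apply: measurable_fun_ifT => //.
    exact: (measurableT_comp (f := S) _ mk).
  by apply/funext => w /=; case: ifP.
Qed.

(* The workload has not run out before the [n]-th arrival; an arrival at the very time
   at which it runs out still counts. *)
Definition alive (x : R) (n : nat) (z : (nat -> R) * (nat -> R)) : bool :=
  all (fun j => z.1 j <= x + \sum_(i < j) z.2 i) (iota 0 n.+1).

Lemma aliveP (x : R) n (z : (nat -> R) * (nat -> R)) :
  reflect (forall j, (j <= n)%N -> z.1 j <= x + \sum_(i < j) z.2 i) (alive x n z).
Proof.
apply: (iffP allP) => h j; first by move=> jn; apply: h; rewrite mem_iota.
by rewrite mem_iota/= add0n ltnS => /h.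
Qed.

Lemma sum_trunc (b : nat -> R) n j : (j <= n)%N ->
  \sum_(i < j) trunc n b i = \sum_(i < j) b i.
Proof. by move=> jn; apply: eq_bigr => i _; rewrite /trunc (leq_trans (ltn_ord i) jn). Qed.

Lemma alive_trunc x n (z : hist R) : alive x n (trunch n z) = alive x n z.
Proof.
by apply/aliveP/aliveP => h j jn; have := h j jn; rewrite /= sum_trunc.
Qed.

Section comparison.
Variables (x : R) (phi : R -> R) (qh q : nat -> hist R -> R).
Hypothesis qE : forall n z, q n z =
  if alive x n z then phi (x + \sum_(i < n) z.2 i - z.1 n) else 0.
Hypothesis qh_le : forall n z, qh n z <= q n z.
Variables (t u s : nat -> R).
Hypotheses (u0 : forall n, 0 <= u n) (s0 : forall k, 0 <= s k).

Lemma sum_mono m n : (m <= n)%N -> \sum_(k < m) s k <= \sum_(k < n) s k.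
Proof.
elim: n => [|n ih]; first by rewrite leqn0 => /eqP ->.
by rewrite leq_eqVlt => /predU1P[->//|/ih h]; rewrite [leRHS]big_ord_recr ler_wpDr.
Qed.

(* While the two counts agree the workloads agree too, so a join in the thinned
   system forces one in the other; a count that lags behind can at most catch up. *)
Lemma run_index_mono n : ((run qh t u s n).2 <= (run q t u s n).2)%N.
Proof.
(* Not having run out involves the partial sums at every earlier arrival, so the induction carries
   the comparison for all of them. *)
suff H m : (m <= n)%N -> ((run qh t u s m).2 <= (run q t u s m).2)%N by exact: H.
elim: n m => [|n ih] m; first by rewrite leqn0 => /eqP ->.
rewrite leq_eqVlt => /predU1P[->|]; last exact: ih.
rewrite /=; have := ih n (leqnn n); rewrite leq_eqVlt => /predU1P[E|lt_n]; last first.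
  have le_n := ltnW lt_n.
  by case: ifP => _; case: ifP => _ //=; exact: leqW.
case: ifPn => [join|_]; last by rewrite E; case: ifP => /=.
suff -> : u n < q n (t, (run q t u s n).1) by rewrite /= E.
rewrite !run_jumps in join *.
have := lt_le_trans join (qh_le _ _); rewrite !qE.
case: ifPn => [al|_]; last by rewrite ltNge u0.
rewrite (_ : alive x n _).
  by rewrite /= !sum_trunc// !run_sum E.
apply/aliveP => j jn; have /aliveP/(_ j jn) := al.
rewrite /= !sum_trunc// !run_sum => /le_trans; apply.
by rewrite lerD2l; apply: sum_mono; exact: ih.
Qed.

Lemma jumps_partial_le n :
  \sum_(i < n) jumps qh t u s i <= \sum_(i < n) jumps q t u s i.
Proof. by rewrite !run_sum; exact/sum_mono/run_index_mono. Qed.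

End comparison.

(** As the epochs increase, the arrivals up to time [r] form an initial segment, so the work by time
    [r] is compared through the partial sums of the hypothesis. *)
Lemma tail_work_mono (z z' : hist R) r :
  z.1 = z'.1 -> (forall n, z.1 n < z.1 n.+1) ->
  (forall n, 0 <= z.2 n) -> (forall n, 0 <= z'.2 n) ->
  (forall n, \sum_(i < n) z.2 i <= \sum_(i < n) z'.2 i) ->
  (tail_work z 0 r <= tail_work z' 0 r)%E.
Proof.
move=> zz' inc b0 b'0 bb'.
have mono i j : (i <= j)%N -> z.1 i <= z.1 j.
  elim: j => [|j ih]; first by rewrite leqn0 => /eqP ->.
  by rewrite leq_eqVlt => /predU1P[->//|/ih h]; exact: le_trans h (ltW _).
have partial n : \sum_(i < n) jump z r i <= \sum_(i < n) jump z' r i.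
  elim: n => [|n ih]; first by rewrite !big_ord0.
  have [tn|tn] := leP (z.1 n) r; last first.
    have j0 z0 : z0.1 = z.1 -> jump z0 r n = 0 by rewrite /jump => ->; rewrite (lt_geF tn).
    by rewrite !big_ord_recr/= !j0// !addr0.
  have full z0 : z0.1 = z.1 -> (forall n, 0 <= z0.2 n) ->
      \sum_(i < n.+1) jump z0 r i = \sum_(i < n.+1) z0.2 i.
    move=> z0z b0'; apply: eq_bigr => i _.
    by rewrite /jump z0z (le_trans (mono _ _ _) tn) ?ger0_norm// -ltnS.
  by rewrite !full.
rewrite /tail_work; apply: lee_lim.
- by apply: is_cvg_nneseries => i _ _; rewrite lee_fin jump_ge0.
- by apply: is_cvg_nneseries => i _ _; rewrite lee_fin jump_ge0.
by near=> n; rewrite !big_mkord !sumEFin lee_fin.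
Unshelve. all: by end_near. Qed.

Lemma path_map_mono x (z z' : hist R) :
  admissible z -> admissible z' -> z.1 = z'.1 ->
  (forall n, \sum_(i < n) z.2 i <= \sum_(i < n) z'.2 i) ->
  pathwise_le (path_map x z) (path_map x z').
Proof.
move=> az az' zz' bb' r r0; rewrite !path_mapE//.
have wz : work z r <= work z' r.
  apply: fine_le; rewrite ?tail_work_fin//.
  by case: az az' => [_ ? ? _] [_ _ ? _]; exact: tail_work_mono.
by rewrite ge_max !le_max !lerB ?lerD2l//= lexx orbT.
Qed.

End run.

(** * Laws determined by a kernel *)

Section kernel.
Context (R : realType).
Local Open Scope ereal_scope.

Section defs.
Context d (O : measurableType d).

Definition history (t b : nat -> O -> R) (n : nat) (w : O) : hist R :=
  (t ^~ w, trunc n (b ^~ w)).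

(* Given the epochs and the first [n] jumps, the [n]-th jump is distributed as [G]
   with probability [q n] and is [0] otherwise. *)
Definition has_kernel (P : probability O R) (t b : nat -> O -> R)
    (q : nat -> hist R -> R) (G : probability R R) : Prop :=
  forall n, exists (J : set O) (S : O -> R),
    [/\ measurable J, measurable_fun setT S,
      forall w, (J w -> b n w = S w) /\ (~ J w -> b n w = 0%R),
      forall A C, measurable A -> measurable C ->
        P (history t b n @^-1` A `&` J `&` S @^-1` C) =
        P (history t b n @^-1` A `&` J) * G C
    & forall A, measurable A -> P (history t b n @^-1` A `&` J) =
        \int[pushforward P (history t b n)]_(z in A) (q n z)%:E].

Variables (P : probability O R) (t b : nat -> O -> R).
Hypotheses (mt : forall n, measurable_fun setT (t n))
           (mb : forall n, measurable_fun setT (b n)).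

Lemma measurable_history n : measurable_fun setT (history t b n).
Proof.
exact: (measurableT_comp (@measurable_trunch R n) (measurable_hist mt mb)).
Qed.

Lemma historyS n : history t b n.+1 =
  (fun z : hist R * R => (z.1.1, upd n z.1.2 z.2) : hist R) \o (fun w => (history t b n w, b n w)).
Proof. by apply/funext => w; rewrite /history truncS. Qed.

(** Expresses the joint law of history and next jump by the law of the history, [q] and [G] alone:
    either a draw from [G] or an atom at 0. This is what lets a kernel determine a law. *)
Lemma kernel_rect q G n A C : has_kernel P t b q G -> measurable A -> measurable C ->
  P [set w | A (history t b n w) /\ C (b n w)] =
  (\int[pushforward P (history t b n)]_(z in A) (q n z)%:E) * G C +
  (P (history t b n @^-1` A) - \int[pushforward P (history t b n)]_(z in A) (q n z)%:E) *
    (\1_C (0 : R))%:E.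
Proof.
move=> /(_ n)[J [S [mJ mS bJ K1 K2]]] mA mC.
have mZ : measurable (history t b n @^-1` A).
  by rewrite -[X in measurable X]setTI; exact: measurable_history.
have mSC : measurable (S @^-1` C) by rewrite -[X in measurable X]setTI; exact: mS.
rewrite -!K2// -K1//.
rewrite (_ : [set w | _] = (history t b n @^-1` A `&` J `&` S @^-1` C) `|`
   (if pselect (C 0%R) then history t b n @^-1` A `\` J else set0)); last first.
  apply/seteqP; split => w /=.
    move=> [Aw Cw]; have [Jw|nJw] := pselect (J w).
      by left; split => //; rewrite -(bJ w).1.
    by right; case: pselect => // nC; apply: nC; rewrite -((bJ w).2 nJw).
  move=> [[[Aw Jw] Sw]|]; first by split => //; rewrite (bJ w).1.
  by case: pselect => //= C0 [Aw nJ]; split => //; rewrite (bJ w).2.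
have mAJ : measurable (history t b n @^-1` A `&` J) by exact: measurableI.
have mD : measurable (history t b n @^-1` A `\` J) by exact: measurableD.
case: pselect => /= C0; last first.
  by rewrite setU0 indicE memNset// mule0 adde0.
rewrite indicE mem_set// mule1.
have -> : (P (history t b n @^-1` A) - P (history t b n @^-1` A `&` J) =
    P (history t b n @^-1` A `\` J))%E.
  apply/esym; apply: measureD => //.
  by rewrite -ge0_fin_numE// fin_num_measure.
apply: measureU => //; first exact: measurableI.
by apply/seteqP; split => w //= [[[_ Jw] _] [_]].
Qed.

End defs.

(** Induction on the number of jumps: the empty history carries only the epochs, whose laws agree,
    and [kernel_rect] adds one jump. The laws of all truncations then determine the law of the
    whole. *)
Lemma kernel_law_unique d1 d2 (O1 : measurableType d1) (O2 : measurableType d2)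
    (P1 : probability O1 R) (P2 : probability O2 R)
    (t1 b1 : nat -> O1 -> R) (t2 b2 : nat -> O2 -> R) q G
    (mt1 : forall n, measurable_fun setT (t1 n)) (mb1 : forall n, measurable_fun setT (b1 n))
    (mt2 : forall n, measurable_fun setT (t2 n)) (mb2 : forall n, measurable_fun setT (b2 n)) :
  has_kernel P1 t1 b1 q G -> has_kernel P2 t2 b2 q G ->
  (forall A : set (seqM R), measurable A ->
    P1 [set w | A (t1 ^~ w)] = P2 [set w | A (t2 ^~ w)]) ->
  forall A : set (hist R), measurable A ->
    P1 [set w | A (t1 ^~ w, b1 ^~ w)] = P2 [set w | A (t2 ^~ w, b2 ^~ w)].
Proof.
move=> k1 k2 tt.
have step n : forall A, measurable A ->
    P1 (history t1 b1 n @^-1` A) = P2 (history t2 b2 n @^-1` A).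
  elim: n => [|n ih] A mA.
    have := tt [set t | A (t, fun=> 0%R)]; apply.
    rewrite -[X in measurable X]setTI.
    exact: (pair2_measurable ((fun=> 0%R) : seqM R)).
  rewrite !historyS !comp_preimage.
  set f := fun z : hist R * R => _.
  have mh1 : measurable_fun setT (fun w => (history t1 b1 n w, b1 n w)).
    by apply: measurable_fun_pair; [exact: measurable_history|exact: mb1].
  have mh2 : measurable_fun setT (fun w => (history t2 b2 n w, b2 n w)).
    by apply: measurable_fun_pair; [exact: measurable_history|exact: mb2].
  have mfA : measurable (f @^-1` A).
    by rewrite -[X in measurable X]setTI; exact: measurable_upd.
  apply: (@prob_unique_prod _ _ _ _ _ (law P1 mh1) (law P2 mh2)) mfA => B C mB mC.
  rewrite [LHS](_ : _ = P1 [set w | B (history t1 b1 n w) /\ C (b1 n w)])//.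
  rewrite [RHS](_ : _ = P2 [set w | B (history t2 b2 n w) /\ C (b2 n w)])//.
  rewrite (kernel_rect mt1 mb1 n k1)// (kernel_rect mt2 mb2 n k2)// ih//.
  have e : \int[pushforward P1 (history t1 b1 n)]_(z in B) (q n z)%:E =
      \int[pushforward P2 (history t2 b2 n)]_(z in B) (q n z)%:E.
    apply: (@eq_measure_integral _ _ _ B (law P2 (measurable_history mt2 mb2 n))
      (law P1 (measurable_history mt1 mb1 n))) => D mD ?.
    exact: ih.
  by rewrite e.
have m1 := measurable_hist mt1 mb1; have m2 := measurable_hist mt2 mb2.
move=> A mA; apply: (@hist_prob_unique R (law P1 m1) (law P2 m2)) mA => n B mB.
exact: step.
Qed.

End kernel.

(** * The coupling space: epochs and an independent supply of fair coins *)

Section canonical.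
Context (R : realType) d (O : measurableType d) (P : probability O R).
Local Notation coin := (coin R).
Local Notation Bits := (seqM bool).
Variables (t : nat -> O -> R) (mt : forall n, measurable_fun setT (t n)).
Variables (G : probability R R) (G_pos : G `]0, +oo[%classic = 1%E).

Definition canonical := (P \x coin)%E.

HB.instance Definition _ := Measure.on canonical.

Let canonicalT : canonical setT = 1%E.
Proof.
transitivity (P setT * coin setT)%E; first by rewrite -setXTT; exact: product_measure1E.
by rewrite (@probability_setT _ _ _ P) (@probability_setT _ _ _ coin) mul1e.
Qed.

HB.instance Definition _ := Measure_isProbability.Build _ _ _ canonical canonicalT.

Local Notation unif := (uniform_prob (@ltr01 R)).

(* The same space with the [k]-th block of coins forgotten. *)
Definition off_block k := (O * g_sigma_algebraType (off_coords (~` block k)))%type.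

Lemma canonical_indep k (D : set (off_block k)) (C : set Bits) :
  measurable D -> measurable C ->
  canonical ((D : set (O * Bits)) `&` [set w | C (sub k w.2)]) = (canonical D * coin C)%E.
Proof.
move=> mD mC.
have msC : measurable (sub k @^-1` C).
  by rewrite -[X in measurable X]setTI; exact: measurable_sub.
have sE : coin (sub k @^-1` C) = coin C.
  have := @coin_sub R k setT C (@measurableT _ (g_sigma_algebraType _)) mC.
  rewrite setTI => ->.
  by rewrite [X in (X * _)%E](_ : _ = 1%E) ?mul1e//; exact: probability_setT.
pose rect : set (set (O * Bits)) :=
  [set A `*` B | A in measurable & B in <<s off_coords (~` block k) >>].
have recD : <<s rect >> D.
  by move: mD; rewrite measurable_prod_measurableType.
apply: (@indep_sigma _ _ _ canonical rect) recD.
- move=> _ _ [A mA [B mB <-]] [A' mA' [B' mB' <-]]; rewrite -setXI.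
  exists (A `&` A'); first exact: measurableI.
  by exists (B `&` B') => //; exact: (@measurableI _ (g_sigma_algebraType _)).
- move=> _ [A mA [B mB <-]]; apply: measurableX => //.
  exact: off_coords_measurable mB.
- rewrite (_ : [set _ | _] = setT `*` (sub k @^-1` C)); first exact: measurableX.
  by apply/seteqP; split => w //= [].
- rewrite (_ : [set _ | _] = setT `*` (sub k @^-1` C)); last first.
    by apply/seteqP; split => w //= [].
  transitivity (P setT * coin (sub k @^-1` C))%E; first exact: product_measure1E.
  by rewrite (@probability_setT _ _ _ P) mul1e.
- move=> _ [A mA [B mB <-]].
  have mB' := off_coords_measurable mB.
  rewrite (_ : _ `&` _ = A `*` (B `&` sub k @^-1` C)); last first.
    by apply/seteqP; split => w /=; tauto.
  transitivity (P A * coin (B `&` sub k @^-1` C))%E.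
    by apply: product_measure1E => //; exact: measurableI.
  rewrite coin_sub// muleA; congr (_ * _)%E.
  by apply/esym; exact: product_measure1E.
Qed.

Definition epochs (n : nat) (w : O * Bits) : R := t n w.1.
(** Even blocks feed the uniforms that decide and odd blocks the sizes, so no two of these variables
    share a coin. *)
Definition coins (n : nat) (w : O * Bits) : R := coin_val R (sub n.*2 w.2).
Definition sizes (k : nat) (w : O * Bits) : R :=
  quantile G (coin_val R (sub k.*2.+1 w.2)).

Lemma measurable_off_sub k j : k != j ->
  measurable_fun setT (fun w : off_block k => sub j w.2 : Bits).
Proof.
move=> kj; apply: measurable_seqM => i.
have mc : measurable_fun setT (fun w : g_sigma_algebraType (off_coords (~` block k)) =>
    w (pickle (j, i))).
  move=> _ A mA; rewrite setTI; apply: sub_sigma_algebra; exists (pickle (j, i)).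
    by move=> [i' _ /(pcan_inj pickleK)[kj']]; rewrite kj' eqxx in kj.
  by exists A => //; rewrite setTI.
exact: (measurableT_comp mc measurable_snd).
Qed.

Lemma measurable_off_epochs k n : measurable_fun setT (epochs n : off_block k -> R).
Proof. exact: (measurableT_comp (mt n) measurable_fst). Qed.

Lemma measurable_off_coins k n : k != n.*2 -> measurable_fun setT (coins n : off_block k -> R).
Proof.
by move=> kn; exact: (measurableT_comp (@measurable_coin_val R) (measurable_off_sub kn)).
Qed.

Lemma measurable_off_sizes k n : k != n.*2.+1 -> measurable_fun setT (sizes n : off_block k -> R).
Proof.
move=> kn; apply: (measurableT_comp (measurable_quantile G_pos)).
exact: (measurableT_comp (@measurable_coin_val R) (measurable_off_sub kn)).
Qed.

Lemma canonical_coin n (D : set (O * Bits)) C :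
  @measurable _ (off_block n.*2) D -> measurable C ->
  canonical (D `&` coins n @^-1` C) = (canonical D * unif C)%E.
Proof.
move=> mD mC.
have mC' : measurable (coin_val R @^-1` C).
  by rewrite -[X in measurable X]setTI; exact: measurable_coin_val.
have := canonical_indep mD mC'.
by rewrite coin_coin_val.
Qed.

Lemma canonical_size n (D : set (O * Bits)) C :
  @measurable _ (off_block n.*2.+1) D -> measurable C ->
  canonical (D `&` sizes n @^-1` C) = (canonical D * G C)%E.
Proof.
move=> mD mC.
have mQ : measurable (quantile G @^-1` C).
  by rewrite -[X in measurable X]setTI; exact: measurable_quantile.
have mC' : measurable (coin_val R @^-1` (quantile G @^-1` C)).
  by rewrite -[X in measurable X]setTI; exact: measurable_coin_val.
have := canonical_indep mD mC'.
by rewrite coin_coin_val// unif_quantile.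
Qed.

End canonical.

(** A variable picked at a random index is still a fresh draw if it is one on each event where the
    index is fixed: sum over the values of the index. *)
Lemma indep_index d (O : measurableType d) d' (T : measurableType d') (R : realType)
    (P : probability O R) (D : set O) (K : O -> nat) (s : nat -> O -> T) (C : set T)
    (g : \bar R) :
  measurable D -> measurable_fun setT K -> (forall k, measurable_fun setT (s k)) ->
  measurable C -> g \is a fin_num ->
  (forall k, P (D `&` K @^-1` [set k] `&` s k @^-1` C) = P (D `&` K @^-1` [set k]) * g)%E ->
  (P (D `&` (fun w => s (K w) w) @^-1` C) = P D * g)%E.
Proof.
move=> mD mK ms mC gfin Pk.
have mKk k : measurable (K @^-1` [set k]) by rewrite -[X in measurable X]setTI; exact: mK.
have msC k : measurable (s k @^-1` C) by rewrite -[X in measurable X]setTI; exact: ms.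
have e1 : D `&` (fun w => s (K w) w) @^-1` C =
    \bigcup_k (D `&` K @^-1` [set k] `&` s k @^-1` C).
  apply/seteqP; split => [w [Dw c]|w [k _ [[Dw /= kk] c]]]; first by exists (K w).
  by split => //=; rewrite kk.
have e2 : D = \bigcup_k (D `&` K @^-1` [set k]).
  by apply/seteqP; split => [w Dw|w [k _ []]//]; exists (K w).
have m2 k : measurable (D `&` K @^-1` [set k]) by exact: measurableI.
have t2 : trivIset setT (fun k => D `&` K @^-1` [set k]).
  apply/trivIsetP => i j _ _ ij; apply/seteqP; split => w //= [[_ Ki] [_ Kj]].
  by move: ij; rewrite -Ki -Kj eqxx.
transitivity (\sum_(k <oo) P (D `&` K @^-1` [set k] `&` s k @^-1` C))%E.
  rewrite e1; apply: measure_semi_bigcup.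
  - by move=> k; exact: measurableI.
  - exact: trivIset_setIr.
  - by apply: bigcupT_measurable => k; exact: measurableI.
have -> : (P D = \sum_(k <oo) P (D `&` K @^-1` [set k]))%E.
  rewrite [in LHS]e2; apply: measure_semi_bigcup => //.
  exact: bigcupT_measurable.
rewrite muleC -(fineK gfin) -nneseriesZl; last by move=> k _; exact: measure_ge0.
by apply: eq_eseriesr => k _; rewrite Pk fineK// muleC.
Qed.

Section canonical_kernel.
Context (R : realType) d (O : measurableType d) (P : probability O R).
Local Notation Bits := (seqM bool).
Variables (t : nat -> O -> R) (mt : forall n, measurable_fun setT (t n)).
Variables (G : probability R R) (G_pos : G `]0, +oo[%classic = 1%E).
Variable q : nat -> hist R -> R.
Hypothesis mq : forall n, measurable_fun setT (q n).
Hypothesis q01 : forall n z, 0 <= q n z <= 1.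
Local Notation unif := (uniform_prob (@ltr01 R)).
Local Notation ep := (epochs t).
Local Notation co := (@coins R _ O).
Local Notation si := (@sizes _ _ O G).

Definition canonical_jumps (n : nat) (w : O * Bits) : R :=
  jumps q (ep ^~ w) (co ^~ w) (si ^~ w) n.

Let Z n (w : O * Bits) : hist R := (ep ^~ w, (run q (ep ^~ w) (co ^~ w) (si ^~ w) n).1).
Let K n (w : O * Bits) : nat := (run q (ep ^~ w) (co ^~ w) (si ^~ w) n).2.

Let historyE n : history ep canonical_jumps n = Z n.
Proof. by apply/funext => w; rewrite /history /Z run_jumps. Qed.

Lemma measurable_epochs n : measurable_fun setT (ep n).
Proof. exact: (measurableT_comp (mt n) measurable_fst). Qed.

Lemma measurable_coins n : measurable_fun setT (co n).
Proof.
apply: (measurableT_comp (@measurable_coin_val R)).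
exact: (measurableT_comp (@measurable_sub _) measurable_snd).
Qed.

Lemma measurable_sizes n : measurable_fun setT (si n).
Proof.
apply: (measurableT_comp (measurable_quantile G_pos)).
apply: (measurableT_comp (@measurable_coin_val R)).
exact: (measurableT_comp (@measurable_sub _) measurable_snd).
Qed.

Let mZK n : measurable_fun setT (Z n) /\ measurable_fun setT (K n).
Proof.
apply: measurable_run => //; first exact: measurable_epochs.
  by move=> i _; exact: measurable_coins.
exact: measurable_sizes.
Qed.

Lemma measurable_canonical_jumps n : measurable_fun setT (canonical_jumps n).
Proof.
rewrite (_ : canonical_jumps n = fun w => if co n w < q n (Z n w) then si (K n w) w else 0).
  apply: measurable_fun_ifT => //.
    apply: measurable_fun_ltr; first exact: measurable_coins.
    exact: (measurableT_comp (mq n) (mZK n).1).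
  by apply: measurable_index; [exact: (mZK n).2|exact: measurable_sizes].
by apply/funext => w; rewrite /canonical_jumps jumpsE -run_jumps.
Qed.

Lemma unif_ltr (r : R) : 0 <= r <= 1 -> unif [set u | u < r] = r%:E.
Proof.
move=> /andP[r0 r1]; rewrite -unif_setI01; last first.
  by rewrite (_ : [set _ | _] = `]-oo, r[%classic)//; apply/seteqP; split => u; rewrite /= in_itv.
rewrite (_ : _ `&` _ = `[0, r[%classic); first by rewrite unif_itv// subr0.
apply/seteqP; split => u /=; rewrite !in_itv/=; first by move=> [-> /andP[->]].
by move=> /andP[u0 ur]; rewrite ur u0 (lt_le_trans ur r1).
Qed.

Let mid : measurable_fun setT (id : measurableTypeR R -> R).
Proof. by move=> _ A mA; rewrite setTI. Qed.

(** The uniform law, carried by the identity to the measurable structure in which [coins] takes its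
    values. *)
Let unif' : probability R R := law unif mid.

Let join n : set (O * Bits) := [set w | co n w < q n (Z n w)].

Let mjoin n : measurable (join n).
Proof.
apply: measurable_pred; apply: measurable_fun_ltr; first exact: measurable_coins.
exact: (measurableT_comp (mq n) (mZK n).1).
Qed.

Let join_prob n (A : set (hist R)) : measurable A ->
  canonical P (Z n @^-1` A `&` join n) =
  (\int[pushforward (canonical P) (Z n)]_(z in A) (q n z)%:E)%E.
Proof.
move=> mA.
pose M : set (hist R * R) := [set zu | A zu.1 /\ zu.2 < q n zu.1].
have mM : measurable M.
  apply: measurableI.
    by rewrite -[X in measurable X]setTI; exact: measurable_fst.
  apply: measurable_pred; apply: measurable_fun_ltr; first exact: measurable_snd.
  exact: (measurableT_comp (mq n) measurable_fst).
(* The history before arrival [n] uses earlier uniforms and the odd blocks, hence no coin of block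
   [n.*2]. *)
have ind B C : measurable B -> measurable C ->
    (canonical P (Z n @^-1` B `&` co n @^-1` C) = canonical P (Z n @^-1` B) * unif' C)%E.
  move=> mB mC; apply: canonical_coin => //.
  have [mZ _] : measurable_fun setT (Z n : off_block O n.*2 -> hist R) /\
      measurable_fun setT (K n : off_block O n.*2 -> nat).
    apply: measurable_run => //.
    - by move=> i; exact: measurable_off_epochs.
    - move=> i ni; apply: measurable_off_coins.
      by rewrite -!mul2n eqn_pmul2l// gtn_eqF.
    - move=> i; apply: measurable_off_sizes => //.
      by apply/eqP => /(congr1 odd); rewrite /= !odd_double.
  by rewrite -[X in measurable X]setTI; exact: mZ.
have := @indep_freeze _ _ _ _ _ _ R (canonical P) (Z n) (co n) (mZK n).1 (measurable_coins n)
  unif' ind M mM.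
move=> e; transitivity (\int[law (canonical P) (mZK n).1]_(z in A) (q n z)%:E)%E; last by [].
transitivity (\int[law (canonical P) (mZK n).1]_z unif' (xsection M z))%E.
  exact: e.
rewrite [RHS]integral_mkcond; apply: eq_integral => z _.
rewrite patchE; case: ifPn => zA.
  rewrite -(unif_ltr (q01 n z)); apply: (congr1 unif).
  by apply/seteqP; split => u; rewrite /xsection /M /= inE/=; [case|split; [exact: set_mem|]].
rewrite (_ : xsection _ _ = set0) ?measure0//.
apply/seteqP; split => u //; rewrite /xsection /M /= inE/= => -[Az _].
by move: zA; rewrite notin_setE.
Qed.

(** Replacing the sizes from the [k]-th on by 0 removes any dependence on the block of size [k]; by
    [run_ext] the run is unchanged where its count is [k]. *)
Let K_off n k : measurable_fun setT (fun w : off_block O k.*2.+1 =>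
    (ep ^~ w, (run q (ep ^~ w) (co ^~ w) (fun j => if (j < k)%N then si j w else 0) n).1) : hist R) /\
  measurable_fun setT (fun w : off_block O k.*2.+1 =>
    (run q (ep ^~ w) (co ^~ w) (fun j => if (j < k)%N then si j w else 0) n).2).
Proof.
apply: (@measurable_run R _ (off_block O k.*2.+1) q ep co
  (fun j w => if (j < k)%N then si j w else 0) n) => //.
- by move=> i; exact: measurable_off_epochs.
- move=> i _; apply: measurable_off_coins.
  by apply/eqP => /(congr1 odd); rewrite /= !odd_double.
- move=> j; case: ltnP => // jk; apply: measurable_off_sizes => //.
  by rewrite eqSS -!mul2n eqn_pmul2l// gtn_eqF.
Qed.

Let size_prob_index n k A C : measurable A -> measurable C ->
  (canonical P (Z n @^-1` A `&` join n `&` K n @^-1` [set k] `&` si k @^-1` C) =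
   canonical P (Z n @^-1` A `&` join n `&` K n @^-1` [set k]) * G C)%E.
Proof.
move=> mA mC; apply: canonical_size => //.
pose s' (w : O * Bits) j := if (j < k)%N then si j w else 0.
pose r w := run q (ep ^~ w) (co ^~ w) (s' w) n.
have runE w : (r w).2 = k \/ K n w = k -> r w = run q (ep ^~ w) (co ^~ w) (si ^~ w) n.
  case=> h; first by apply: (@run_ext _ _ _ _ _ _ k); rewrite -?/(r w) ?h// => j; rewrite /s' => ->.
  by apply/esym/(@run_ext _ _ _ _ _ _ k); rewrite -?/(K n w) ?h// => j; rewrite /s' => ->.
have [mZ' mK'] := K_off n k.
pose Z' (w : off_block O k.*2.+1) : hist R := (ep ^~ w, (r w).1).
rewrite (_ : _ `&` _ = Z' @^-1` A `&` [set w | co n w < q n (Z' w)] `&` [set w | (r w).2 = k]).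
  apply: measurableI; last first.
    by rewrite -[X in measurable X]setTI; exact: (mK' measurableT [set k]).
  apply: measurableI; first by rewrite -[X in measurable X]setTI; exact: mZ'.
  apply: measurable_pred; apply: measurable_fun_ltr.
    by apply: measurable_off_coins; apply/eqP => /(congr1 odd); rewrite /= !odd_double.
  exact: (measurableT_comp (mq n) mZ').
apply/seteqP; split => w /=.
  move=> [[Az j] k_]; have e := runE w (or_intror k_).
  by rewrite /Z' e; split.
move=> [[Az j] k_]; have e := runE w (or_introl k_).
by move: Az j k_; rewrite /Z' e.
Qed.

Let size_prob n A C : measurable A -> measurable C ->
  (canonical P (Z n @^-1` A `&` join n `&` (fun w => si (K n w) w) @^-1` C) =
   canonical P (Z n @^-1` A `&` join n) * G C)%E.
Proof.
move=> mA mC.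
apply: (@indep_index _ _ _ _ _ (canonical P) _ (K n) si).
- apply: measurableI; last exact: mjoin.
  by rewrite -[X in measurable X]setTI; exact: (mZK n).1.
- exact: (mZK n).2.
- exact: measurable_sizes.
- exact: mC.
- by rewrite fin_num_measure.
- by move=> k; exact: size_prob_index.
Qed.

Lemma canonical_kernel : has_kernel (canonical P) ep canonical_jumps q G.
Proof.
move=> n; exists (join n), (fun w => si (K n w) w); rewrite historyE; split.
- exact: mjoin.
- by apply: measurable_index; [exact: (mZK n).2|exact: measurable_sizes].
- move=> w; rewrite /canonical_jumps jumpsE -run_jumps; split; rewrite /join /=.
    by rewrite /Z => ->.
  by rewrite /Z => /negP/negbTE ->.
- exact: size_prob.
- exact: join_prob.
Qed.

End canonical_kernel.

(** * Sample paths of the workload *)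

Section pathwise.
Context (R : realType) (x : R) (t s : nat -> R) (r : nat -> bool) (W : skorokhod R).
Hypotheses (x0 : 0 < x) (t0 : 0 < t 0%N) (tS : forall n, t n < t n.+1).
Hypothesis s0 : forall n, 0 < s n.
Hypothesis wW : is_workload x t s r W.

Definition raw_jump (n : nat) : R := (r n)%:R * s n.
Local Notation b := raw_jump.
Local Notation zb := ((t, b) : hist R).
Local Notation alive_at := alive.
Local Notation alive n := (alive x n (t, b)).
(* Work brought after the workload has run out is discarded: the stopped path does not
   see it, and the kernel of the remaining jumps does not involve the later busy periods. *)
Definition live_jump (n : nat) : R := if alive n then b n else 0.
Local Notation z := ((t, live_jump) : hist R).
Local Notation csum n := (x + \sum_(i < n) b i).

Lemma raw_jump_ge0 n : 0 <= b n.
Proof. by rewrite mulr_ge0// ltW. Qed.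

Lemma live_jump_ge0 n : 0 <= live_jump n.
Proof. by rewrite /live_jump; case: ifP => // _; exact: raw_jump_ge0. Qed.

Lemma net_inputE u : net_input x t s r u = (x%:E + tail_work zb 0 u - u%:E)%E.
Proof.
rewrite /net_input /tail_work eseries_mkcond; congr (_ + _ - _)%E.
apply: eq_eseriesr => i _; rewrite /jump /=; case: ifP => // _.
by rewrite ger0_norm// raw_jump_ge0.
Qed.

(** The infimum in the workload equation lies between [- u] and 0, so infinite work by time [u]
    would make the real number [W u] infinite. *)
Lemma tail_work_raw u : 0 < u -> (tail_work zb 0 u < +oo)%E.
Proof.
move=> u0; have [_ /(_ u u0)] := wW; rewrite ltey net_inputE => Wu.
apply/eqP => tw; move: Wu; rewrite tw.
have lb : ((- u)%:E <= ereal_inf [set Order.min (net_input x t s r v) 0%E | v in `[0%R, u[])%E.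
  apply: le_ereal_inf_tmp => _ [v /= + <-]; rewrite in_itv/= => /andP[v0 vu].
  rewrite le_min net_inputE; apply/andP; split; last by rewrite lee_fin oppr_le0 ltW.
  rewrite -addeA; apply: (@le_trans _ _ (0 + (- u)%:E)%E); first by rewrite add0e.
  apply: leeD; first by rewrite lee_fin ltW.
  apply: (@le_trans _ _ (0 + (- v)%:E)%E); first by rewrite add0e lee_fin lerN2 ltW.
  by rewrite leeD2r// tail_work_ge0.
have ub : (ereal_inf [set Order.min (net_input x t s r v) 0%E | v in `[0%R, u[] <= 0)%E.
  apply: (@le_trans _ _ (Order.min (net_input x t s r 0%R) 0%E)); last by rewrite ge_min lexx orbT.
  by apply: ereal_inf_lbound; exists 0 => //=; rewrite in_itv/= lexx.
by case: ereal_inf lb ub.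
Qed.

Lemma admissible_raw : admissible zb.
Proof.
split => //=; first exact: raw_jump_ge0.
move=> M; apply: (@le_lt_trans _ _ (tail_work zb 0 M.+1%:R)).
  by apply: le_tail_work; rewrite ler_nat.
by apply: tail_work_raw; rewrite ltr0n.
Qed.

Lemma admissible_live : admissible z.
Proof.
split => //=; first exact: live_jump_ge0.
move=> M; have [_ _ _ /(_ M)] := admissible_raw; apply: le_lt_trans.
apply: lee_nneseries => i _; first by rewrite lee_fin jump_ge0.
rewrite lee_fin /jump /= /live_jump; case: ifP => // _; case: ifP => // _.
by rewrite normr0.
Qed.

Local Notation L v := (x + work zb v - v).

Lemma net_input_fin u : net_input x t s r u = (L u)%:E.
Proof.
by rewrite net_inputE /work; have /fineK {1}<- := tail_work_fin admissible_raw 0 u.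
Qed.

Lemma workloadE u : 0 < u ->
  (W u)%:E = ((L u)%:E - ereal_inf [set (Num.min (L v) 0)%:E | v in `[0%R, u[])%E.
Proof.
move=> u0; have [_ /(_ u u0) ->] := wW; rewrite net_input_fin; congr (_ - ereal_inf _)%E.
by apply/seteqP; split => _ [v v01 <-]; exists v => //; rewrite net_input_fin EFin_min.
Qed.

Lemma work_between (b' : nat -> R) n v : admissible (t, b') -> (forall i, (i < n)%N -> t i <= v) -> v < t n ->
  work (t, b') v = \sum_(i < n) b' i.
Proof.
move=> ab tv vt; have [_ _ b0 _] := ab.
rewrite (work_split ab n) [X in _ + X](_ : _ = 0) ?addr0.
  by apply: eq_bigr => i _; rewrite /jump tv// ger0_norm// b0.
rewrite /tail_work eseries0// => i ni _; rewrite /jump /= leNgt.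
suff -> : v < t i by [].
apply: lt_le_trans vt _; move: ni; rewrite leq_eqVlt => /predU1P[->//|ni].
exact/ltW/(adm_mono ab).
Qed.

Lemma locate n v : v < t n -> exists m, [/\ (m <= n)%N, forall i, (i < m)%N -> t i <= v & v < t m].
Proof.
move=> vn; have ex : exists m, v < t m by exists n.
case: (ex_minnP ex) => m vm mmin; exists m; split => //; first exact: mmin.
by move=> i im; rewrite leNgt; apply/negP => /mmin; rewrite leqNgt im.
Qed.

Lemma work0 : work zb 0 = 0.
Proof. by rewrite (work_between (n := 0)) ?big_ord0//; exact: admissible_raw. Qed.

Lemma aliveS m n : (m <= n)%N -> alive n -> alive m.
Proof. by move=> mn /aliveP al; apply/aliveP => j jm; apply: al; exact: leq_trans mn. Qed.

(** Between arrivals [L] falls at unit rate, so its nonnegativity just before each arrival, which is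
    what [alive] says, makes it positive in between. *)
Lemma alive_pos n v : alive n -> 0 <= v -> v < t n -> 0 < L v.
Proof.
move=> al v0 vn; have [m [mn tv vm]] := locate vn.
rewrite (work_between admissible_raw tv vm) subr_gt0; apply: lt_le_trans vm _.
by have /aliveP/(_ m mn) := al.
Qed.

Lemma workload_free u : 0 <= u -> (forall v, 0 <= v -> v < u -> 0 <= L v) -> W u = L u.
Proof.
rewrite le_eqVlt => /predU1P[<- _|u0 Lv].
  by have [-> _] := wW; rewrite work0; lra.
apply/EFin_inj; rewrite workloadE// (_ : [set _ | _ in _] = [set 0%:E]) ?ereal_inf1 ?sube0//.
apply/seteqP; split => [_ [v /= + <-]|_ ->].
  by rewrite in_itv/= => /andP[? ?]; rewrite (min_idPr _)// Lv.
by exists 0; rewrite /= ?in_itv/= ?lexx// (min_idPr _)// Lv.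
Qed.

(** Covers the stretch after the work has run out but before the next arrival, where the infimum
    compensates the net input and the workload is 0. *)
Lemma workload_reflect m u : (forall i, (i < m)%N -> alive i) -> 0 <= u ->
  (forall i, (i < m)%N -> t i <= u) -> u < t m -> W u = Num.max (csum m - u) 0.
Proof.
move=> al u0 tu um.
have Lu : L u = csum m - u by rewrite (work_between admissible_raw tu um).
have t_csum i : (i < m)%N -> t i <= csum m.
  move=> im; have /aliveP/(_ i (leqnn i)) := al i im.
  move=> /le_trans; apply; rewrite lerD2l.
  rewrite -(subnKC (ltnW im)) big_split_ord/= lerDl sumr_ge0// => k _.
  exact: raw_jump_ge0.
have Lv v : 0 <= v -> v < u -> 0 <= L v \/ L v = csum m - v.
  move=> v0 vu; have [[i [im vi]]|h] := pselect (exists i, (i < m)%N /\ v < t i).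
    by left; apply/ltW/(alive_pos (al i im)).
  right; rewrite (work_between admissible_raw (n := m))//; last exact: lt_trans um.
  by move=> i im; rewrite leNgt; apply/negP => vi; apply: h; exists i.
have [cu|uc] := leP u (csum m).
  rewrite (max_idPl _) ?subr_ge0// -Lu; apply: workload_free => // v v0 vu.
  have [//|->] := Lv v v0 vu; rewrite subr_ge0; apply: le_trans cu; exact: ltW.
rewrite (max_idPr _) ?subr_le0 1?ltW//.
have c0 : 0 <= csum m.
  by rewrite addr_ge0 ?(ltW x0)// sumr_ge0// => i _; exact: raw_jump_ge0.
have u0' : 0 < u by exact: le_lt_trans uc.
have := workloadE u0'; rewrite Lu.
set S := [set _ | _ in _].
have lb : ((csum m - u)%:E <= ereal_inf S)%E.
  apply: le_ereal_inf_tmp => _ [v /= + <-]; rewrite in_itv/= => /andP[v0 vu].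
  rewrite lee_fin le_min subr_le0 (ltW uc) andbT.
  have [h|->] := Lv v v0 vu; first by apply: le_trans h; rewrite subr_le0 ltW.
  by rewrite lerD2l lerN2 ltW.
have ub v : csum m <= v -> v < u -> (ereal_inf S <= (csum m - v)%:E)%E.
  move=> cv vu; have v0 : 0 <= v by exact: le_trans cv.
  apply: (@le_trans _ _ (Num.min (L v) 0)%:E).
    by apply: ereal_inf_lbound; exists v => //=; rewrite in_itv/= v0.
  rewrite lee_fin ge_min (work_between admissible_raw (n := m)) ?lexx//; last exact: lt_trans um.
  by move=> i im; exact: le_trans (t_csum i im) cv.
case: (ereal_inf S) lb ub => [y| |] lb ub; last 2 first.
- by have := ub _ (lexx _) uc; rewrite leye_eq.
- by move: lb; rewrite leeNy_eq.
rewrite lee_fin in lb; move=> [->].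
apply/eqP; rewrite eq_le; apply/andP; split; first by rewrite subr_le0.
rewrite leNgt; apply/negP => neg.
(* The infimum is over times before [u] and is approached only as they tend to [u]: an infimum too
   large by [e] is refuted at a time within [e / 2] of [u] at which the work has already run out. *)
pose e := y - (csum m - u).
have e0 : 0 < e by rewrite /e; lra.
pose v := Num.max (csum m) (u - e / 2).
have cv : csum m <= v by rewrite /v le_max lexx.
have vu : v < u by rewrite /v gt_max uc/=; lra.
have := ub v cv vu; rewrite lee_fin.
have : u - e / 2 <= v by rewrite /v le_max lexx orbT.
rewrite /e; lra.
Qed.

Lemma first_dead n : ~~ alive n -> exists m, [/\ (m <= n)%N, forall i, (i < m)%N -> alive i,
  forall i, (i < m)%N -> t i <= csum m & csum m < t m].
Proof.
move=> dead; have ex : exists m, ~~ alive m by exists n.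
case: (ex_minnP ex) => m dm mmin.
have al i : (i < m)%N -> alive i.
  by move=> im; apply: contraT => /mmin; rewrite leqNgt im.
exists m; split => //; first exact: mmin.
  move=> i im; have /aliveP/(_ i (leqnn i)) := al i im.
  move=> /le_trans; apply; rewrite lerD2l.
  rewrite -(subnKC (ltnW im)) big_split_ord/= lerDl sumr_ge0// => k _.
  exact: raw_jump_ge0.
rewrite ltNge; apply: contra dm => tm; apply/aliveP => j.
rewrite leq_eqVlt => /predU1P[->//|jm].
by have /aliveP/(_ j (leqnn j)) := al j jm.
Qed.

(** Turns [alive] into countably many conditions on the path before [t n]. If the work runs out
    before that epoch, the workload vanishes until the next arrival, on an interval that contains a
    rational. *)
Lemma alive_rat n : alive n <-> (forall q : rat, 0 <= ratr q :> R -> ratr q < t n -> 0 < W (ratr q)).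
Proof.
split => [al q q0 qn|h].
  rewrite workload_free//; first exact: alive_pos qn.
  by move=> v v0 vq; apply/ltW/(alive_pos al) => //; exact: lt_trans qn.
apply: contraT => /first_dead[m [mn al tc ct]].
have c0 : 0 < csum m.
  by rewrite ltr_wpDr// sumr_ge0// => i _; exact: raw_jump_ge0.
have [q] := rat_in_itvoo ct; rewrite in_itv/= => /andP[cq qm].
have q0 : 0 <= ratr q :> R by rewrite ltW// (lt_trans c0).
have tmn : t m <= t n.
  move: mn; rewrite leq_eqVlt => /predU1P[->//|mn].
  exact/ltW/(adm_mono admissible_raw).
have := h q q0 (lt_le_trans qm tmn); rewrite (@workload_reflect m)//; last first.
  by move=> i im; apply: le_trans (tc i im) (ltW _).
have -> : Num.max (csum m - ratr q) 0 = 0 by apply/max_idPr; rewrite subr_le0 ltW.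
by rewrite ltxx.
Qed.

Lemma alive_workload n j v : alive n -> (j < n)%N -> t j <= v -> v < t j.+1 ->
  W v = csum j.+1 - v.
Proof.
move=> al jn jv vj.
have v0 : 0 <= v by apply: le_trans jv; apply: ltW; exact: (adm_gt0 admissible_raw).
have vn : v < t n.
  apply: (lt_le_trans vj); move: jn; rewrite leq_eqVlt => /predU1P[->//|mn].
  exact/ltW/(adm_mono admissible_raw).
rewrite workload_free//; last first.
  by move=> v' v'0 v'v; apply/ltW/(alive_pos al) => //; exact: lt_trans vn.
rewrite (work_between admissible_raw (n := j.+1))// => i ij.
apply: le_trans jv; move: ij; rewrite ltnS leq_eqVlt => /predU1P[->//|mn].
exact/ltW/(adm_mono admissible_raw).
Qed.

Lemma alive_left_lim n : alive n -> left_lim W (t n) = csum n - t n.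
Proof.
move=> al; apply/cvg_lim => //.
have h : csum n - v @[v --> (t n)^'-] --> csum n - t n.
  by apply: cvgB; [exact: cvg_cst|exact: cvg_at_left_filter].
apply: cvg_trans h; apply: near_eq_cvg.
(* From the preceding arrival on, or from time 0, no further work arrives before [t n]. *)
have lo : exists2 l, l < t n & 0 <= l /\ forall i, (i < n)%N -> t i <= l.
  case: n {al} => [|n]; first by exists 0.
  exists (t n) => //; split; first by apply: ltW; exact: (adm_gt0 admissible_raw).
  move=> i; rewrite ltnS leq_eqVlt => /predU1P[->//|mn].
  exact/ltW/(adm_mono admissible_raw).
have [l ln [l0 tl]] := lo.
near=> v.
have lv : l <= v by near: v; exact: nbhs_left_ge.
have vn : v < t n by near: v; exact: nbhs_left_lt.
have v0 : 0 <= v by exact: le_trans lv.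
rewrite workload_free//; last first.
  by move=> v' v'0 v'v; apply/ltW/(alive_pos al) => //; exact: lt_trans vn.
rewrite (work_between admissible_raw (n := n))// => i ij.
exact: le_trans (tl i ij) lv.
Unshelve. all: by end_near. Qed.

Lemma live_before m v : (forall i, (i < m)%N -> alive i) ->
  (forall i, (i < m)%N -> t i <= v) -> v < t m -> work z v = work zb v.
Proof.
move=> al tv vm.
rewrite (work_between admissible_raw tv vm) (work_between admissible_live tv vm).
by apply: eq_bigr => i _; rewrite /live_jump al.
Qed.

Lemma live_jumpE n i : alive n -> (i <= n)%N -> live_jump i = b i.
Proof. by move=> al ni; rewrite /live_jump (aliveS ni al). Qed.

Lemma alive_live n : alive_at x n (t, live_jump) = alive n.
Proof.
apply/idP/idP => [al|al].
  apply: contraT => /first_dead[m [mn alm _]]; rewrite ltNge => /negP[].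
  have /aliveP/(_ m mn) := al; rewrite /= (eq_bigr (fun i : 'I_m => b i))// => i _.
  by rewrite (live_jumpE (alm i (ltn_ord i))).
apply/aliveP => j jn; rewrite /= (eq_bigr (fun i : 'I_j => b i)).
  by have /aliveP/(_ j jn) := al.
by move=> i _; rewrite (live_jumpE al)// ltnW// (leq_trans (ltn_ord i)).
Qed.

(** Writes the path before the [n]-th arrival as a function of the epochs and earlier jumps, so that
    the information of the dispatcher can be read off the history. *)
Lemma alive_workload_sum n v : alive n -> 0 <= v -> v < t n ->
  W v = x + \sum_(i < n) jump z v i - v.
Proof.
move=> al v0 vn; rewrite workload_free//; last first.
  by move=> v' v'0 v'v; apply/ltW/(alive_pos al) => //; exact: lt_trans vn.
congr (_ + _ - _); rewrite (work_split admissible_raw n) [X in _ + X](_ : _ = 0) ?addr0.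
  by apply: eq_bigr => i _; rewrite /jump /= (live_jumpE al)// ltnW.
rewrite /tail_work eseries0// => i ni _; rewrite /jump /= leNgt.
suff -> : v < t i by [].
apply: lt_le_trans vn _; move: ni; rewrite leq_eqVlt => /predU1P[->//|ni].
exact/ltW/(adm_mono admissible_raw).
Qed.

(** The work can run out in two ways: before some arrival, or, if the epochs are bounded, with every
    arrival still [alive]. In both cases the live jumps bring nothing after the time [c] of
    extinction. *)
Lemma free_until_death :
  (forall v, 0 <= v -> 0 < L v /\ work z v = work zb v) \/
  exists c, [/\ 0 < c, forall v, 0 <= v -> v < c -> 0 < L v /\ work z v = work zb v,
    W c = 0 & forall u, c <= u -> x + work z u - u <= 0].
Proof.
have [al|/existsNP[n /negP dead]] := pselect (forall n, alive n).
  have zE : live_jump = b by apply/funext => n; rewrite /live_jump al.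
  have [pos|/existsNP[v0 /not_implyP[v00 /negP]]] := pselect (forall v, 0 <= v -> 0 < L v).
    by left => v v0; split; [exact: pos|rewrite zE].
  rewrite -leNgt => Lv0; right.
  (* Since [L] is positive before each epoch, all epochs lie before [v0]; the total work [S] is then
     complete and runs out at [x + S]. *)
  have tv0 n : t n <= v0.
    by rewrite leNgt; apply: contraTN Lv0 => vn; rewrite -ltNge; exact: alive_pos vn.
  have workE v : (forall n, t n <= v) -> work zb v = work zb v0.
    move=> tv; rewrite /work /tail_work; congr fine; apply: eq_eseriesr => i _.
    by rewrite /jump /= tv tv0.
  set S := work zb v0.
  have S0 : 0 <= S by exact: work_ge0.
  have tc n : t n <= x + S.
    have /aliveP/(_ n (leqnn n)) := al n; move=> /le_trans; apply.
    rewrite lerD2l /S (work_split admissible_raw n) ler_wpDr ?fine_ge0 ?tail_work_ge0//.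
    by apply: ler_sum => i _; rewrite /jump /= tv0 ger0_norm// raw_jump_ge0.
  have Lpos v : 0 <= v -> v < x + S -> 0 < L v.
    move=> v'0 vc; have [[n vn]|h] := pselect (exists n, v < t n); first exact: alive_pos vn.
    by rewrite workE ?subr_gt0// => n; rewrite leNgt; apply/negP => vn; apply: h; exists n.
  exists (x + S); split => //.
  - by rewrite ltr_wpDr.
  - by move=> v v'0 vc; split; [exact: Lpos|rewrite zE].
  - rewrite workload_free; last 2 first.
    + by rewrite addr_ge0// ltW.
    + by move=> v v'0 vc; apply/ltW/Lpos.
    by rewrite workE// subrr.
  - move=> u cu; rewrite zE workE ?subr_le0// => n; exact: le_trans (tc n) cu.
right; have [m [_ al tc ct]] := first_dead dead.
have c0 : 0 < csum m.
  by rewrite ltr_wpDr// sumr_ge0// => i _; exact: raw_jump_ge0.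
exists (csum m); split => //.
- move=> v v0 vc; have [i [im tv vi]] := locate (lt_trans vc ct).
  split; last by apply: live_before tv vi => k ki; apply: al; exact: leq_trans im.
  rewrite (work_between admissible_raw tv vi) subr_gt0.
  move: im; rewrite leq_eqVlt => /predU1P[->//|im].
  by apply: lt_le_trans vi _; have /aliveP/(_ i (leqnn i)) := al i im.
- by rewrite (workload_reflect al (ltW c0) tc ct) subrr (max_idPl _).
- move=> u cu; rewrite subr_le0; apply: le_trans cu; rewrite lerD2l.
  have dead_i i : (m <= i)%N -> ~~ alive i.
    move=> mi; apply: contraTN ct => /(aliveS mi)/aliveP/(_ m (leqnn m)).
    by rewrite -leNgt.
  rewrite (work_split admissible_live m) [X in _ + X](_ : _ = 0) ?addr0.
    apply: ler_sum => i _; rewrite /jump /= /live_jump al//.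
    by case: ifP => _; rewrite ?ger0_norm ?raw_jump_ge0.
  rewrite /tail_work eseries0// => i mi _.
  by rewrite /jump /= /live_jump (negbTE (dead_i i mi)) normr0 if_same.
Qed.

Lemma stop_path_map u : 0 <= u -> stop W (hitting0 W) u = path_map x z u.
Proof.
move=> u0; rewrite (path_mapE x admissible_live u0) /stop /= /stop_fun ltNge u0 /=.
have Wpos c : (forall v, 0 <= v -> v < c -> 0 < L v) ->
    forall v, 0 <= v -> v < c -> W v = L v.
  by move=> h v v0 vc; apply: workload_free => // v' v'0 v'v; apply/ltW/h => //; exact: lt_trans vc.
case: free_until_death => [pos|[c [c0 pos Wc late]]].
  have WL v : 0 <= v -> W v = L v.
    by move=> v0; apply: workload_free => // v' v'0 _; case: (pos v' v'0) => /ltW.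
  rewrite (_ : hitting0 W = +oo%E); last first.
    rewrite /hitting0 (_ : [set _ | _] = set0) ?image_set0 ?ereal_inf0//.
    apply/seteqP; split => v //= [v0]; rewrite WL// => Lv.
    by have [] := pos v v0; rewrite Lv ltxx.
  rewrite (min_idPl (leey _))/= WL//; have [Lu ->] := pos u u0.
  by rewrite (max_idPl _)// ltW.
have WL := Wpos c (fun v v0 vc => (pos v v0 vc).1).
rewrite (_ : hitting0 W = c%:E); last first.
  apply/eqP; rewrite eq_le; apply/andP; split.
    by apply: ereal_inf_lbound; exists c => //; split => //; exact: ltW.
  apply: le_ereal_inf_tmp => _ [v [v0 Wv] <-]; rewrite lee_fin leNgt; apply/negP => vc.
  by have [] := pos v v0 vc; rewrite -WL// Wv ltxx.
have [cu|uc] := leP c u.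
  rewrite (min_idPr _) ?lee_fin//= Wc.
  by apply/esym/max_idPr; exact: late.
rewrite (min_idPl _) ?lee_fin ?(ltW uc)//= WL//.
by have [Lu ->] := pos u u0 uc; rewrite (max_idPl _)// ltW.
Qed.

End pathwise.

(** * The kernels of the two systems *)

Section trace_types.
Context d (O : measurableType d).
Implicit Types (G : set (set O)) (M : set O).

Definition traceT G M := g_sigma_algebraType (trace_sigma G M).

Lemma trace_measurable G M A : @measurable _ (traceT G M) A -> trace_sigma G M A.
Proof. by rewrite /measurable/= sigma_algebra_id//; exact: trace_sigma_algebra. Qed.

Lemma measurable_trace G M A : trace_sigma G M A -> @measurable _ (traceT G M) A.
Proof. exact: sub_sigma_algebra. Qed.

Lemma trace_sigma_eq G M A A' : measurable A' -> A `&` M = A' `&` M ->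
  trace_sigma G M A -> trace_sigma G M A'.
Proof. by move=> mA' AA' [mA [B GB AB]]; split => //; exists B; rewrite -?AA'. Qed.

Lemma trace_fun d' (F : measurableType d') G M (f : O -> F) :
  (forall C, measurable C -> trace_sigma G M (f @^-1` C)) ->
  measurable_fun setT (f : traceT G M -> F).
Proof. by move=> h _ C mC; rewrite setTI; apply: measurable_trace; exact: h. Qed.

Lemma trace_fun_inv d' (F : measurableType d') G M (f : O -> F) C :
  measurable_fun setT (f : traceT G M -> F) -> measurable C -> trace_sigma G M (f @^-1` C).
Proof. by move=> mf mC; apply: trace_measurable; rewrite -[X in measurable X]setTI; exact: mf. Qed.

Lemma trace_pred G M (f : O -> bool) :
  measurable_fun setT (f : traceT G M -> bool) -> trace_sigma G M [set w | f w].
Proof. by move=> mf; apply: trace_measurable; exact: measurable_pred. Qed.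

Lemma trace_bool G M (f : O -> bool) : trace_sigma G M [set w | f w] ->
  measurable_fun setT (f : traceT G M -> bool).
Proof. by move=> h; apply: (measurable_fun_bool true); rewrite setTI; exact: measurable_trace. Qed.

Lemma trace_gen_fun d' (F : measurableType d') (Ix : Type) (Dx : set Ix) (X : Ix -> O -> F) G M i :
  Dx i -> gen Dx X `<=` G -> <<s G >> `<=` measurable ->
  measurable_fun setT (X i : traceT G M -> F).
Proof.
move=> Di XG Gm; apply: trace_fun => C mC; apply: sub_trace_sigma => //.
by apply: sub_sigma_algebra; apply: XG; exists i => //; exists C => //; rewrite setTI.
Qed.

(** An event of the trace on a set of full probability differs from an event of [<<s G >>] only by a
    null set. *)
Lemma trace_indep (R : realType) (P : probability O R) G M E (g : \bar R) D :
  <<s G >> `<=` measurable -> measurable M -> P M = 1%E -> measurable E ->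
  (forall D, <<s G >> D -> P (D `&` E) = P D * g)%E ->
  trace_sigma G M D -> (P (D `&` E) = P D * g)%E.
Proof.
move=> Gm mM PM mE h [mD [B GB DB]]; have mB := Gm _ GB.
rewrite -(probability_setI1 _ mM PM); last exact: measurableI.
rewrite -(probability_setI1 mD mM PM) DB (probability_setI1 mB mM PM) -h//.
rewrite setIAC DB setIAC (probability_setI1 _ mM PM)//; exact: measurableI.
Qed.

Lemma gen_measurable d' (F : measurableType d') (Ix : Type) (Dx : set Ix) (X : Ix -> O -> F) :
  (forall i, Dx i -> measurable_fun setT (X i)) -> gen Dx X `<=` measurable.
Proof. by move=> mX _ [i Di [C mC <-]]; exact: mX. Qed.

End trace_types.

Lemma measurable_alive (R : realType) (x : R) n :
  measurable_fun setT (fun z : hist R => alive x n z).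
Proof.
rewrite /alive; elim: (iota 0 n.+1) => [|j s ih] /=; first exact: measurable_cst.
apply: measurable_and => //; apply: measurable_fun_ler; first exact: measurable_fst_coord.
apply: measurable_funD; first exact: measurable_cst.
by apply: measurable_sum => i; exact: measurable_snd_coord.
Qed.

Section join_probability.
Context (R : realType) (E : ptopologicalType) (H : probability (borel E) R).
Variables (Phi : borel E * R -> bool).
Hypothesis Phi_meas : measurable_fun [set p : borel E * R | (0 : R) <= p.2] Phi.

(** [Phi] is measurable only at nonnegative workloads, whence the maximum; it changes nothing where
    [alive] holds. *)
Definition join_prob_at (c : R) : R := fine (H [set y | Phi (y, Num.max c 0)]).

Lemma measurable_Phi_max :
  measurable_fun setT (fun p : borel E * R => Phi (p.1, Num.max p.2 0)).
Proof.
pose D := [set p : borel E * R | (0 : R) <= p.2].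
have mD : measurable D.
  by apply: measurable_pred; apply: measurable_fun_ler => //; exact: measurable_snd.
have mf : measurable_fun setT (fun p : borel E * R => (p.1, Num.max p.2 0) : borel E * R).
  apply: measurable_fun_pair; first exact: measurable_fst.
  by apply: measurable_maxr; [exact: measurable_snd|exact: measurable_cst].
move=> _ B mB; rewrite setTI.
rewrite (_ : _ @^-1` _ = (fun p : borel E * R => (p.1, Num.max p.2 0) : borel E * R) @^-1` (D `&` Phi @^-1` B)).
  by rewrite -[X in measurable X]setTI; apply: mf => //; exact: Phi_meas.
by apply/seteqP; split => p /=; [split; [rewrite /D/= le_max lexx orbT|]|case].
Qed.

Let graph := [set p : borel E * R | Phi (p.1, Num.max p.2 0)].

Let join_secE c : [set y | Phi (y, Num.max c 0)] = ysection graph c.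
Proof. by apply/seteqP; split => y; rewrite /ysection /graph /= inE. Qed.

Lemma measurable_join_sec c : measurable [set y : borel E | Phi (y, Num.max c 0)].
Proof. by rewrite join_secE; apply: measurable_ysection; exact: measurable_pred measurable_Phi_max. Qed.

Lemma join_prob_atE c : (join_prob_at c)%:E = H [set y | Phi (y, Num.max c 0)].
Proof. by rewrite fineK// fin_num_measure//; exact: measurable_join_sec. Qed.

Lemma join_prob_at01 c : 0 <= join_prob_at c <= 1.
Proof.
by rewrite fine_ge0//= -lee_fin join_prob_atE probability_le1//; exact: measurable_join_sec.
Qed.

Lemma measurable_join_prob_at : measurable_fun setT join_prob_at.
Proof.
apply: (measurableT_comp (fine_measurable measurableT)).
rewrite (_ : (fun _ => _) = (fun c => H (ysection graph c))); last first.
  by apply/funext => c; rewrite join_secE.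
by apply: measurable_fun_ysection; exact: measurable_pred measurable_Phi_max.
Qed.

Definition join_kernel (x : R) (n : nat) (z : hist R) : R :=
  if alive x n z then join_prob_at (x + \sum_(i < n) z.2 i - z.1 n) else 0.

Lemma join_kernel01 x n z : 0 <= join_kernel x n z <= 1.
Proof. by rewrite /join_kernel; case: ifP => // _; rewrite ?join_prob_at01// lexx ler01. Qed.

Lemma measurable_wait x n :
  measurable_fun setT (fun z : hist R => x + \sum_(i < n) z.2 i - z.1 n).
Proof.
apply: measurable_funB; last exact: measurable_fst_coord.
apply: measurable_funD; first exact: measurable_cst.
by apply: measurable_sum => i; exact: measurable_snd_coord.
Qed.

Lemma measurable_join_kernel x n : measurable_fun setT (join_kernel x n).
Proof.
apply: measurable_fun_ifT; [exact: measurable_alive| |exact: measurable_cst].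
exact: (measurableT_comp measurable_join_prob_at (measurable_wait x n)).
Qed.

End join_probability.

(** * Joint treatment of both systems as thinned arrivals *)

Section system.
Context (R : realType) (E : ptopologicalType) (H : probability (borel E) R)
  (G : probability R R) (Phi : borel E * R -> bool) (x : R)
  d (O : measurableType d) (P : probability O R).
Hypothesis Phi_meas : measurable_fun [set p : borel E * R | (0 : R) <= p.2] Phi.
Hypothesis x_gt0 : 0 < x.
Variables (T S : nat -> O -> R) (Y : nat -> O -> borel E) (I J : nat -> O -> bool).
Variables (W : O -> skorokhod R) (N : nat -> set (set O)) (O0 : set O).
Hypotheses (mT : forall n, measurable_fun setT (T n)) (mS : forall n, measurable_fun setT (S n))
  (mY : forall n, measurable_fun setT (Y n)) (mI : forall n, measurable_fun setT (I n))
  (mJ : forall n, measurable_fun setT (J n))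
  (mW : forall t, 0 <= t -> measurable_fun setT (fun w => W w t)).
Hypothesis S_gt0 : forall n w, 0 < S n w.
Hypotheses (mO0 : measurable O0) (PO0 : P O0 = 1%E).
Hypothesis T_gt0 : forall w, O0 w -> 0 < T 0 w.
Hypothesis T_inc : forall w, O0 w -> forall n, T n w < T n.+1 w.
Hypothesis workload : forall w, O0 w ->
  is_workload x (T ^~ w) (S ^~ w) (fun n => I n w && J n w) (W w).
Hypothesis join : forall w, O0 w -> forall n, I n w = Phi (Y n w, left_lim (W w) (T n w)).
Hypothesis mN : forall n, N n `<=` measurable.
Hypothesis N_mono : forall m n, (m <= n)%N -> N m `<=` N n.

(* [N n] is the extra information at the [n]-th arrival: the randomization variables up
   to [n] in the controlled system, nothing in the baseline system. *)
Let before_type n := gen setT T `|`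
  (gen [set j | (j < n)%N] S `|` (gen [set j | (j < n)%N] Y `|` N n)).
Let before_size n := gen setT T `|`
  (past W (T n) `|` (gen [set j | (j <= n)%N] Y `|` N n)).

Hypothesis type_indep : forall n D C, <<s before_type n >> D -> measurable C ->
  (P (D `&` Y n @^-1` C) = P D * H C)%E.
Hypothesis size_indep : forall n D C, <<s before_size n >> D -> measurable C ->
  (P (D `&` S n @^-1` C) = P D * G C)%E.
Hypothesis admit_past : forall n,
  <<s gen setT T `|` (past W (T n) `|` N n) >> [set w | J n w].

Definition served n w := I n w && J n w.
Definition offered n w := raw_jump (S ^~ w) (served ^~ w) n.
Definition accepted n w := live_jump x (T ^~ w) (S ^~ w) (served ^~ w) n.
Definition lives n w := alive x n (T ^~ w, offered ^~ w).

Let S_gt0' w n : 0 < S n w. Proof. exact: S_gt0. Qed.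

Lemma measurable_served n : measurable_fun setT (served n).
Proof. exact: measurable_and. Qed.

Lemma measurable_offered n : measurable_fun setT (offered n).
Proof.
rewrite (_ : offered n = fun w => if served n w then S n w else 0).
  by apply: measurable_fun_ifT => //; exact: measurable_served.
by apply/funext => w; rewrite /offered /raw_jump; case: ifP; rewrite ?mul1r ?mul0r.
Qed.

Lemma measurable_lives n : measurable_fun setT (lives n).
Proof.
exact: (measurableT_comp (measurable_alive x n) (measurable_hist mT measurable_offered)).
Qed.

Lemma measurable_accepted n : measurable_fun setT (accepted n).
Proof.
apply: measurable_fun_ifT; [exact: measurable_lives|exact: measurable_offered|exact: measurable_cst].
Qed.

Lemma past_measurable n : past W (T n) `<=` measurable.
Proof.
move=> _ [t [C [t0 mC ->]]]; apply: measurableI.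
  by apply: measurable_pred; apply: measurable_fun_ltr.
by rewrite -[X in measurable X]setTI; exact: mW.
Qed.

Let sigma_measurable (A : set (set O)) : A `<=` measurable -> <<s A >> `<=` measurable.
Proof. by move=> h; apply: smallest_sub => //; exact: sigma_algebra_measurable. Qed.

Let m_before_type n : <<s before_type n >> `<=` measurable.
Proof.
apply: sigma_measurable => A [|[|[|]]].
- by apply: gen_measurable => i _; exact: mT.
- by apply: gen_measurable => i _; exact: mS.
- by apply: gen_measurable => i _; exact: mY.
- exact: mN.
Qed.

Let m_before_size n : <<s before_size n >> `<=` measurable.
Proof.
apply: sigma_measurable => A [|[|[|]]].
- by apply: gen_measurable => i _; exact: mT.
- exact: past_measurable.
- by apply: gen_measurable => i _; exact: mY.
- exact: mN.
Qed.

Let lives_set n := [set w | lives n w].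
Let m_lives_set n : measurable (lives_set n).
Proof. exact: measurable_pred (measurable_lives n). Qed.

Let wait n (w : O) : R := x + \sum_(i < n) offered i w - T n w.

Let join_live n w : O0 w -> lives n w -> I n w = Phi (Y n w, Num.max (wait n w) 0).
Proof.
move=> Ow al; rewrite (join Ow).
rewrite (alive_left_lim x_gt0 (T_gt0 Ow) (T_inc Ow) (S_gt0' w) (workload Ow) al).
rewrite (max_idPl _)// subr_ge0.
by have /aliveP/(_ n (leqnn n)) := al.
Qed.

Section service.
Variable n : nat.
Local Notation G1 := (before_size n).
Let M := O0 `&` lives_set n.

Let mT1 i : measurable_fun setT (T i : traceT G1 M -> R).
Proof.
apply: (@trace_gen_fun _ _ _ _ nat setT T) => //; by left.
Qed.

Let mY1 : measurable_fun setT (Y n : traceT G1 M -> borel E).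
Proof.
apply: (@trace_gen_fun _ _ _ _ nat [set j | (j <= n)%N] Y) => //=.
by move=> A h; right; right; left.
Qed.

(** Earlier sizes are not among the generators of [before_size], so the work offered is recovered
    from the path: at any rational time between two successive arrivals it equals the workload plus
    the elapsed time minus [x]. *)
Let sum_trace j : (j <= n)%N ->
  measurable_fun setT ((fun w => \sum_(i < j) offered i w) : traceT G1 M -> R).
Proof.
case: j => [_|j jn].
  by rewrite (_ : (fun _ => _) = cst 0); [exact: measurable_cst|apply/funext => w; rewrite big_ord0].
apply: trace_fun => C mC; split.
  rewrite -[X in measurable X]setTI.
  by apply: measurable_sum => // i; exact: measurable_offered.
pose piece (q : rat) : set O := [set w | T j w <= ratr q] `&` [set w | ratr q < T j.+1 w] `&`
  [set w | ratr q < T n w /\ C (W w (ratr q) + ratr q - x)].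
exists (\bigcup_q (if 0 <= ratr q :> R then piece q else set0)).
  apply: (@countable_bigcupT_measurable _ (g_sigma_algebraType G1)); first exact: countableP.
  move=> q; case: ifP => [q0|_]; last exact: (@measurable0 _ (g_sigma_algebraType G1)).
  apply: (@measurableI _ (g_sigma_algebraType G1)).
    apply: (@measurableI _ (g_sigma_algebraType G1)); apply: sub_sigma_algebra; left.
      exists j => //; exists `]-oo, ratr q]%classic => //.
      by rewrite setTI; apply/seteqP; split => w /=; rewrite in_itv.
    exists j.+1 => //; exists `]ratr q, +oo[%classic => //.
    by rewrite setTI; apply/seteqP; split => w /=; rewrite in_itv/= andbT.
  apply: sub_sigma_algebra; right; left; exists (ratr q), [set v | C (v + ratr q - x)]; split => //.
  rewrite -[X in measurable X]setTI.
  by apply: measurable_funB => //; exact: measurable_funD.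
apply/seteqP; split => w /= -[].
  move=> Cw [Ow al]; split => //.
  have := T_inc Ow j => /rat_in_itvoo[q]; rewrite in_itv/= => /andP[Tq qT].
  have q0 : 0 <= ratr q :> R.
    apply: le_trans (ltW Tq); apply: ltW.
    exact: (adm_gt0 (admissible_raw x_gt0 (T_gt0 Ow) (T_inc Ow) (S_gt0' w) (workload Ow))).
  exists q => //; rewrite q0 /piece /=; split; first by split => //; exact: ltW.
  split.
    apply: (lt_le_trans qT); move: jn; rewrite leq_eqVlt => /predU1P[->//|jn].
    exact/ltW/(adm_mono (admissible_raw x_gt0 (T_gt0 Ow) (T_inc Ow) (S_gt0' w) (workload Ow))).
  rewrite (alive_workload x_gt0 (T_gt0 Ow) (T_inc Ow) (S_gt0' w) (workload Ow) al jn (ltW Tq) qT).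
  by rewrite subrK addrC addKr.
move=> [q _]; case: ifP => // q0 [[/= Tq qT] [qn Cq]] [Ow al]; split => //.
move: Cq; rewrite (alive_workload x_gt0 (T_gt0 Ow) (T_inc Ow) (S_gt0' w) (workload Ow) al jn Tq qT).
by rewrite subrK addrC addKr.
Qed.

Let offered_trace i : (i < n)%N -> measurable_fun setT (offered i : traceT G1 M -> R).
Proof.
move=> iN; rewrite (_ : offered i = (fun w => \sum_(k < i.+1) offered k w - \sum_(k < i) offered k w)).
  by apply: measurable_funB; apply: sum_trace => //; exact: ltnW.
by apply/funext => w; rewrite big_ord_recr/= addrAC subrr add0r.
Qed.

Let lives_trace : trace_sigma G1 O0 (lives_set n).
Proof.
split; first exact: m_lives_set.
exists (\bigcap_(q : rat) (if 0 <= ratr q :> R then [set w | T n w <= ratr q] `|`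
    [set w | ratr q < T n w /\ `]0, +oo[%classic (W w (ratr q))] else setT)).
  rewrite -[X in <<s _ >> X]setCK setC_bigcap.
  apply: (@measurableC _ (g_sigma_algebraType G1)).
  apply: (@countable_bigcupT_measurable _ (g_sigma_algebraType G1)); first exact: countableP.
  move=> q; apply: (@measurableC _ (g_sigma_algebraType G1)).
  case: ifP => [q0|_]; last exact: (@measurableT _ (g_sigma_algebraType G1)).
  apply: (@measurableU _ (g_sigma_algebraType G1)); apply: sub_sigma_algebra.
    left; exists n => //; exists `]-oo, ratr q]%classic => //.
    by rewrite setTI; apply/seteqP; split => w /=; rewrite in_itv.
  by right; left; exists (ratr q), `]0, +oo[%classic.
have aR w (Ow : O0 w) := alive_rat x_gt0 (T_gt0 Ow) (T_inc Ow) (S_gt0' w) (workload Ow) n.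
apply/seteqP; split => w /= -[].
  move=> al Ow; split => // q _; case: ifP => // q0.
  have [?|qT] := leP (T n w) (ratr q); [by left|right; split => //].
  by rewrite /= in_itv/= andbT; apply: (aR w Ow).1.
move=> h Ow; split => //; apply: (aR w Ow).2 => q q0 qT.
have := h q Logic.I; rewrite q0 => -[/=|/= [_]]; first by rewrite leNgt qT.
by rewrite in_itv/= andbT.
Qed.

Lemma accepted_size A C : measurable A -> measurable C ->
  (P (history T accepted n @^-1` A `&` [set w | lives n w && served n w] `&` S n @^-1` C) =
   P (history T accepted n @^-1` A `&` [set w | lives n w && served n w]) * G C)%E.
Proof.
move=> mA mC.
have mZA : measurable (history T accepted n @^-1` A).
  rewrite -[X in measurable X]setTI; apply: measurable_history => //.
  exact: measurable_accepted.
apply: (@trace_indep _ _ _ P G1 O0) => //.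
- by rewrite -[X in measurable X]setTI; exact: mS.
- by move=> D hD; exact: size_indep.
have -> : history T accepted n @^-1` A `&` [set w | lives n w && served n w] =
    (history T accepted n @^-1` A `&` [set w | served n w]) `&` lives_set n.
  by apply/seteqP; split => w /=; [move=> [? /andP[]]|move=> [[? ?] ?]; split => //; apply/andP].
(* The event [lives_set n] is itself known on [O0]; what remains may be checked on [M], where
   accepted and offered work agree. *)
apply: (trace_sigma_restr lives_trace).
have mserved : measurable [set w | served n w] by exact: measurable_pred (measurable_served n).
have Zt : trace_sigma G1 M (history T accepted n @^-1` A).
  pose Z' w : hist R := (T ^~ w, fun i => if (i < n)%N then offered i w else 0).
  have mZ' : measurable_fun setT (Z' : traceT G1 M -> hist R).
    apply: (@measurable_hist _ _ (traceT G1 M) T (fun i w => if (i < n)%N then offered i w else 0)) => // i.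
    by case: ltnP => // iN; exact: offered_trace.
  apply: (trace_sigma_eq (A := Z' @^-1` A)) => //; last exact: trace_fun_inv.
  suff ZE w : M w -> Z' w = history T accepted n w.
    by apply/seteqP; split => w /= [Aw Mw]; split => //; move: Aw; rewrite ZE.
  move=> [Ow al]; congr pair; apply/funext => i; rewrite /trunc; case: ltnP => // iN.
  by apply/esym; apply: (live_jumpE al); exact: ltnW.
have wt : measurable_fun setT (wait n : traceT G1 M -> R).
  apply: measurable_funB => //; apply: measurable_funD; first exact: measurable_cst.
  exact: sum_trace.
have It : trace_sigma G1 M [set w | I n w].
  apply: (trace_sigma_eq (A := [set w | Phi (Y n w, Num.max (wait n w) 0)])).
  - exact: measurable_pred (mI n).
  - by apply/seteqP; split => w /= [Aw [Ow al]]; split => //; move: Aw; rewrite (join_live Ow al).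
  - apply: trace_pred.
    exact: (measurableT_comp (measurable_Phi_max Phi_meas) (measurable_fun_pair mY1 wt)).
have Jt : trace_sigma G1 M [set w | J n w].
  apply: (@sub_trace_sigma _ _ _ M (@m_before_size n)).
  move: (@admit_past n); apply: smallest_sub; first exact: smallest_sigma_algebra.
  move=> B [hB|[hB|hB]]; apply: sub_sigma_algebra.
  - by left.
  - by right; left.
  - by right; right; right.
apply: trace_measurable; apply: (@measurableI _ (traceT G1 M)); first exact: measurable_trace.
rewrite (_ : [set w | served n w] = [set w | I n w] `&` [set w | J n w]).
  by apply: (@measurableI _ (traceT G1 M)); exact: measurable_trace.
by apply/seteqP; split => w /=; [move=> /andP[]|move=> [? ?]; apply/andP].
Qed.

End service.

Let accepted_eq m w i : lives m w -> (i < m)%N -> accepted i w = offered i w.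
Proof. by move=> al im; apply: (live_jumpE al); exact: ltnW. Qed.

Let lives_history m w : lives m w = alive x m (history T accepted m w).
Proof.
rewrite -[history _ _ _ _]/(trunch m (T ^~ w, accepted ^~ w)) alive_trunc.
by apply/esym; exact: alive_live.
Qed.

Let hist_wait m (z : hist R) : R := x + \sum_(i < m) z.2 i - z.1 m.

Let wait_history m w : lives m w -> wait m w = hist_wait m (history T accepted m w).
Proof.
move=> al; rewrite /wait /hist_wait /= sum_trunc//; congr (_ + _ - _).
by apply: eq_bigr => i _; rewrite (accepted_eq al).
Qed.

Section arrival.
Variable n : nat.
Local Notation G2 := (before_type n).
Local Notation O2 := (traceT G2 O0).

Let mT2 i : measurable_fun setT (T i : O2 -> R).
Proof. by apply: (@trace_gen_fun _ _ _ _ nat setT T) => //; by left. Qed.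

Let mS2 i : (i < n)%N -> measurable_fun setT (S i : O2 -> R).
Proof.
move=> iN; apply: (@trace_gen_fun _ _ _ _ nat [set j | (j < n)%N] S) => //=.
by move=> A h; right; left.
Qed.

Let mY2 i : (i < n)%N -> measurable_fun setT (Y i : O2 -> borel E).
Proof.
move=> iN; apply: (@trace_gen_fun _ _ _ _ nat [set j | (j < n)%N] Y) => //=.
by move=> A h; right; right; left.
Qed.

Let history_trace m : (forall i, (i < m)%N -> measurable_fun setT (accepted i : O2 -> R)) ->
  measurable_fun setT (history T accepted m : O2 -> hist R).
Proof.
move=> h; apply: (@measurable_hist _ _ O2 T (fun i w => if (i < m)%N then accepted i w else 0)) => // i.
by case: ltnP => // im; exact: h.
Qed.

Let lives_trace2 m : measurable_fun setT (history T accepted m : O2 -> hist R) ->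
  trace_sigma G2 O0 (lives_set m).
Proof.
move=> mh; apply: (trace_sigma_eq (A := [set w | alive x m (history T accepted m w)])) => //.
  by apply/seteqP; split => w /= [Aw Ow]; split => //; move: Aw; rewrite /lives_set /= lives_history.
by apply: trace_pred; exact: (measurableT_comp (measurable_alive x m) mh).
Qed.

(** The admission decision sees the path before arrival [m], which on [lives_set m] is the function
    [level] of the epochs and earlier jumps. *)
Let admit_trace m : (m < n)%N -> (forall i, (i < m)%N -> measurable_fun setT (accepted i : O2 -> R)) ->
  trace_sigma G2 (O0 `&` lives_set m) [set w | J m w].
Proof.
move=> mn ma; move: (@admit_past m); apply: trace_sigma_gen => A [hA|[hA|hA]].
- by apply: (@sub_trace_sigma _ _ _ _ (@m_before_type n)); apply: sub_sigma_algebra; left.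
- have mA := past_measurable hA; case: hA => t [C [t0 mC AE]].
  pose level w := x + \sum_(i < m) (if T i w <= t then `|accepted i w| else 0) - t.
  have ml : measurable_fun setT (level : O2 -> R).
    apply: measurable_funB => //; apply: measurable_funD => //.
    apply: measurable_sum => i; apply: measurable_fun_ifT => //.
      exact: measurable_fun_ler.
    exact: (measurableT_comp (@normr_measurable R setT) (ma i (ltn_ord i))).
  apply: (trace_sigma_eq (A := [set w | t < T m w] `&` level @^-1` C)) => //.
    apply/seteqP; split => w /=; rewrite AE.
      move=> [[tT Cw] [Ow al]]; split => //; split => //.
      by rewrite (alive_workload_sum x_gt0 (T_gt0 Ow) (T_inc Ow) (S_gt0' w) (workload Ow) al t0 tT).
    move=> [[tT Cw] [Ow al]]; split => //; split => //; move: Cw.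
    by rewrite (alive_workload_sum x_gt0 (T_gt0 Ow) (T_inc Ow) (S_gt0' w) (workload Ow) al t0 tT).
  apply: (trace_sigmaS (@subIsetl _ O0 _)); apply: trace_measurable.
  apply: (@measurableI _ O2); last by rewrite -[X in measurable X]setTI; exact: ml.
  by apply: measurable_pred; exact: measurable_fun_ltr.
- apply: (@sub_trace_sigma _ _ _ _ (@m_before_type n)); apply: sub_sigma_algebra.
  by right; right; right; exact: N_mono (ltnW mn) _ hA.
Qed.

(** [before_type] does not contain the path, so the jumps are rebuilt one by one: the history
    decides [alive] and the wait, the latter with the type decides joining, then come the admission
    and the size. *)
Let accepted_trace m : (m <= n)%N ->
  forall i, (i < m)%N -> measurable_fun setT (accepted i : O2 -> R).
Proof.
elim: m => // m ih mn i; rewrite ltnS leq_eqVlt => /predU1P[->{i}|im]; last exact: ih (ltnW mn) i im.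
have ma := ih (ltnW mn).
have mh := history_trace ma.
have lt := lives_trace2 mh.
pose M := O0 `&` lives_set m.
have It : trace_sigma G2 M [set w | I m w].
  have mw : measurable_fun setT ((fun w => hist_wait m (history T accepted m w)) : O2 -> R).
    exact: (measurableT_comp (measurable_wait x m) mh).
  apply: (trace_sigma_eq (A := [set w | Phi (Y m w, Num.max (hist_wait m (history T accepted m w)) 0)])).
  - exact: measurable_pred (mI m).
  - apply/seteqP; split => w /= [Aw [Ow al]]; split => //; move: Aw;
      by rewrite (join_live Ow al) wait_history.
  - apply: (trace_sigmaS (@subIsetl _ O0 _)); apply: trace_pred.
    exact: (measurableT_comp (measurable_Phi_max Phi_meas) (measurable_fun_pair (mY2 mn) mw)).
have Jt := admit_trace mn ma.
have st : trace_sigma G2 O0 [set w | served m w && lives m w].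
  rewrite (_ : [set w | _] = ([set w | I m w] `&` [set w | J m w]) `&` lives_set m).
    apply: (trace_sigma_restr lt); apply: trace_measurable.
    by apply: (@measurableI _ (traceT G2 M)); exact: measurable_trace.
  by apply/seteqP; split => w /=; [move=> /andP[/andP[]]|move=> [[? ?] ?]; apply/andP; split => //; apply/andP].
rewrite (_ : accepted m = fun w => if served m w && lives m w then S m w else 0).
  by apply: measurable_fun_ifT => //; [exact: trace_bool|exact: mS2].
apply/funext => w; rewrite /accepted /live_jump -/(lives m w).
case: ifP => _; rewrite ?andbF// andbT /raw_jump.
by case: (served m w); rewrite ?mul1r ?mul0r.
Qed.

(** The type is independent of the history, of which the wait is a function; freezing the history
    leaves the probability that a random type joins. *)
Lemma accepted_join A : measurable A ->
  P (history T accepted n @^-1` A `&` [set w | lives n w && I n w]) =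
  (\int[pushforward P (history T accepted n)]_(z in A) (join_kernel H Phi x n z)%:E)%E.
Proof.
move=> mA.
have mh := history_trace (accepted_trace (leqnn n)).
have mZ : measurable_fun setT (history T accepted n).
  by apply: measurable_history => // i; exact: measurable_accepted.
pose M : set (hist R * borel E) := [set zy | A zy.1 /\
  (alive x n zy.1 && Phi (zy.2, Num.max (hist_wait n zy.1) 0))].
have mM : measurable M.
  apply: measurableI.
    by rewrite -[X in measurable X]setTI; exact: measurable_fst.
  apply: measurable_pred; apply: measurable_and.
    exact: (measurableT_comp (measurable_alive x n) measurable_fst).
  have mg : measurable_fun setT
      (fun zy : hist R * borel E => (zy.2, hist_wait n zy.1) : borel E * R).
    apply: measurable_fun_pair; first exact: measurable_snd.
    exact: (measurableT_comp (measurable_wait x n) measurable_fst).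
  exact: (measurableT_comp (measurable_Phi_max Phi_meas) mg).
have ind B C : measurable B -> measurable C ->
    (P (history T accepted n @^-1` B `&` Y n @^-1` C) = P (history T accepted n @^-1` B) * H C)%E.
  move=> mB mC; apply: (@trace_indep _ _ _ P G2 O0) => //.
  - by rewrite -[X in measurable X]setTI; exact: mY.
  - by move=> D hD; exact: type_indep.
  - exact: trace_fun_inv.
have key := @indep_freeze _ _ _ _ _ _ R P _ _ mZ (mY n) H ind M mM.
transitivity (P [set w | M (history T accepted n w, Y n w)]).
  have mZA : measurable (history T accepted n @^-1` A) by rewrite -[X in measurable X]setTI; apply: (mZ).
  rewrite -[LHS](probability_setI1 _ mO0 PO0); last first.
    by apply: measurableI => //; apply: measurable_pred; apply: measurable_and => //; exact: measurable_lives.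
  rewrite -[RHS](probability_setI1 _ mO0 PO0); last first.
    by rewrite -[X in measurable X]setTI; apply: measurable_fun_pair.
  congr (P _); apply/seteqP; split => w /=.
    move=> [[Aw /andP[al Iw]] Ow]; split => //; split => //=.
    by rewrite -lives_history// al -wait_history// -join_live.
  move=> [[/= Aw] + Ow]; rewrite -lives_history// => /andP[al Iw]; split => //; split => //.
  by rewrite al (join_live Ow al) wait_history.
transitivity (\int[law P mZ]_(z in A) (join_kernel H Phi x n z)%:E)%E; last by [].
transitivity (\int[law P mZ]_z H (xsection M z))%E; first exact: key.
rewrite [RHS]integral_mkcond; apply: eq_integral => z _.
rewrite patchE /join_kernel; case: ifPn => zA; last first.
  rewrite (_ : xsection _ _ = set0) ?measure0//.
  apply/seteqP; split => y //; rewrite /xsection /M /= inE/= => -[Az _].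
  by move: zA; rewrite notin_setE.
case: ifPn => al; last first.
  rewrite (_ : xsection _ _ = set0) ?measure0//.
  by apply/seteqP; split => y //; rewrite /xsection /M /= inE/= (negbTE al) => -[].
rewrite join_prob_atE//; congr (H _).
apply/seteqP; split => y; rewrite /xsection /M /= inE/= al /=; first by case.
by split => //; exact: set_mem.
Qed.

End arrival.

End system.

(** * From conditional to unconditional independence *)

Section conditional_independence.
Context (R : realType) d (O : measurableType d) (P : probability O R).
Local Open Scope ereal_scope.

Lemma cond_prob_cst_indep (Gs : set (set O)) (A D : set O) (c : \bar R) :
  Gs `<=` measurable -> cond_prob P Gs A (fun=> c) -> <<s Gs >> D -> P (D `&` A) = P D * c.
Proof.
move=> Gm [_ _ h] GD.
have mD : measurable D.
  by move: D GD; apply: smallest_sub => //; exact: sigma_algebra_measurable.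
by rewrite setIC -h// integral_cst// muleC.
Qed.

Lemma cond_prob_ae_cst (Gs : set (set O)) (A : set O) (p : O -> \bar R) (c : R) :
  Gs `<=` measurable -> cond_prob P Gs A p ->
  (forall D, <<s Gs >> D -> P (A `&` D) = P D * c%:E) ->
  {ae P, forall w, p w = c%:E}.
Proof.
move=> Gm [mp ip hp] h.
have GM : <<s Gs >> `<=` @measurable _ O.
  by apply: smallest_sub => //; exact: sigma_algebra_measurable.
have mid : measurable_fun setT (id : O -> g_sigma_algebraType Gs).
  by move=> _ B mB; rewrite setTI; exact: GM.
(* The integrals of [p] are known only over events of [<<s Gs >>], so uniqueness is applied to the
   restriction of [P] to this sigma-algebra. *)
have ae' : ae_eq (law P mid) setT p (cst c%:E).
  apply: integral_ae_eq => //.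
  - exact: (@integrable_pushforward _ _ _ _ R _ mid P setT p).
  - move=> B _ mB.
    rewrite (@integral_pushforward _ _ _ _ R _ mid P B p)//; last first.
      by apply: (@integrableS _ _ _ _ setT) => //; exact: GM.
    rewrite [LHS](hp B mB) h// integral_cst//= muleC//.
case: ae' => N [mN PN sub]; exists N; split => //; first exact: GM.
by move=> w /= pw; apply: sub => /= H; apply: pw; exact: H.
Qed.

(** The conditional law of [X n] is constant, so in the product formula its factor is almost
    everywhere a constant and leaves the integral. Intersections of events from [Gs] and [G2] then
    generate the join. *)
Lemma cond_indep_indep d' (F : measurableType d') (Gs G2 : set (set O)) (Ix : Type) (n : Ix)
    (X : Ix -> O -> F) (mu : probability F R) :
  Gs `<=` measurable -> G2 `<=` measurable -> measurable_fun setT (X n) ->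
  cond_dist P Gs (X n) (fun=> mu) ->
  cond_indep P Gs (gen [set n] X) G2 ->
  forall D C, <<s Gs `|` G2 >> D -> measurable C -> P (D `&` X n @^-1` C) = P D * mu C.
Proof.
move=> Gm G2m mX dist ind D C GD mC.
have GM : <<s Gs >> `<=` @measurable _ O.
  by apply: smallest_sub => //; exact: sigma_algebra_measurable.
have G2M : <<s G2 >> `<=` @measurable _ O.
  by apply: smallest_sub => //; exact: sigma_algebra_measurable.
have mXC : measurable (X n @^-1` C) by rewrite -[X in measurable X]setTI; exact: mX.
have base D1 : <<s Gs >> D1 -> P (D1 `&` X n @^-1` C) = P D1 * mu C.
  by move=> GD1; apply: (cond_prob_cst_indep Gm) GD1; exact: dist.
have PXC : P (X n @^-1` C) = mu C.
  have := base setT (@measurableT _ (g_sigma_algebraType Gs)).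
  rewrite setTI => ->.
  by rewrite [X in X * _](_ : _ = 1) ?mul1e//; exact: probability_setT.
have muC : mu C \is a fin_num by rewrite fin_num_measure.
pose rect : set (set O) := [set D1 `&` D2 | D1 in <<s Gs >> & D2 in <<s G2 >>].
apply: (@indep_sigma _ _ _ P rect) => //.
- move=> _ _ [A GA [B GB <-]] [A' GA' [B' GB' <-]]; rewrite setIACA.
  exists (A `&` A'); first exact: (@measurableI _ (g_sigma_algebraType Gs)).
  by exists (B `&` B') => //; exact: (@measurableI _ (g_sigma_algebraType G2)).
- by move=> _ [A GA [B GB <-]]; apply: measurableI; [exact: GM|exact: G2M].
- move=> _ [A GA [B GB <-]].
  have GXC : <<s gen [set n] X >> (X n @^-1` C).
    by apply: sub_sigma_algebra; exists n => //; exists C => //; rewrite setTI.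
  have [p [q [cp cq cpq]]] := ind _ _ GXC GB.
  have pc : {ae P, forall w, p w = (fine (mu C))%:E}.
    apply: (cond_prob_ae_cst Gm cp) => D1 GD1.
    by rewrite setIC base// fineK.
  have [mp _ _] := cp; have [mq iq hq] := cq; have [mpq _ hpq] := cpq.
  have up f : @measurable_fun _ _ (g_sigma_algebraType Gs) (\bar R) setT f ->
      measurable_fun setT (f : O -> \bar R).
    by move=> mf _ B' mB'; apply: GM; exact: mf.
  have mA := GM _ GA.
  have -> : A `&` B `&` X n @^-1` C = (X n @^-1` C `&` B) `&` A.
    by rewrite setIC [A `&` B]setIC setIA.
  rewrite -hpq// (ae_eq_integral (fun w => (fine (mu C))%:E * q w))//.
  + rewrite integralZl//; last exact: (integrableS measurableT).
    by rewrite hq// fineK// muleC [B `&` A]setIC.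
  + by apply: measurable_funTS; exact: up.
  + apply: measurable_funTS; apply: measurable_funeM; exact: up.
  + by case: pc => N [mN PN sub]; exists N; split => // w /= h; apply: sub => /= e; apply: h => _; rewrite e.
- move: D GD; apply: smallest_sub; first exact: smallest_sigma_algebra.
  move=> D [GD|G2D]; apply: sub_sigma_algebra.
    exists D; first exact: sub_sigma_algebra.
    by exists setT; [exact: (@measurableT _ (g_sigma_algebraType G2))|rewrite setIT].
  exists setT; first exact: (@measurableT _ (g_sigma_algebraType Gs)).
  by exists D; [exact: sub_sigma_algebra|rewrite setTI].
Qed.

Lemma ae_full (Q : O -> Prop) : {ae P, forall w, Q w} ->
  exists O0 : set O, [/\ measurable O0, P O0 = 1 & forall w, O0 w -> Q w].
Proof.
move=> [N [mN PN sub]]; exists (~` N); split.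
- exact: measurableC.
- by rewrite probability_setC// PN sube0.
- by move=> w Nw; apply: contrapT => nQ; apply: Nw; exact: sub.
Qed.

End conditional_independence.

Section sub_law.
Local Open Scope ereal_scope.
Context d1 d2 (T1 : measurableType d1) (T2 : measurableType d2) (R : realType).
Variables (P : probability T1 R) (f : T1 -> T2) (J : set T1).

(* Radon-Nikodym derivative of the joint law with [J], truncated at its bound [p]. *)
Definition sub_law & measurable_fun setT f & measurable J :=
  fun A => P (f @^-1` A `&` J).

Hypotheses (mf : measurable_fun setT f) (mJ : measurable J).

Let sub_law0 : sub_law mf mJ set0 = 0.
Proof. by rewrite /sub_law preimage_set0 set0I measure0. Qed.

Let sub_law_ge0 A : 0 <= sub_law mf mJ A.
Proof. exact: measure_ge0. Qed.

Let sub_law_sigma_additive : semi_sigma_additive (sub_law mf mJ).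
Proof.
exact: (@measure_semi_sigma_additive _ _ _ (pushforward (mrestr P mJ) (mfun_Sub (mem_set mf)))).
Qed.

HB.instance Definition _ := isMeasure.Build _ _ _ (sub_law mf mJ)
  sub_law0 sub_law_ge0 sub_law_sigma_additive.

Let sub_law_fin : fin_num_fun (sub_law mf mJ).
Proof.
move=> A mA; apply: fin_num_measure; apply: measurableI => //.
by rewrite -[X in measurable X]setTI; exact: mf.
Qed.

HB.instance Definition _ := Measure_isFinite.Build _ _ _ (sub_law mf mJ) sub_law_fin.

(** The truncation makes the bound by [p] hold everywhere instead of almost everywhere, as the
    pathwise comparison of runs requires. *)
Lemma dominated_density (p : T2 -> R) :
  measurable_fun setT p -> (forall z, 0 <= p z)%R ->
  (forall A, measurable A -> P (f @^-1` A `&` J) <= \int[pushforward P f]_(z in A) (p z)%:E) ->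
  exists q : T2 -> R, [/\ measurable_fun setT q, forall z, (0 <= q z)%R,
    forall z, (q z <= p z)%R &
    forall A, measurable A -> P (f @^-1` A `&` J) = \int[pushforward P f]_(z in A) (q z)%:E].
Proof.
move=> mp p0 le_p.
pose nu : {finite_measure set T2 -> \bar R} := sub_law mf mJ.
pose mu : probability T2 R := law P mf.
have numu : nu `<< mu.
  apply/null_content_dominatesP => A mA muA.
  apply/eqP; rewrite eq_le measure_ge0 andbT -muA; apply: le_measure; rewrite ?inE//.
  - by apply: measurableI => //; rewrite -[X in measurable X]setTI; exact: mf.
  - by rewrite -[X in measurable X]setTI; exact: mf.
have [g [g0 gfin ig nug]] := radon_nikodym_sigma_finite numu.
have mg := measurable_int _ ig.
have mg' : measurable_fun setT (fine \o g) by exact: (measurableT_comp (fine_measurable measurableT)).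
exists (fun z => Num.min (fine (g z)) (p z)); split.
- exact: measurable_minr.
- by move=> z; rewrite le_min p0 fine_ge0.
- by move=> z; rewrite ge_min lexx orbT.
move=> A mA.
transitivity (\int[mu]_(z in A) g z); first exact: nug.
transitivity (\int[mu]_(z in A) (Num.min (fine (g z)) (p z))%:E); last by [].
apply: ge0_ae_eq_integral => //.
- exact: measurable_funTS.
- by apply: measurable_funTS; apply/measurable_EFinP; exact: measurable_minr.
- by move=> z _; rewrite lee_fin le_min p0 fine_ge0.
(* Here the density exceeds [p], yet its integral is at most that of [p]; so the positive function
   [g - p] has integral 0 and [D] is null. *)
pose D := [set z | (p z < fine (g z))%R].
have mD : measurable D by apply: measurable_pred; exact: measurable_fun_ltr.
suff muD : mu D = 0.
  exists D; split => // z /= h; rewrite /D /= ltNge; apply/negP => gp; apply: h => _.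
  by rewrite (min_idPl gp) fineK.
have fin_nu : nu D \is a fin_num by exact: fin_num_measure.
have le1 : \int[mu]_(z in D) g z <= \int[mu]_(z in D) (p z)%:E by rewrite -nug//; exact: le_p.
have ip : mu.-integrable D (EFin \o p).
  apply: (le_integrable mD _ _ (integrableS measurableT mD (@subsetT _ D) ig)).
    by apply: measurable_funTS; apply/measurable_EFinP.
  move=> z Dz; rewrite [leLHS]gee0_abs ?lee_fin// gee0_abs// -(fineK (gfin z)) lee_fin.
  exact: ltW.
have iD : mu.-integrable D g by exact: (integrableS measurableT).
have gap : \int[mu]_(z in D) (g z - (p z)%:E) = 0.
  apply/eqP; rewrite eq_le; apply/andP; split.
    by rewrite integralB// sube_le0.
  apply: integral_ge0 => z Dz; rewrite sube_ge0//.
  by rewrite -(fineK (gfin z)) lee_fin ltW.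
have : ae_eq mu D (fun z => g z - (p z)%:E) (cst 0).
  apply/ae_eq_integral_abs => //.
    by apply: emeasurable_funB; apply: measurable_funTS => //; exact/measurable_EFinP.
  rewrite -[RHS]gap; apply: eq_integral => z; rewrite inE => Dz.
  by rewrite gee0_abs// sube_ge0// -(fineK (gfin z)) lee_fin ltW.
move=> [B [mB muB sub]]; apply/eqP; rewrite eq_le measure_ge0 andbT -muB.
apply: le_measure; rewrite ?inE// => z Dz; apply: sub => /= h.
have := h Dz; rewrite -(fineK (gfin z)) -EFinB => -[] /eqP.
by rewrite subr_eq0 => /eqP e; move: Dz; rewrite /D /= e ltxx.
Qed.

End sub_law.

Section kernel_fiber.
Context d1 d2 (X : measurableType d1) (F : measurableType d2) (R : realType)
  (k : R.-pker X ~> F) (a : X).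

Definition fiber : set F -> \bar R := k a.

HB.instance Definition _ := Measure.on fiber.
HB.instance Definition _ := Measure_isProbability.Build _ _ _ fiber (prob_kernel a).

End kernel_fiber.

Section systems.
Context (R : realType) (E : ptopologicalType) (H : probability (borel E) R)
  (Psi : R.-pker borel E ~> R) (Phi : borel E * R -> bool) (x : R).
Hypothesis Phi_meas : measurable_fun [set p : borel E * R | (0 : R) <= p.2] Phi.
Hypothesis x_gt0 : 0 < x.
Hypothesis Psi_cst : forall y1 y2 A, measurable A -> Psi y1 A = Psi y2 A.

(** As [Psi] does not depend on the type, its value at the default type is the common service
    law. *)
Local Notation size_law := (fiber Psi point).

Let accepted_jump d (O : measurableType d) (T S : nat -> O -> R) (I J : nat -> O -> bool) n w :
  ([set w | lives x T S I J n w && served I J n w] w -> accepted x T S I J n w = S n w) /\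
  (~ [set w | lives x T S I J n w && served I J n w] w -> accepted x T S I J n w = 0).
Proof.
rewrite /accepted /live_jump /= -/(offered S I J n w) -/(lives x T S I J n w) /offered /raw_jump.
by case: (lives _ _ _ _ _ _ _); case: (served _ _ _ _) => /=; split; rewrite ?mul1r ?mul0r//; case.
Qed.

Let gen_rv_measurable d (O : measurableType d) (P : probability O R) d' (F : measurableType d')
  (D : set nat) (X : nat -> {RV P >-> F}) : gen D X `<=` measurable.
Proof. by apply: gen_measurable. Qed.

Lemma baseline_kernel d (O : measurableType d) (P : probability O R)
    (T : nat -> {RV P >-> R}) (Y : nat -> {RV P >-> borel E})
    (S : nat -> {RV P >-> R}) (I : nat -> {RV P >-> bool}) (W : O -> skorokhod R) :
  baseline H Psi Phi x T Y S I W -> exists b : nat -> O -> R,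
  [/\ forall n, measurable_fun setT (b n), has_kernel P T b (join_kernel H Phi x) size_law &
   exists O0, [/\ measurable O0, P O0 = 1%E & forall w, O0 w ->
     admissible (T ^~ w, b ^~ w) /\
     forall u, 0 <= u -> stop (W w) (hitting0 (W w)) u = path_map x (T ^~ w, b ^~ w) u]].
Proof.
move=> [ep S0 mW wl td ti jn si sd].
have [D1 [mD1 PD1 ep1]] := ae_full ep.
have [D2 [mD2 PD2 wl2]] := ae_full wl.
have [D3 [mD3 PD3 jn3]] := ae_full (ae_foralln jn).
pose O0 := D1 `&` D2 `&` D3.
have mO0 : measurable O0 by do 2 apply: measurableI => //.
have PO0 : P O0 = 1%E.
  by rewrite probability_setI1// ?probability_setI1//; exact: measurableI.
pose J (_ : nat) (_ : O) := true.
have wl0 w : O0 w -> is_workload x (T ^~ w) (S ^~ w) (fun n => I n w && J n w) (W w).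
  move=> [[_ /wl2]]; rewrite (_ : (fun n => I n w && J n w) = (I ^~ w))//.
  by apply/funext => n; rewrite andbT.
have T0 w : O0 w -> 0 < T 0%N w by move=> [[/ep1[]]].
have Tinc w : O0 w -> forall n, T n w < T n.+1 w by move=> [[/ep1[]]].
have jn0 w : O0 w -> forall n, I n w = Phi (Y n w, left_lim (W w) (T n w)) by move=> [_ /jn3].
have mRV : forall e (F : measurableType e) (X : {RV P >-> F}), measurable_fun setT X by [].

have mpast n : past W (T n) `<=` measurable.
  exact: (past_measurable (fun m => mRV _ _ (T m)) mW).
pose N (_ : nat) : set (set O) := set0.
have mN n : N n `<=` measurable by move=> A [].
have mJ n : measurable_fun setT (J n) by exact: measurable_cst.
have adm n : <<s gen setT T `|` (past W (T n) `|` N n) >> [set w | J n w].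
  rewrite (_ : [set w | _] = setT); last by apply/seteqP; split.
  exact: (@measurableT _ (g_sigma_algebraType _)).
have sind n D C : <<s gen setT T `|` (past W (T n) `|` (gen [set j | (j <= n)%N] Y `|` N n)) >> D ->
    measurable C -> (P (D `&` S n @^-1` C) = P D * size_law C)%E.
  rewrite setU0 => GD mC; apply: cond_prob_cst_indep GD.
    by move=> A [|[|]]; [exact: gen_rv_measurable|exact: mpast|exact: gen_rv_measurable].
  have := sd n C mC; rewrite (_ : (fun w => Psi (Y n w) C) = (fun=> size_law C))//.
  by apply/funext => w; exact: Psi_cst.
have tind n D C : <<s gen setT T `|` (gen [set j | (j < n)%N] S `|` (gen [set j | (j < n)%N] Y `|` N n)) >> D ->
    measurable C -> (P (D `&` Y n @^-1` C) = P D * H C)%E.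
  rewrite setU0; apply: (@cond_indep_indep _ _ _ _ _ _ _ _ _ n (fun m => Y m) _ _ _ (mRV _ _ (Y n)) (td n) (ti n)).
  - exact: gen_rv_measurable.
  - by move=> A []; exact: gen_rv_measurable.
have K1 := accepted_size Phi_meas x_gt0 (fun n => mRV _ _ (T n)) (fun n => mRV _ _ (S n))
  (fun n => mRV _ _ (Y n)) (fun n => mRV _ _ (I n)) mJ mW S0 mO0 PO0 T0 Tinc wl0 jn0 mN sind adm.
have K2 := accepted_join Phi_meas x_gt0 (fun n => mRV _ _ (T n)) (fun n => mRV _ _ (S n))
  (fun n => mRV _ _ (Y n)) (fun n => mRV _ _ (I n)) mJ mW S0 mO0 PO0 T0 Tinc wl0 jn0 mN
  (fun _ _ _ => @subset_refl _ _) tind adm.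
exists (accepted x T S I J); split.
- by apply: measurable_accepted => //.
- move=> n; exists [set w | lives x T S I J n w && served I J n w], (S n); split.
  + apply: measurable_pred; apply: measurable_and; [exact: measurable_lives|exact: measurable_served].
  + exact: mRV.
  + by move=> w; exact: accepted_jump.
  + by move=> A C; exact: K1.
  + move=> A mA; rewrite -K2//; congr (P (_ `&` _)).
    by apply/seteqP; split => w /=; rewrite /served andbT.
- exists O0; split => // w Ow; split.
    exact: (admissible_live x_gt0 (T0 w Ow) (Tinc w Ow) (fun n => S0 n w) (wl0 w Ow)).
  by move=> u u0; exact: (stop_path_map x_gt0 (T0 w Ow) (Tinc w Ow) (fun n => S0 n w) (wl0 w Ow)).
Qed.

Lemma admission_kernel d (O : measurableType d) (P : probability O R)
    (T : nat -> {RV P >-> R}) (Y : nat -> {RV P >-> borel E})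
    (S Z : nat -> {RV P >-> R}) (I J : nat -> {RV P >-> bool}) (W : O -> skorokhod R) :
  admission_controlled H Psi Phi x T Y S Z I J W -> exists (b : nat -> O -> R) (q : nat -> hist R -> R),
  [/\ forall n, measurable_fun setT (b n), has_kernel P T b q size_law,
   forall n, [/\ measurable_fun setT (q n), forall z, 0 <= q n z & forall z, q n z <= join_kernel H Phi x n z] &
   exists O0, [/\ measurable O0, P O0 = 1%E & forall w, O0 w ->
     admissible (T ^~ w, b ^~ w) /\
     forall u, 0 <= u -> stop (W w) (hitting0 (W w)) u = path_map x (T ^~ w, b ^~ w) u]].
Proof.
move=> [ep S0 Z01 mW wl td ti jn sd rd ri adm_].
have [D1 [mD1 PD1 ep1]] := ae_full ep.
have [D2 [mD2 PD2 wl2]] := ae_full wl.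
have [D3 [mD3 PD3 jn3]] := ae_full (ae_foralln jn).
pose O0 := D1 `&` D2 `&` D3.
have mO0 : measurable O0 by do 2 apply: measurableI => //.
have PO0 : P O0 = 1%E.
  by rewrite probability_setI1// ?probability_setI1//; exact: measurableI.
have wl0 w : O0 w -> is_workload x (T ^~ w) (S ^~ w) (fun n => I n w && J n w) (W w).
  by move=> [[_ /wl2]].
have T0 w : O0 w -> 0 < T 0%N w by move=> [[/ep1[]]].
have Tinc w : O0 w -> forall n, T n w < T n.+1 w by move=> [[/ep1[]]].
have jn0 w : O0 w -> forall n, I n w = Phi (Y n w, left_lim (W w) (T n w)) by move=> [_ /jn3].
have mRV : forall e (F : measurableType e) (X : {RV P >-> F}), measurable_fun setT X by [].

have mpast n : past W (T n) `<=` measurable.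
  exact: (past_measurable (fun m => mRV _ _ (T m)) mW).
pose N (n : nat) : set (set O) := gen [set j | (j <= n)%N] Z.
have mN n : N n `<=` measurable by exact: gen_rv_measurable.
have Nmono m n : (m <= n)%N -> N m `<=` N n.
  by move=> mn A [i /= im h]; exists i => //=; exact: leq_trans mn.
have adm n : <<s gen setT T `|` (past W (T n) `|` N n) >> [set w | J n w].
  have hJ : <<s gen setT T `|` (past W (T n) `|` gen [set n] Z) >> [set w | J n w].
    have := adm_ n measurableT [set true] Logic.I; rewrite setTI.
    by congr (_ _); apply/seteqP; split.
  move: (hJ); apply: smallest_sub; first exact: smallest_sigma_algebra.
  move=> A [hA|[hA|[i ni hA]]]; apply: sub_sigma_algebra; [by left|by right; left|].
  by right; right; exists i => //=; rewrite (ni : i = n).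
have sind n D C : <<s gen setT T `|` (past W (T n) `|` (gen [set j | (j <= n)%N] Y `|` N n)) >> D ->
    measurable C -> (P (D `&` S n @^-1` C) = P D * size_law C)%E.
  move=> GD mC; apply: cond_prob_cst_indep GD.
    by move=> A [|[|[|]]]; [exact: gen_rv_measurable|exact: mpast|exact: gen_rv_measurable|exact: mN].
  have := sd n C mC; rewrite (_ : (fun w => Psi (Y n w) C) = (fun=> size_law C))//.
  by apply/funext => w; exact: Psi_cst.
have tind n D C : <<s gen setT T `|` (gen [set j | (j < n)%N] S `|` (gen [set j | (j < n)%N] Y `|` N n)) >> D ->
    measurable C -> (P (D `&` Y n @^-1` C) = P D * H C)%E.
  apply: (@cond_indep_indep _ _ _ _ _ _ _ _ _ n (fun m => Y m) _ _ _ (mRV _ _ (Y n)) (td n) (ti n)).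
  - exact: gen_rv_measurable.
  - by move=> A [|[]]; exact: gen_rv_measurable.
have K1 := accepted_size Phi_meas x_gt0 (fun n => mRV _ _ (T n)) (fun n => mRV _ _ (S n))
  (fun n => mRV _ _ (Y n)) (fun n => mRV _ _ (I n)) (fun n => mRV _ _ (J n)) mW S0 mO0 PO0 T0 Tinc
  wl0 jn0 mN sind adm.
have K2 := accepted_join Phi_meas x_gt0 (fun n => mRV _ _ (T n)) (fun n => mRV _ _ (S n))
  (fun n => mRV _ _ (Y n)) (fun n => mRV _ _ (I n)) (fun n => mRV _ _ (J n)) mW S0 mO0 PO0 T0 Tinc
  wl0 jn0 mN Nmono tind adm.
pose b := accepted x T S I J.
pose D n := [set w | lives x T S I J n w && served I J n w].
have mb n : measurable_fun setT (b n) by apply: measurable_accepted.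
have mD n : measurable (D n).
  apply: measurable_pred; apply: measurable_and; last exact: measurable_served.
  exact: (measurable_lives x (fun m => mRV _ _ (T m)) (fun m => mRV _ _ (S m))
    (fun m => mRV _ _ (I m)) (fun m => mRV _ _ (J m))).
have mh n : measurable_fun setT (history T b n).
  exact: (measurable_history (fun m => mRV _ _ (T m)) mb).
(* Served customers are among those who join, whose probability is given by [K2]; this is the bound
   on the density. *)
have le_join n A : measurable A -> (P (history T b n @^-1` A `&` D n) <=
    \int[pushforward P (history T b n)]_(z in A) (join_kernel H Phi x n z)%:E)%E.
  move=> mA; have mhA : measurable (history T b n @^-1` A).
    by rewrite -[X in measurable X]setTI; exact: mh.
  rewrite -K2//; apply: le_measure; rewrite ?inE.
  - exact: measurableI.
  - apply: measurableI => //; apply: measurable_pred; apply: measurable_and => //.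
    exact: (measurable_lives x (fun m => mRV _ _ (T m)) (fun m => mRV _ _ (S m))
      (fun m => mRV _ _ (I m)) (fun m => mRV _ _ (J m))).
  - by move=> w [Aw /andP[al /andP[Iw _]]]; split => //=; rewrite al.
have kernel_ge0 n z : 0 <= join_kernel H Phi x n z by have /andP[] := join_kernel01 H Phi_meas x n z.
have /choice[q qP] n := dominated_density (mh n) (mD n) (measurable_join_kernel H Phi_meas x n)
  (kernel_ge0 n) (le_join n).
exists b, q; split => //.
- move=> n; exists (D n), (S n); split.
  + exact: mD.
  + exact: mRV.
  + by move=> w; exact: accepted_jump.
  + by move=> A C; exact: K1.
  + by move=> A mA; have [_ _ _] := qP n; exact.
- by move=> n; have [? ? ? _] := qP n.
- exists O0; split => // w Ow; split.
    exact: (admissible_live x_gt0 (T0 w Ow) (Tinc w Ow) (fun n => S0 n w) (wl0 w Ow)).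
  by move=> u u0; exact: (stop_path_map x_gt0 (T0 w Ow) (Tinc w Ow) (fun n => S0 n w) (wl0 w Ow)).
Qed.
End systems.

(** * Transfer to the coupling and conclusion *)

Section transfer.
Context (R : realType) d1 d2 (O1 : measurableType d1) (O2 : measurableType d2)
  (P1 : probability O1 R) (P2 : probability O2 R)
  (t1 b1 : nat -> O1 -> R) (t2 b2 : nat -> O2 -> R) (q : nat -> hist R -> R)
  (G : probability R R).
Hypotheses (mt1 : forall n, measurable_fun setT (t1 n)) (mb1 : forall n, measurable_fun setT (b1 n))
  (mt2 : forall n, measurable_fun setT (t2 n)) (mb2 : forall n, measurable_fun setT (b2 n)).
Hypotheses (k1 : has_kernel P1 t1 b1 q G) (k2 : has_kernel P2 t2 b2 q G).
Hypothesis same_t : forall A : set (seqM R), measurable A ->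
  P1 [set w | A (t1 ^~ w)] = P2 [set w | A (t2 ^~ w)].

Lemma kernel_integral_eq (g : hist R -> \bar R) :
  measurable_fun setT g -> (forall z, 0 <= g z)%E ->
  (\int[P1]_w g (t1 ^~ w, b1 ^~ w) = \int[P2]_w g (t2 ^~ w, b2 ^~ w))%E.
Proof.
move=> mg g0.
have mZ1 := measurable_hist mt1 mb1; have mZ2 := measurable_hist mt2 mb2.
transitivity (\int[law P1 mZ1]_z g z)%E; first by rewrite ge0_integral_law.
transitivity (\int[law P2 mZ2]_z g z)%E; last by rewrite ge0_integral_law.
apply: (@eq_measure_integral _ _ _ setT (law P2 mZ2) (law P1 mZ1)) => A mA _.
exact: (kernel_law_unique mt1 mb1 mt2 mb2 k1 k2 same_t mA).
Qed.

End transfer.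

(** A monotone [f] takes equal values at paths that agree on nonnegative times, by domination in
    both directions, so equality of the path records is avoided. *)
Lemma path_integral_eq (R : realType) (x : R) d (O : measurableType d) (P : probability O R)
    (V : O -> skorokhod R) (z : O -> hist R) (O0 : set O) (f : skorokhod R -> R) :
  measurable O0 -> P O0 = 1%E ->
  (forall w, O0 w -> forall u, 0 <= u -> V w u = path_map x (z w) u) ->
  (forall u, 0 <= f u) -> (forall u v, pathwise_le u v -> f u <= f v) ->
  (\int[P]_w (f (V w))%:E = \int[P]_w (f (path_map x (z w)))%:E)%E.
Proof.
move=> mO0 PO0 Vz f0 fm.
have mN : measurable (~` O0) by exact: measurableC.
have PN : P (~` O0) = 0%E by rewrite probability_setC// PO0 subee.
apply/eqP; rewrite eq_le; apply/andP; split; apply: (ge0_ae_le_integral_nomeas mN PN).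
- by move=> w; rewrite lee_fin.
- by move=> w; rewrite lee_fin.
- by move=> w /contrapT Ow; rewrite lee_fin; apply: fm => u u0; rewrite Vz.
- by move=> w; rewrite lee_fin.
- by move=> w; rewrite lee_fin.
- by move=> w /contrapT Ow; rewrite lee_fin; apply: fm => u u0; rewrite Vz.
Qed.

Lemma canonical_epochs_law (R : realType) d (O : measurableType d) (P : probability O R)
    (t : nat -> O -> R) (A : set (seqM R)) : (forall n, measurable_fun setT (t n)) -> measurable A ->
  canonical P [set w | A (epochs t ^~ w)] = P [set w | A (t ^~ w)].
Proof.
move=> mt mA.
have mB : measurable [set w | A (t ^~ w)].
  by rewrite -[X in measurable X]setTI; exact: (measurable_seqM mt).
rewrite (_ : [set w | A (epochs t ^~ w)] = [set w | A (t ^~ w)] `*` setT); last first.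
  by apply/seteqP; split => w //= [].
transitivity (P [set w | A (t ^~ w)] * coin R setT)%E; first exact: product_measure1E.
by rewrite [X in (_ * X)%E](_ : _ = 1%E) ?mule1//; exact: probability_setT.
Qed.

Theorem theorem3 (R : realType) (E : ptopologicalType)
  (H : probability (borel E) R)
  (Psi : R.-pker borel E ~> R)
  (Psi_pos : forall y, Psi y `]0, +oo[%classic = 1%E)
  (Phi : borel E * R -> bool)
  (Phi_meas : measurable_fun [set p : borel E * R | (0 : R) <= p.2] Phi)
  (x : R) (x_gt0 : 0 < x)
  (d : measure_display) (Omega : measurableType d) (P : probability Omega R)
  (T : nat -> {RV P >-> R}) (Y : nat -> {RV P >-> borel E})
  (S : nat -> {RV P >-> R}) (I : nat -> {RV P >-> bool})
  (W : Omega -> skorokhod R)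
  (d' : measure_display) (Omega' : measurableType d')
  (P' : probability Omega' R)
  (T' : nat -> {RV P' >-> R}) (Y' : nat -> {RV P' >-> borel E})
  (S' Z' : nat -> {RV P' >-> R}) (I' J' : nat -> {RV P' >-> bool})
  (W' : Omega' -> skorokhod R)
  (base : baseline H Psi Phi x T Y S I W)
  (ctrl : admission_controlled H Psi Phi x T' Y' S' Z' I' J' W')
  (same_epochs : same_law P' P T' T)
  (Psi_cst : forall y1 y2 A, measurable A -> Psi y1 A = Psi y2 A) :
  stoch_le P' P (fun w => stop (W' w) (hitting0 (W' w)))
                (fun w => stop (W w) (hitting0 (W w))).
Proof.
have G_pos : fiber Psi point `]0, +oo[%classic = 1%E by exact: Psi_pos.
have [b [mb kb [D0 [mO0 PO0 h0]]]] := baseline_kernel Phi_meas x_gt0 Psi_cst base.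
have [b' [q [mb' kb' qP [D1 [mO1 PO1 h1]]]]] := admission_kernel Phi_meas x_gt0 Psi_cst ctrl.
pose p := join_kernel H Phi x.
have mT n : measurable_fun setT (T n) by [].
have mT' n : measurable_fun setT (T' n) by [].
have p01 n z : 0 <= p n z <= 1 by exact: join_kernel01.
have mp n : measurable_fun setT (p n) by exact: measurable_join_kernel.
have mq n : measurable_fun setT (q n) by have [] := qP n.
have q_le n z : q n z <= p n z by have [_ _] := qP n; exact.
have q01 n z : 0 <= q n z <= 1.
  have [_ q0 _] := qP n; rewrite q0 /=.
  by apply: le_trans (q_le n z) _; have /andP[] := p01 n z.
pose G : probability R R := fiber Psi point.
(* Both runs live over the epochs of the controlled system; the baseline law is reached through
   [same_epochs]. *)
pose C : probability (Omega' * seqM bool)%type R := canonical P'.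
pose t' : nat -> Omega' -> R := fun k => T' k.
pose e := epochs t'.
pose c1 := canonical_jumps t' G q.
pose c2 := canonical_jumps t' G p.
have me n : measurable_fun setT (e n) by exact: measurable_epochs.
have mc1 n : measurable_fun setT (c1 n) by exact: measurable_canonical_jumps.
have mc2 n : measurable_fun setT (c2 n) by exact: measurable_canonical_jumps.
have k1 : has_kernel C e c1 q G by exact: canonical_kernel.
have k2 : has_kernel C e c2 p G by exact: canonical_kernel.
have s1 (A : set (seqM R)) : measurable A -> P' [set w | A (T' ^~ w)] = C [set w | A (e ^~ w)].
  by move=> mA; apply/esym; exact: canonical_epochs_law.
have s2 (A : set (seqM R)) : measurable A -> C [set w | A (e ^~ w)] = P [set w | A (T ^~ w)].
  move=> mA; transitivity (P' [set w | A (T' ^~ w)]); last exact: same_epochs.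
  exact: canonical_epochs_law.
(* Admissibility is a measurable condition on epochs and jumps, so its full probability passes to
   the coupling by equality in law. *)
have a1 : C [set w | admissible ((e ^~ w, c1 ^~ w) : hist R)] = 1%E.
  rewrite -(kernel_law_unique mT' mb' me mc1 kb' k1 s1 (@measurable_admissible R)).
  apply/eqP; rewrite eq_le probability_le1/=; last first.
    by rewrite -[X in measurable X]setTI; apply: (measurable_hist mT' mb') => //; exact: measurable_admissible.
  rewrite -PO1; apply: le_measure; rewrite ?inE//.
    by rewrite -[X in measurable X]setTI; apply: (measurable_hist mT' mb') => //; exact: measurable_admissible.
  by move=> w /h1[].
have a2 : C [set w | admissible ((e ^~ w, c2 ^~ w) : hist R)] = 1%E.
  rewrite (kernel_law_unique me mc2 mT mb k2 kb s2 (@measurable_admissible R)).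
  apply/eqP; rewrite eq_le probability_le1/=; last first.
    by rewrite -[X in measurable X]setTI; apply: (measurable_hist mT mb) => //; exact: measurable_admissible.
  rewrite -PO0; apply: le_measure; rewrite ?inE//.
    by rewrite -[X in measurable X]setTI; apply: (measurable_hist mT mb) => //; exact: measurable_admissible.
  by move=> w /h0[].
move=> f mf f0 fm; rewrite unlock.
pose g (z : hist R) := (f (path_map x z))%:E.
have mg : measurable_fun setT g.
  by apply/measurable_EFinP; exact: (measurableT_comp mf (measurable_path_map x)).
have g0 z : (0 <= g z)%E by rewrite lee_fin.
rewrite [leLHS](path_integral_eq mO1 PO1 (fun w Ow => (h1 w Ow).2) f0 fm).
rewrite [leRHS](path_integral_eq mO0 PO0 (fun w Ow => (h0 w Ow).2) f0 fm).
rewrite [leLHS](kernel_integral_eq mT' mb' me mc1 kb' k1 s1 mg g0).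
rewrite -[leRHS](kernel_integral_eq me mc2 mT mb k2 kb s2 mg g0).
pose A := [set w | admissible ((e ^~ w, c1 ^~ w) : hist R)] `&`
  [set w | admissible ((e ^~ w, c2 ^~ w) : hist R)].
have mA1 : measurable [set w | admissible ((e ^~ w, c1 ^~ w) : hist R)].
  by rewrite -[X in measurable X]setTI; apply: (measurable_hist me mc1) => //; exact: measurable_admissible.
have mA2 : measurable [set w | admissible ((e ^~ w, c2 ^~ w) : hist R)].
  by rewrite -[X in measurable X]setTI; apply: (measurable_hist me mc2) => //; exact: measurable_admissible.
have mA : measurable A by exact: measurableI.
have PA1 : C A = 1%E by exact: etrans (probability_setI1 mA1 mA2 a2) a1.
have PA : C (~` A) = 0%E by rewrite probability_setC// PA1 subee.
apply: (ge0_ae_le_integral_nomeas (measurableC mA) PA) => // w /contrapT[A1 A2].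
rewrite lee_fin; apply: fm; apply: (path_map_mono x A1 A2) => [//|n].
have coins_ge0 k : 0 <= @coins R _ Omega' k w by exact: coin_val_ge0.
have sizes_ge0 k : 0 <= sizes G k w by apply: ltW; exact: quantile_gt0.
exact: (jumps_partial_le (fun _ _ => erefl) q_le (e ^~ w) coins_ge0 sizes_ge0).
Qed.
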